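(* Let $n,n'\ge 1$ and let $Q=A_n\square A_{n'}$. Put $a=nn'(n'+1)/2$ and $b=n'n(n+1)/2$. Let $\phi_1\prec\phi_2\prec\cdots\prec\phi_a$ be any listing of all the horizontal positive roots of $Q$ such that, for $r<s$, $\lambda(\phi_r,\phi_s)\ge 0$ if $\phi_r,\phi_s$ are from the same row, and $\lambda(\phi_r,\phi_s)\le 0$ if they are from different rows. Let $\psi_1\prec\psi_2\prec\cdots\prec\psi_b$ be any listing of all the vertical positive roots of $Q$ such that, for $r<s$, $\lambda(\psi_r,\psi_s)\ge 0$ if $\psi_r,\psi_s$ are from the same column, and $\lambda(\psi_r,\psi_s)\le 0$ if they are from different columns. Then the following identity of quantum dilogarithm series holds in the completed quantum algebra $\hat{\mathbb A}_Q$: $$\mathbb E(y_{\phi_1})\,\mathbb E(y_{\phi_2})\cdots \mathbb E(y_{\phi_a})=\mathbb E(y_{\psi_1})\,\mathbb E(y_{\psi_2})\cdots \mathbb E(y_{\psi_b}).$$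
   Context: **The quiver.** $Q=A_n\square A_{n'}$ has vertex set $Q_0=\{(i,j):1\le i\le n,\ 1\le j\le n'\}$ drawn in matrix notation (row $i$, column $j$). There is exactly one arrow between $(i,j)$ and $(i,j+1)$ (horizontal arrow) and exactly one arrow between $(i,j)$ and $(i+1,j)$ (vertical arrow), and no others. Each horizontal arrow goes from its endpoint with odd coordinate sum to its endpoint with even coordinate sum; each vertical arrow goes from its endpoint with even coordinate sum to its endpoint with odd coordinate sum. (E.g. $(1,2)\to(1,1)\to(2,1)\to(2,2)\to(1,2)$.) $Q_1$ is the set of arrows; $h(c)$ and $t(c)$ are the head and tail of an arrow $c$. **Forms.** A dimension vector is a function $\gamma:Q_0\to\mathbb N$ ($\mathbb N\ni 0$); $\epsilon_{i,j}$ is the unit dimension vector at $(i,j)$. Set $\chi(\gamma_1,\gamma_2)=\sum_{v\in Q_0}\gamma_1(v)\gamma_2(v)-\sum_{c\in Q_1}\gamma_1(t(c))\gamma_2(h(c))$ and $\lambda(\gamma_1,\gamma_2)=\chi(\gamma_2,\gamma_1)-\chi(\gamma_1,\gamma_2)$. **Roots.** The horizontal positive roots are the dimension vectors $\beta^{(i)}_{k,l}=\sum_{j=k}^{l}\epsilon_{i,j}$ with $1\le i\le n$, $1\le k\le l\le n'$, tagged by their row $i$; they form a set of size $a$ (a root $\epsilon_{i,j}$ is in row $i$). The vertical positive roots are $\sum_{i=k}^{l}\epsilon_{i,j}$ with $1\le j\le n'$, $1\le k\le l\le n$, tagged by their column $j$. **Quantum algebra.** $\mathbb A_Q$ is the $\mathbb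 Q(q^{1/2})$-algebra generated by symbols $y_\gamma$, one for each dimension vector $\gamma$, subject to $y_{\gamma_1+\gamma_2}=-q^{-\frac12\lambda(\gamma_1,\gamma_2)}y_{\gamma_1}y_{\gamma_2}$. The $y_\gamma$ form a basis of it as a vector space. $\hat{\mathbb A}_Q$ is its completion in which formal power series in the $y_\gamma$ are allowed. **Quantum dilogarithm series.** $\mathbb E(z)=1+\sum_{j=1}^\infty \dfrac{(-z)^j q^{j^2/2}}{\prod_{k=1}^j(1-q^k)}$. *)

(* Defs.v *)
From HB Require Import structures.
From mathcomp Require Import all_boot all_order all_algebra.
From mathcomp Require Import boolp.
Set Implicit Arguments.
Unset Strict Implicit.
Unset Printing Implicit Defensive.
Import GRing.Theory.
Local Open Scope ring_scope.

(* Indices are 0-based: the 1-based vertex (i, j) is (i - 1, j - 1) here,       *)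
(* which leaves the parity of the coordinate sum unchanged.                     *)
Definition vertex (n n' : nat) := ('I_n * 'I_n')%type.

Definition consecutive (k l : nat) := (k.+1 == l) || (l.+1 == k).

(* [harrow u v], [varrow u v]: there is a horizontal, resp. vertical, arrow     *)
(* with tail u and head v.  The parity condition on the tail determines the     *)
(* parity of the head.                                                          *)
Definition harrow (n n' : nat) : rel (vertex n n') := fun u v =>
  [&& u.1 == v.1, consecutive u.2 v.2 & odd (u.1 + u.2)].

Definition varrow (n n' : nat) : rel (vertex n n') := fun u v =>
  [&& u.2 == v.2, consecutive u.1 v.1 & ~~ odd (u.1 + u.2)].

(* There is at most one arrow between two vertices, so an arrow c is encoded by *)
(* the pair (t(c), h(c)).                                                       *)
Definition arrows (n n' : nat) : {set vertex n n' * vertex n n'} :=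
  [set c | harrow c.1 c.2 || varrow c.1 c.2].

Definition dimv (n n' : nat) := {ffun vertex n n' -> nat}.

Definition eps (n n' : nat) (i : 'I_n) (j : 'I_n') : dimv n n' :=
  [ffun v => nat_of_bool (v == (i, j))].

Definition chi (n n' : nat) (g1 g2 : dimv n n') : int :=
  \sum_(v : vertex n n') (g1 v)%:Z * (g2 v)%:Z
  - \sum_(c in arrows n n') (g1 c.1)%:Z * (g2 c.2)%:Z.

Definition lambda (n n' : nat) (g1 g2 : dimv n n') : int :=
  chi g2 g1 - chi g1 g2.

(* [segment m p]: an interval k <= l in 'I_p, tagged by a line in 'I_m.         *)
Definition segment (m p : nat) : predArgType :=
  {x : 'I_m * ('I_p * 'I_p) | (x.2.1 <= x.2.2)%N}.

Definition line (m p : nat) (x : segment m p) : 'I_m := (val x).1.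
Definition seg_first (m p : nat) (x : segment m p) : 'I_p := (val x).2.1.
Definition seg_last (m p : nat) (x : segment m p) : 'I_p := (val x).2.2.

(* Positive roots, tagged by their row (horizontal) or column (vertical).       *)
Definition hroot (n n' : nat) := segment n n'.
Definition vroot (n n' : nat) := segment n' n.

Definition hdim (n n' : nat) (x : hroot n n') : dimv n n' :=
  \sum_(j < n' | (seg_first x <= j <= seg_last x)%N) eps (line x) j.

Definition vdim (n n' : nat) (x : vroot n n') : dimv n n' :=
  \sum_(i < n | (seg_first x <= i <= seg_last x)%N) eps i (line x).

Lemma card_segment (m p : nat) : #|segment m p| = ((m * p * p.+1) %/ 2)%N.
Proof.
rewrite card_sig.
have -> : #|[pred x : 'I_m * ('I_p * 'I_p) | (x.2.1 <= x.2.2)%N]|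
   = (m * \sum_(l < p) l.+1)%N.
  rewrite -sum1_card (eq_bigl (fun x : 'I_m * ('I_p * 'I_p) =>
    predT x.1 && (x.2.1 <= x.2.2)%N)) //.
  rewrite -(pair_big predT (fun y : 'I_p * 'I_p => (y.1 <= y.2)%N)
    (fun _ _ => 1%N)) /=.
  rewrite sum_nat_const card_ord; congr (_ * _)%N.
  rewrite -(pair_big_dep predT (fun k l : 'I_p => (k <= l)%N) (fun _ _ => 1%N)).
  rewrite (exchange_big_dep predT) //=.
  apply: eq_bigr => l _; rewrite -(big_ord_widen _ (fun _ => 1%N) (ltn_ord l)).
  by rewrite sum_nat_const card_ord muln1.
have -> : (\sum_(l < p) l.+1 = 'C(p.+1, 2))%N.
  rewrite -bin2_sum big_mkord big_ord_recl add0n.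
  by apply: eq_bigr.
have /eqP := bin_ffact p.+1 2.
rewrite !ffactnSr ffactn0 mul1n subn0 subn1 /= => /eqP.
rewrite -[(2`!)%N]/2%N [(p.+1 * p)%N]mulnC => e.
by rewrite -mulnA -e mulnA mulnK.
Qed.

(* The field Q(q^(1/2)), as the rational functions in one variable q^(1/2).     *)
Definition Qq : fieldType := {fraction {poly rat}}.
Definition qhalf : Qq := tofrac 'X.
Definition q : Qq := qhalf ^+ 2.

(* Elements of the completed quantum algebra are the formal series              *)
(* \sum_g (coef f g) y_g, over all dimension vectors g, with no restriction on  *)
(* the support.                                                                 *)
Record qalg (n n' : nat) := QAlg { coef : dimv n n' -> Qq }.

Definition y (n n' : nat) (g : dimv n n') : qalg n n' :=
  QAlg (fun d => if d == g then 1 else 0).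

Section Splits.
Variables n n' : nat.
Implicit Types g d : dimv n n'.

Definition weight g : nat := \sum_v g v.

(* The pairs of dimension vectors with sum g.                                   *)
Definition splits g : seq (dimv n n' * dimv n n') :=
  [seq p <- [seq ([ffun v => val (d v)], [ffun v => (g v - d v)%N]) |
               d : {ffun vertex n n' -> 'I_(weight g).+1}]
   | p.1 + p.2 == g].

Lemma weightD g d : weight (g + d) = (weight g + weight d)%N.
Proof. by rewrite -big_split; apply: eq_bigr => v _; rewrite ffunE. Qed.

Lemma leq_weight g v : (g v <= weight g)%N.
Proof. by rewrite /weight (bigD1 v) //= leq_addr. Qed.

Lemma weight_eq0 g : (weight g == 0) = (g == 0).
Proof.
apply/eqP/eqP => [g0|->]; last by rewrite /weight big1 // => v _; rewrite ffunE.
apply/ffunP => v; rewrite ffunE; apply/eqP.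
by rewrite -leqn0 -[X in (_ <= X)%N]g0 leq_weight.
Qed.

Lemma mem_splits g p : (p \in splits g) = (p.1 + p.2 == g).
Proof.
rewrite mem_filter andbC; apply: andb_idl => /eqP pg.
have lt v : (p.1 v < (weight g).+1)%N.
  by rewrite ltnS (leq_trans _ (leq_weight g v)) // -pg ffunE leq_addr.
apply/mapP; exists [ffun v => Ordinal (lt v)]; first by rewrite mem_enum.
case: p pg lt => p1 p2 /= pg lt; congr (_, _).
  by apply/ffunP => v; rewrite !ffunE.
apply/ffunP => v; have := congr1 (fun e : dimv n n' => e v) pg.
by rewrite !ffunE /= => <-; rewrite addKn.
Qed.

Lemma uniq_splits g : uniq (splits g).
Proof.
apply: filter_uniq; rewrite map_inj_uniq ?enum_uniq // => d e [/ffunP de _].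
by apply/ffunP => v; apply: val_inj; have := de v; rewrite !ffunE.
Qed.

Lemma chiDl g1 g2 g3 : chi (g1 + g2) g3 = chi g1 g3 + chi g2 g3.
Proof.
rewrite /chi addrACA -opprD -!big_split.
by congr (_ - _); apply: eq_bigr => v _; rewrite ffunE PoszD mulrDl.
Qed.

Lemma chiDr g1 g2 g3 : chi g1 (g2 + g3) = chi g1 g2 + chi g1 g3.
Proof.
rewrite /chi addrACA -opprD -!big_split.
by congr (_ - _); apply: eq_bigr => v _; rewrite ffunE PoszD mulrDr.
Qed.

Lemma lambdaDl g1 g2 g3 : lambda (g1 + g2) g3 = lambda g1 g3 + lambda g2 g3.
Proof. by rewrite /lambda chiDl chiDr opprD addrACA. Qed.

Lemma lambdaDr g1 g2 g3 : lambda g1 (g2 + g3) = lambda g1 g2 + lambda g1 g3.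
Proof. by rewrite /lambda chiDl chiDr opprD addrACA. Qed.

Lemma lambda0l g : lambda 0 g = 0.
Proof. by apply: (addrI (lambda 0 g)); rewrite -lambdaDl !addr0. Qed.

Lemma lambda0r g : lambda g 0 = 0.
Proof. by apply: (addrI (lambda g 0)); rewrite -lambdaDr !addr0. Qed.

End Splits.

Lemma qhalf_neq0 : qhalf != 0.
Proof. by rewrite tofrac_eq0 polyX_eq0. Qed.

Section QAlgRing.
Variables n n' : nat.
Local Notation A := (qalg n n').
Implicit Types f g h : A.

Lemma qalgP f g : (forall d, coef f d = coef g d) -> f = g.
Proof. by case: f g => [f] [g] /= /funext ->. Qed.

HB.instance Definition _ := gen_eqMixin A.
HB.instance Definition _ := gen_choiceMixin A.

Definition qalg_zero : A := QAlg (fun=> 0).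
Definition qalg_opp f : A := QAlg (fun d => - coef f d).
Definition qalg_add f g : A := QAlg (fun d => coef f d + coef g d).
Definition qalg_scale (a : Qq) f : A := QAlg (fun d => a * coef f d).

(* The relation y_(g1 + g2) = - q^(- lambda(g1, g2) / 2) y_g1 y_g2 reads        *)
(* y_g1 y_g2 = - q^(lambda(g1, g2) / 2) y_(g1 + g2); in particular the unit     *)
(* of the algebra is - y_0.                                                     *)
Definition qalg_one : A := QAlg (fun d => if d == 0 then -1 else 0).
Definition qalg_mul f g : A := QAlg (fun d =>
  \sum_(p <- splits d) - qhalf ^ lambda p.1 p.2 * (coef f p.1 * coef g p.2)).

Fact qalg_addA : associative qalg_add.
Proof. by move=> f g h; apply: qalgP => d; apply: addrA. Qed.
Fact qalg_addC : commutative qalg_add.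
Proof. by move=> f g; apply: qalgP => d; apply: addrC. Qed.
Fact qalg_add0 : left_id qalg_zero qalg_add.
Proof. by move=> f; apply: qalgP => d; apply: add0r. Qed.
Fact qalg_addN : left_inverse qalg_zero qalg_opp qalg_add.
Proof. by move=> f; apply: qalgP => d; apply: addNr. Qed.

HB.instance Definition _ :=
  GRing.isZmodule.Build A qalg_addA qalg_addC qalg_add0 qalg_addN.

Fact qalg_mulA : associative qalg_mul.
Proof.
move=> f g h; apply: qalgP => d /=.
pose W (t : dimv n n' * dimv n n' * dimv n n') : Qq :=
  qhalf ^ (lambda t.1.1 t.1.2 + lambda t.1.1 t.2 + lambda t.1.2 t.2)
  * (coef f t.1.1 * coef g t.1.2 * coef h t.2).
pose s1 := [seq (p.1, r.1, r.2) | p <- splits d, r <- splits p.2].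
pose s2 := [seq (r.1, r.2, p.2) | p <- splits d, r <- splits p.1].
transitivity (\sum_(t <- s1) W t).
  rewrite big_allpairs_dep; apply: eq_bigr => p _.
  rewrite !mulr_sumr big_seq [RHS]big_seq; apply: eq_bigr => r.
  rewrite mem_splits /W /= => /eqP <-.
  rewrite lambdaDr !(expfzDr _ _ qhalf_neq0) !mulNr !mulrN opprK.
  by rewrite mulrCA -!mulrA !(mulrCA (coef f _)).
transitivity (\sum_(t <- s2) W t).
  apply: perm_big; apply: uniq_perm.
  - apply: allpairs_uniq_dep; first exact: uniq_splits.
      by move=> p _; apply: uniq_splits.
    move=> [p r] [p' r'] /allpairsPdep[p1 [r1 [_ + [-> ->]]]].
    rewrite mem_splits => /eqP e1 /allpairsPdep[p2 [r2 [_ + [-> ->]]]].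
    rewrite mem_splits => /eqP e2 /= [ea eb ec].
    by move: e1 e2 ea eb ec; case: p1 r1 p2 r2 => [??] [??] [??] [??] /= <- <- -> -> ->.
  - apply: allpairs_uniq_dep; first exact: uniq_splits.
      by move=> p _; apply: uniq_splits.
    move=> [p r] [p' r'] /allpairsPdep[p1 [r1 [_ + [-> ->]]]].
    rewrite mem_splits => /eqP e1 /allpairsPdep[p2 [r2 [_ + [-> ->]]]].
    rewrite mem_splits => /eqP e2 /= [ea eb ec].
    by move: e1 e2 ea eb ec; case: p1 r1 p2 r2 => [??] [??] [??] [??] /= <- <- -> -> ->.
  - move=> [[a b] c]; apply/allpairsPdep/allpairsPdep => -[p [r []]];
      rewrite !mem_splits => /eqP e1 /eqP e2 [-> -> ->].
    + exists (p.1 + r.1, r.2), (p.1, r.1).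
      by split; rewrite ?mem_splits //= -addrA e2 e1.
    + exists (r.1, r.2 + p.2), (r.2, p.2).
      by split; rewrite ?mem_splits //= addrA e2 e1.
rewrite big_allpairs_dep; apply: eq_bigr => p _.
rewrite mulr_suml mulr_sumr big_seq [RHS]big_seq; apply: eq_bigr => r.
rewrite mem_splits /W /= => /eqP <-.
rewrite lambdaDl -addrA addrC !(expfzDr _ _ qhalf_neq0) !mulNr !mulrN opprK.
by rewrite -!mulrA.
Qed.

Fact qalg_mul1 : left_id qalg_one qalg_mul.
Proof.
move=> f; apply: qalgP => d /=.
rewrite (bigD1_seq (0, d)) ?uniq_splits ?mem_splits ?add0r //=.
rewrite eqxx lambda0l expr0z mulN1r mulN1r opprK big_seq_cond big1 ?addr0 //.
move=> [a b] /andP[]; rewrite mem_splits /= => /eqP <-.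
by case: (a =P 0) => [->|_ _]; rewrite ?add0r ?eqxx // mul0r mulr0.
Qed.

Fact qalg_1mul : right_id qalg_one qalg_mul.
Proof.
move=> f; apply: qalgP => d /=.
rewrite (bigD1_seq (d, 0)) ?uniq_splits ?mem_splits ?addr0 //=.
rewrite eqxx lambda0r expr0z mulN1r mulrN1 opprK big_seq_cond big1 ?addr0 //.
move=> [a b] /andP[]; rewrite mem_splits /= => /eqP <-.
by case: (b =P 0) => [->|_ _]; rewrite ?addr0 ?eqxx // !mulr0.
Qed.

Fact qalg_mulDl : left_distributive qalg_mul qalg_add.
Proof.
move=> f g h; apply: qalgP => d /=; rewrite -big_split.
by apply: eq_bigr => p _; rewrite mulrDl mulrDr.
Qed.

Fact qalg_mulDr : right_distributive qalg_mul qalg_add.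
Proof.
move=> f g h; apply: qalgP => d /=; rewrite -big_split.
by apply: eq_bigr => p _; rewrite mulrDr mulrDr.
Qed.

Fact qalg_1neq0 : qalg_one != 0.
Proof.
apply/eqP => /(congr1 (fun f => coef f 0)) /= /eqP.
by rewrite eqxx oppr_eq0 oner_eq0.
Qed.

HB.instance Definition _ := GRing.Zmodule_isNzRing.Build A
  qalg_mulA qalg_mul1 qalg_1mul qalg_mulDl qalg_mulDr qalg_1neq0.

Fact qalg_scaleA a b f : qalg_scale a (qalg_scale b f) = qalg_scale (a * b) f.
Proof. by apply: qalgP => d; apply: mulrA. Qed.
Fact qalg_scale1 : left_id 1 qalg_scale.
Proof. by move=> f; apply: qalgP => d; apply: mul1r. Qed.
Fact qalg_scaleDr : right_distributive qalg_scale +%R.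
Proof. by move=> a f g; apply: qalgP => d; apply: mulrDr. Qed.
Fact qalg_scaleDl f : {morph qalg_scale^~ f : a b / a + b}.
Proof. by move=> a b; apply: qalgP => d; apply: mulrDl. Qed.

HB.instance Definition _ := GRing.Zmodule_isLmodule.Build Qq A
  qalg_scaleA qalg_scale1 qalg_scaleDr qalg_scaleDl.

Fact qalg_scaleAl (a : Qq) f g : a *: (f * g) = (a *: f) * g.
Proof.
apply: qalgP => d /=; rewrite mulr_sumr; apply: eq_bigr => p _.
by rewrite mulrCA !mulrA.
Qed.

HB.instance Definition _ := GRing.Lmodule_isLalgebra.Build Qq A qalg_scaleAl.

Fact qalg_scaleAr (a : Qq) f g : a *: (f * g) = f * (a *: g).
Proof.
apply: qalgP => d /=; rewrite mulr_sumr; apply: eq_bigr => p _.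
by rewrite mulrCA [a * (_ * _)]mulrCA.
Qed.

HB.instance Definition _ := GRing.Lalgebra_isAlgebra.Build Qq A qalg_scaleAr.

Lemma y_relation (g1 g2 : dimv n n') :
  y (g1 + g2) = - qhalf ^ (- lambda g1 g2) *: (y g1 * y g2).
Proof.
apply: qalgP => d /=; case: eqP => [->|dn]; last first.
  rewrite big_seq big1 ?mulr0 // => p; rewrite mem_splits => /eqP e.
  case: eqP => [e1|_]; last by rewrite mul0r mulr0.
  case: eqP => [e2|_]; last by rewrite !mulr0.
  by case: dn; rewrite -e e1 e2.
rewrite (bigD1_seq (g1, g2)) ?uniq_splits ?mem_splits //= !eqxx !mulr1.
rewrite big_seq_cond big1 ?addr0 => [|[a b] /andP[_]]; last first.
  rewrite xpair_eqE negb_and /=.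
  by case/orP => /negbTE ->; rewrite ?mul0r ?mulr0 // !mulr0.
by rewrite mulrNN -expfzDr ?qhalf_neq0 // addNr expr0z.
Qed.

Lemma y0 : y 0 = -1 :> A.
Proof.
apply: qalgP => d /=; case: eqP => _; first by rewrite opprK.
by rewrite oppr0.
Qed.

(* The sign (-1)^j of the series is carried by (- z)^j in [dilog_partial].      *)
Definition dilog_coef (j : nat) : Qq :=
  qhalf ^+ (j ^ 2) / \prod_(1 <= k < j.+1) (1 - q ^+ k).

Definition dilog_partial (N : nat) (z : A) : A :=
  1 + \sum_(1 <= j < N.+1) dilog_coef j *: (- z) ^+ j.

(* E(z), for z without constant term: then z^j has no term of weight < j, so    *)
(* the coefficient at d of the series is that of the partial sum up to          *)
(* j = weight d, as confirmed by [dilogE].  If z has a constant term the value  *)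
(* is meaningless.                                                              *)
Definition dilog (z : A) : A :=
  QAlg (fun d => coef (dilog_partial (weight d) z) d).

Lemma coefD f g d : coef (f + g) d = coef f d + coef g d.
Proof. by []. Qed.

Lemma coefZ a f d : coef (a *: f) d = a * coef f d.
Proof. by []. Qed.

Lemma coef_exp_eq0 (z : A) j d :
  coef z 0 = 0 -> (weight d < j)%N -> coef (z ^+ j) d = 0.
Proof.
move=> z0; elim: j d => // j IHj d; rewrite ltnS => ledj.
rewrite exprS /= big_seq big1 // => p; rewrite mem_splits => /eqP e.
have [p10|p1n0] := eqVneq p.1 0; first by rewrite p10 z0 mul0r mulr0.
rewrite IHj ?mulr0 //; apply: leq_trans ledj.
by rewrite -e weightD -[X in (X < _)%N]add0n ltn_add2r lt0n weight_eq0.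
Qed.

Lemma dilogE (z : A) (d : dimv n n') (N : nat) :
  coef z 0 = 0 -> (weight d <= N)%N ->
  coef (dilog z) d = coef (dilog_partial N z) d.
Proof.
move=> z0 /subnKC <-; elim: (N - weight d)%N => [|k IHk]; first by rewrite addn0.
rewrite addnS {}IHk /dilog_partial [in RHS]big_nat_recr // addrA [RHS]coefD.
rewrite [X in _ = _ + X]coefZ coef_exp_eq0 ?mulr0 ?addr0 //.
  by rewrite /= z0 oppr0.
by rewrite ltnS leq_addr.
Qed.

End QAlgRing.

(* Main.v *)
Require Import Defs.
From mathcomp Require Import all_boot all_order all_algebra all_field.
From mathcomp Require Import mxabelem zify ring.
Set Implicit Arguments.
Unset Strict Implicit.
Unset Printing Implicit Defensive.
Import Order.TTheory GRing.Theory Num.Theory.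
Local Open Scope ring_scope.
Local Notation dimv := Defs.dimv.

(** Write X for q^(1/2) and (u)_k for the product of the 1 - u^i, 0 < i <= k.
Expanding the series, the coefficient at d of the product along a listing of
roots is, up to sign, the sum over the multiplicities m of the roots with
total dimension d of X^e(m) / prod (q)_(m_r), where e(m) is the sum of the m_r^2
and of the m_r m_s lambda(phi_r, phi_s) for r < s ([coef_prod_dilog]).  The
sign conditions on the listing say exactly that
2 e(m) = sum over (r, s) of 2 [r = s] m_r^2 +- |lambda(phi_r, phi_s)| m_r m_s,
with + inside a row and - across rows; so e(m) depends on the decomposition
only and not on the listing ([order_energy_abs], [listing_energy]).  There
remains an identity between a sum over the decompositions of d into intervals
of rows and the analogous sum over intervals of columns ([half_grid_sum_tr]).

Both sums are rational functions of X, so it is enough to compare them at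
X = p^(-1/2) for all primes p ([eq_by_evaluation]).  There the two sums are two
ways of computing one number.  A representation of the quiver over F_p with
dimension d consists of its row arrows h and its column arrows v; let
W(h, v) be the sum over the unit squares of the trace of the 4-cycle around the
square, with alternating signs, and let Z be the number of zeros of W.  Exchanging
rows and columns only changes the sign of W, so Z is the same for a grid and for
the transposed grid ([zero_count_tr]).  On the other hand Z is computed
by fixing the rows.

- For fixed h, split v into the arrows going down and the arrows going up.  W is
  linear in the former, so an upward part v1 contributes all of its partners if the
  linear form vanishes, and a fraction 1/p of them otherwise.  Therefore Z
  is determined by the number of the v1 on which all the linear forms vanish
  ([zeros_fixed_rows]).
- The vanishing conditions only involve two neighbouring rows at a time.  If the two
  rows are direct sums of interval representations, each pair of an
  interval I of the first and J of the second contributes one free scalar when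
  the overlap of I and J begins and ends at vertices with an upward arrow, and
  nothing otherwise ([card_coupling_kernel]).  The exponents so obtained are the
  |lambda| between different rows, up to a quantity that depends on d only ([linkedE],
  [sum_cross]).
- The number of representations of one row that are a direct sum of intervals with
  multiplicities m is a constant times s^(- E(m)) / prod (u)_(m_I),
  with s^4 = p, u = 1/p, and E(m) the part of 2 e(m) inside the row ([row_sum]).

The last point is proved by adding the vertices of the row one at a time.  The
intervals that end at the last vertex N are totally ordered by the existence
of a nonzero morphism from one to another ([maps_to]).  A new arrow out
of N is a family of vectors, one for each of these intervals; reading it along this
order, each vector either lies in the span of the previous pivots or becomes a
pivot.  In the first case an automorphism of the part already built sends
it to 0, so that only the pivots matter: their intervals are extended to N + 1 and
the others stop at N ([interval_basis_extend]).  Counting families by the labels of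
their pivots ([echelon_count]) leads to a recursion solved by a product of
q-binomial coefficients and a power of q ([pivot_sum_count]), which is the
ratio of the weights after and before the extension ([weight_step]).  An arrow
into N reduces to this case by duality ([arrow_step]). *)

(** * Dual bases of a subspace *)

Section DualBases.
Variables (F : fieldType) (D : nat).

Definition coord_proj K (S : pred 'I_K) : 'M[F]_K :=
  diag_mx (\row_b (S b)%:R).

Lemma mulmx_coord_projl K (S : pred 'I_K) n (A : 'M_(K, n)) i j :
  (coord_proj S *m A) i j = (S i)%:R * A i j.
Proof. by rewrite /coord_proj mul_diag_mx !mxE. Qed.

Lemma mulmx_coord_projr K (S : pred 'I_K) n (A : 'M_(n, K)) i j :
  (A *m coord_proj S) i j = A i j * (S j)%:R.
Proof. by rewrite /coord_proj mul_mx_diag !mxE. Qed.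

Lemma coord_projE K (S : pred 'I_K) i j :
  coord_proj S i j = ((i == j) && S i)%:R.
Proof. by rewrite !mxE; case: eqP; case: (S i). Qed.

Lemma coord_proj_idem K (S : pred 'I_K) :
  coord_proj S *m coord_proj S = coord_proj S.
Proof.
apply/matrixP => i j; rewrite mulmx_coord_projl coord_projE.
by case: (S i); rewrite ?mul1r // mul0r andbF.
Qed.

Lemma coord_projC K (S : pred 'I_K) :
  1%:M - coord_proj S = coord_proj (predC S).
Proof.
apply/matrixP => i j; rewrite !mxE /=.
by case: eqP => [->|_]; case: (S j); rewrite ?subrr ?subr0.
Qed.

Lemma rank_coord_proj K (S : pred 'I_K) : \rank (coord_proj S) = #|S|.
Proof.
have ub (S' : pred 'I_K) : (\rank (coord_proj S') <= #|S'|)%N.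
  have -> : coord_proj S' = \sum_(b in S') delta_mx b b.
    apply/matrixP => i j; rewrite coord_projE summxE.
    under eq_bigr do rewrite mxE.
    have [Si|nSi] := boolP (S' i).
      rewrite (bigD1 i) //= eqxx big1 ?addr0 ?andbT // 1?eq_sym //.
      by move=> b /andP[_ bi]; rewrite eq_sym (negbTE bi).
    rewrite andbF big1 // => b Sb; case: eqP => // ib.
    by move: nSi; rewrite ib -topredE /= in Sb *; rewrite Sb.
  rewrite -sum1_card.
  elim/big_ind2: _ => [|A a B b lA lB|b _]; first by rewrite mxrank0.
    by apply: leq_trans (mxrank_add _ _) _; apply: leq_add.
  by rewrite mxrank_delta.
have cS : (#|S| + #|predC S| = K)%N by rewrite cardC card_ord.
have : (K <= \rank (coord_proj S) + \rank (coord_proj (predC S)))%N.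
  rewrite -coord_projC -{1}(mxrank1 F K) -{1}(subrK (coord_proj S) 1%:M).
  by rewrite addnC; apply: mxrank_add.
move=> h; apply/eqP; rewrite eqn_leq ub /= -(leq_add2r #|predC S|) cS.
by apply: leq_trans h _; rewrite leq_add2l ub.
Qed.

(** The rows of B indexed by S form a basis of the row space of the projection Q,
and the columns of C are the coordinate forms; indices outside S carry zero vectors.
Keeping one index set for all vertices lets one basis vector of a representation be
followed along its interval. *)
Definition dual_bases (Q : 'M[F]_D) K (S : pred 'I_K)
    (B : 'M[F]_(K, D)) (C : 'M[F]_(D, K)) :=
  [/\ Q *m C = C, B *m Q = B, C *m B = Q & B *m C = coord_proj S].

Lemma dual_bases_projl Q K S (B : 'M_(K, D)) C :
  dual_bases Q S B C -> coord_proj S *m B = B.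
Proof. by case=> _ BQ CB <-; rewrite -mulmxA CB. Qed.

Lemma dual_bases_projr Q K S (B : 'M_(K, D)) C :
  dual_bases Q S B C -> C *m coord_proj S = C.
Proof. by case=> QC _ CB <-; rewrite mulmxA CB. Qed.

Lemma dual_bases_rank Q K S (B : 'M_(K, D)) C :
  dual_bases Q S B C -> \rank Q = #|S|.
Proof.
move=> h; rewrite -rank_coord_proj; have [QC BQ CB BC] := h.
apply/eqP; rewrite eqn_leq; apply/andP; split.
  rewrite -CB -(dual_bases_projl h).
  by apply: leq_trans (mxrankM_maxr _ _) (mxrankM_maxl _ _).
rewrite -BC -QC.
by apply: leq_trans (mxrankM_maxr _ _) (mxrankM_maxl _ _).
Qed.

(** A generating family with the right number of nonzero rows is a basis, so that
coordinates exist: any preimage of Q under B becomes a dual basis after projecting,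
because the kernel of B is spanned by the indices outside S. *)
Lemma dual_bases_exists (Q : 'M[F]_D) K (S : pred 'I_K) (B : 'M[F]_(K, D)) :
  Q *m Q = Q -> B *m Q = B -> coord_proj S *m B = B -> (Q <= B)%MS ->
  \rank Q = #|S| -> exists C, dual_bases Q S B C.
Proof.
move=> QQ BQ SB /submxP[C0 QE] rQ.
pose C := Q *m C0 *m coord_proj S; exists C.
have CB : C *m B = Q by rewrite /C -!mulmxA SB -QE QQ.
have rB : \rank B = #|S|.
  apply/eqP; rewrite eqn_leq -{1}rank_coord_proj -{1}SB mxrankM_maxl /= -rQ QE.
  exact: mxrankM_maxr.
have kB : (kermx B <= coord_proj (predC S))%MS.
  have sub : (coord_proj (predC S) <= kermx B)%MS.
    by apply/sub_kermxP; rewrite -coord_projC mulmxBl SB mul1mx subrr.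
  have [_ <-] := mxrank_leqif_sup sub.
  have cS : (#|S| + #|predC S| = K)%N by rewrite cardC card_ord.
  by rewrite mxrank_ker rB rank_coord_proj -[X in (X - _)%N]cS addKn.
split=> //; first by rewrite /C !mulmxA QQ.
apply/eqP; rewrite -subr_eq0.
have : ((B *m C - coord_proj S) <= kermx B)%MS.
  by apply/sub_kermxP; rewrite mulmxBl -mulmxA CB SB BQ subrr.
move/submx_trans/(_ kB)/submxP => [R ER].
have : (B *m C - coord_proj S) *m coord_proj S = B *m C - coord_proj S.
  by rewrite mulmxBl /C -!mulmxA !coord_proj_idem.
rewrite {1}ER -mulmxA -coord_projC mulmxBl mul1mx coord_proj_idem subrr.
by rewrite mulmx0 => <-.
Qed.

End DualBases.

(** * Interval bases of a representation of a line *)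

Section DualBasesOps.
Variables (F : fieldType) (D : nat).

Lemma dual_bases_change (Q : 'M[F]_D) K (S : pred 'I_K) B C G G' :
  dual_bases Q S B C -> G *m G' = 1%:M ->
  G *m coord_proj F S = coord_proj F S *m G ->
  dual_bases Q S (G *m B) (C *m G').
Proof.
move=> [QC BQ CB BC] GG' comm; split.
- by rewrite mulmxA QC.
- by rewrite -mulmxA BQ.
- by rewrite mulmxA -(mulmxA C) (mulmx1C GG') mulmx1.
by rewrite mulmxA -(mulmxA G) BC comm -mulmxA GG' mulmx1.
Qed.

Lemma dual_bases_pad (Q : 'M[F]_D) K k (S : pred 'I_K) (S' : pred 'I_(K + k)) B C :
  dual_bases Q S B C -> (forall b, S' (lshift k b) = S b) ->
  (forall b, S' (rshift K b) = false) ->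
  dual_bases Q S' (col_mx B 0) (row_mx C 0).
Proof.
move=> [QC BQ CB BC] Sl Sr; split.
- by rewrite mul_mx_row QC mulmx0.
- by rewrite mul_col_mx BQ mul0mx.
- by rewrite mul_row_col CB mul0mx addr0.
rewrite mul_col_row BC !mul0mx mulmx0; apply/matrixP => i j.
rewrite -[i]splitK -[j]splitK; case: (split i) => i'; case: (split j) => j' /=.
- by rewrite block_mxEul !coord_projE Sl (inj_eq (@lshift_inj _ _)).
- by rewrite block_mxEur coord_projE eq_lrshift mxE.
- by rewrite block_mxEdl coord_projE eq_rlshift mxE.
by rewrite block_mxEdr coord_projE Sr andbF mxE.
Qed.

End DualBasesOps.

Section Intervals.
Variable p : nat.

(** A pair (k, l) stands for the vertices from k to l, and may be empty. *)
Definition itv := ('I_p.+1 * 'I_p.+1)%type.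
Implicit Types (I J : itv) (o : nat -> bool).

Definition in_itv (j : nat) I : bool := (I.1 <= j <= I.2)%N.

(** The orientation o says whether the arrow between j and j.+1 leaves j. *)
Definition arrow_tail o (j : nat) := if o j then j else j.+1.
Definition arrow_head o (j : nat) := if o j then j.+1 else j.

(** The identity on the overlap is a morphism from the interval representation I
to the interval representation J: on an arrow with
tail in I and head in J, going along I and then
mapping to J agrees with mapping first and going along J. *)
Definition overlap_hom o I J := forall j,
  in_itv (arrow_tail o j) I -> in_itv (arrow_head o j) J ->
  in_itv (arrow_tail o j) J = in_itv (arrow_head o j) I.

Variables (F : fieldType) (D : nat).

(** B j and C j are dual bases of the space at the vertex j, the row space of
[pid_mx (d j)], indexed by the b whose interval contains j; and the arrows send the
basis vector b at the tail to the basis vector b at the head.  In other words the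
representation M of the first N vertices is the direct sum of the intervals I b. *)
Definition interval_basis o (d : nat -> nat) (N : nat) (M : nat -> 'M[F]_D)
    K (I : 'I_K -> itv) (B : nat -> 'M[F]_(K, D)) (C : nat -> 'M[F]_(D, K)) :=
  [/\ forall b, ((I b).1 <= (I b).2)%N && ((I b).2 < N)%N,
      forall j, (j < N)%N ->
        dual_bases (pid_mx (d j)) (fun b => in_itv j (I b)) (B j) (C j)
    & forall j, (j.+1 < N)%N ->
        M j = C (arrow_tail o j) *m B (arrow_head o j)].

Definition extend_itvs K k (I : 'I_K -> itv) (S : {set 'I_K}) (N : nat)
    (b : 'I_(K + k)) : itv :=
  match split b with
  | inl b' => if b' \in S then ((I b').1, inord N.+1) else I b'
  | inr _ => (inord N.+1, inord N.+1)
  end.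

Lemma pid_idem r : (pid_mx r : 'M[F]_D) *m (pid_mx r : 'M_D) = pid_mx r.
Proof. by rewrite mul_pid_mx minnn; apply: pid_mx_minh. Qed.

(** The new arrow sends the basis vectors at N to the rows of X + c X, where the rows
of X in S are independent.  Replacing each basis vector b by b minus the sum of the
c b b' times b' makes the images of the b outside S vanish.  This is invertible
because c squares to 0, and it respects the part already built because c only
involves pairs with a morphism from I b to I b'.  The images of the b in S are then completed
to a basis at N.+1. *)
Lemma interval_basis_extend o d N M K (I : 'I_K -> itv) B C
    (S : {set 'I_K}) (c : 'M[F]_K) (X : 'M[F]_(K, D)) :
  interval_basis o d N.+1 M I B C -> (N.+1 <= p)%N -> o N ->
  (d N.+1 <= D)%N ->
  M N = C N *m (X + c *m X) ->
  X *m pid_mx (d N.+1) = X -> coord_proj F [in S] *m X = X ->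
  \rank X = #|S| ->
  (forall b, b \in S -> in_itv N (I b)) ->
  (forall b b', c b b' != 0 ->
     [/\ b \notin S, b' \in S, in_itv N (I b), in_itv N (I b')
       & overlap_hom o (I b) (I b')]) ->
  exists k B' C',
    (k + #|S| = d N.+1)%N /\
    interval_basis o d N.+2 M (extend_itvs (k := k) I S N) B' C'.
Proof.
move=> [Iok BC arr] Np oN dD MN XP SX rX Sal cP.
pose V := ((pid_mx (d N.+1) : 'M[F]_D) :\: X)%MS.
pose k : nat := \rank V; pose Y : 'M_(k, D) := row_base V.
have XsP : (X <= (pid_mx (d N.+1) : 'M[F]_D))%MS by rewrite -{1}XP submxMl.
have rP : \rank (pid_mx (d N.+1) : 'M[F]_D) = d N.+1 by rewrite rank_pid_mx.
have capX : \rank ((pid_mx (d N.+1) : 'M[F]_D) :&: X)%MS = #|S|.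
  by rewrite (capmx_idPr XsP).
have kS : (k + #|S| = d N.+1)%N.
  by rewrite -rP -(mxrank_cap_compl (pid_mx (d N.+1) : 'M_D) X) capX addnC.
have YP : Y *m pid_mx (d N.+1) = Y.
  have : (Y <= (pid_mx (d N.+1) : 'M[F]_D))%MS.
    by rewrite eq_row_base diffmxSl.
  by case/submxP => R ->; rewrite -mulmxA pid_idem.
pose I' := extend_itvs (k := k) I S N.
have I'l b : I' (lshift k b) = if b \in S then ((I b).1, inord N.+1) else I b.
  by rewrite /I' /extend_itvs (unsplitK (inl b)).
have I'r b : I' (rshift K b) = (inord N.+1, inord N.+1).
  by rewrite /I' /extend_itvs (unsplitK (inr b)).
have vN : nat_of_ord (inord N.+1 : 'I_p.+1) = N.+1 by rewrite inordK.
have INl b : in_itv N.+1 (I' (lshift k b)) = (b \in S).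
  have /andP[h1 h2] := Iok b.
  rewrite I'l /in_itv; case: ifP => bS /=; last by apply/negP => /andP[]; lia.
  by rewrite vN leqnn andbT; lia.
have INr b : in_itv N.+1 (I' (rshift K b)) by rewrite I'r /in_itv /= vN leqnn.
have Ijl j b : (j <= N)%N -> in_itv j (I' (lshift k b)) = in_itv j (I b).
  move=> jN; rewrite I'l; case: ifP => // bS.
  have := Sal _ bS; rewrite /in_itv /= vN => /andP[h1 h2].
  by have /andP[h3 h4] := Iok b; lia.
have Ijr j b : (j <= N)%N -> in_itv j (I' (rshift K b)) = false.
  by move=> jN; rewrite I'r /in_itv /= vN; lia.
(* Y completes the independent rows of X to a basis at the new vertex. *)
have [C1 dbN] : exists C1, dual_bases (pid_mx (d N.+1))
    (fun b => in_itv N.+1 (I' b)) (col_mx X Y) C1.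
  apply: dual_bases_exists.
  - exact: pid_idem.
  - by rewrite mul_col_mx XP YP.
  - apply/matrixP => i j; rewrite mulmx_coord_projl.
    rewrite -[i]splitK; case: (split i) => i' /=.
      rewrite INl col_mxEu -[in RHS]SX mulmx_coord_projl /=.
      by [].
    by rewrite INr mul1r.
  - rewrite -addsmxE -(addsmx_diff_cap_eq (pid_mx (d N.+1) : 'M_D) X) addsmxC.
    by rewrite addsmxS // ?capmxSr // eq_row_base.
  rewrite rP -kS -!sum1_card big_split_ord /= addnC; congr addn.
    by apply: eq_bigl => b; rewrite -!topredE /= INl.
  rewrite -[k in LHS]card_ord -sum1_card.
  by apply: eq_bigl => b; rewrite -!topredE /= INr.
(* The part of c that acts at the vertex j; its square is 0, so that
   1 + cj and 1 - cj are inverse to each other. *)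
pose cj j := coord_proj F (fun b => in_itv j (I b)) *m c
             *m coord_proj F (fun b => in_itv j (I b)).
have cjE j b b' : cj j b b' = (in_itv j (I b) && in_itv j (I b'))%:R * c b b'.
  rewrite mulmx_coord_projr mulmx_coord_projl.
  by do 2 case: in_itv; rewrite ?(mul0r, mul1r, mulr1, mulr0).
have cc i j : cj i *m cj j = 0.
  apply/matrixP => b b'; rewrite !mxE big1 // => a _; rewrite !cjE.
  have [->|/cP[_ aS _ _ _]] := eqVneq (c b a) 0; first by rewrite mulr0 mul0r.
  have [->|/cP[]] := eqVneq (c a b') 0; first by rewrite !mulr0.
  by rewrite aS.
have inv j : (1%:M - cj j) *m (1%:M + cj j) = 1%:M.
  by rewrite mulmxDr mulmx1 mulmxBl mul1mx cc subr0 subrK.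
pose B' j := if j == N.+1 then col_mx X Y else col_mx ((1%:M - cj j) *m B j) 0.
pose C' j := if j == N.+1 then C1 else row_mx (C j *m (1%:M + cj j)) 0.
exists k, B', C'; split=> //; split.
- move=> b; rewrite -/I' -[b]splitK; case: (split b) => b' /=.
    rewrite I'l; have /andP[h1 h2] := Iok b'; case: ifP => _ /=; lia.
  by rewrite I'r /= vN leqnn /=; lia.
- move=> j jN; rewrite -/I' /B' /C'; case: eqP => [->//|/eqP jN1].
  have jN' : (j <= N)%N by lia.
  apply: (@dual_bases_pad _ _ _ _ _ (fun b => in_itv j (I b))).
  + apply: dual_bases_change => //; first exact: BC.
    rewrite mulmxBl mulmxBr mul1mx mulmx1; congr (_ - _).
    by rewrite /cj -!mulmxA coord_proj_idem !mulmxA coord_proj_idem.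
  + by move=> b; rewrite Ijl.
  + by move=> b; rewrite Ijr.
move=> j jN; rewrite /B' /C'.
have [->|jN1] := eqVneq j N.
  rewrite /arrow_tail /arrow_head oN eqxx ltn_eqF // mul_row_col mul0mx addr0.
  rewrite MN -!mulmxA; congr (_ *m _); rewrite mulmxDl mul1mx; congr (_ + _ *m _).
  apply/matrixP => b b'; rewrite cjE.
  have [->|/cP[_ _ -> -> _]] := eqVneq (c b b') 0; first by rewrite mulr0.
  by rewrite mul1r.
have jN' : (j.+1 < N.+1)%N by lia.
have t1 : (arrow_tail o j == N.+1) = false by rewrite /arrow_tail; case: ifP; lia.
have h1 : (arrow_head o j == N.+1) = false by rewrite /arrow_head; case: ifP; lia.
have t2 : (arrow_tail o j < N.+1)%N by rewrite /arrow_tail; case: ifP; lia.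
have h2 : (arrow_head o j < N.+1)%N by rewrite /arrow_head; case: ifP; lia.
(* On an old arrow the two base changes cancel: this is what the condition on the
   pairs (b, b') with c b b' != 0 is for. *)
rewrite t1 h1 mul_row_col mul0mx addr0 (arr _ jN').
set t := arrow_tail o j; set h := arrow_head o j.
rewrite -(dual_bases_projr (BC _ t2)) -(dual_bases_projl (BC _ h2)) -/t -/h.
rewrite -!mulmxA; congr (_ *m _); rewrite !mulmxA; congr (_ *m _).
have -> : coord_proj F (fun b => in_itv t (I b)) *m (1%:M + cj t) *m (1%:M - cj h)
    = coord_proj F (fun b => in_itv t (I b)) *m (1%:M + (cj t - cj h)).
  rewrite -mulmxA; congr (_ *m _).
  by rewrite mulmxBr mulmx1 mulmxDl mul1mx cc addr0 addrA.
rewrite -mulmxA mulmxDl mul1mx mulmxDr -[LHS]addr0; congr (_ + _).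
apply/esym/matrixP => b b'; rewrite mulmx_coord_projl mulmx_coord_projr.
have -> : (cj t - cj h) b b' = cj t b b' - cj h b b'.
  by move: (cj t) (cj h) => a1 a2; rewrite !mxE.
rewrite !cjE [RHS]mxE.
have [->|/cP[_ _ _ _ ov]] := eqVneq (c b b') 0; first by rewrite !mulr0 subr0 mul0r mulr0.
have := ov j; rewrite -/t -/h.
case: (in_itv t (I b)); last by rewrite mul0r.
case: (in_itv h (I b')); last by rewrite !mulr0.
by move=> /(_ isT isT) ->; rewrite andbT andTb subrr mul0r mulr0.
Qed.

End Intervals.

(** * Families of rows, counted by their pivots *)

Section PivotCounting.
Variables (F : finFieldType) (D e : nat) (R : comNzRingType).
Hypothesis eD : (e <= D)%N.
Let qF : nat := #|F|.

(** The sum of G over the pivot sets reached when the rows of w are read in order: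
a row in the span of the pivots S can be chosen in q^#|S| ways, any other row in
q^e - q^#|S| ways, and then it becomes a pivot. *)
Fixpoint pivot_sum K (w : seq 'I_K) (S : {set 'I_K}) (G : {set 'I_K} -> R) : R :=
  match w with
  | [::] => G S
  | b :: w' => qF%:R ^+ #|S| * pivot_sum w' S G
      + (qF%:R ^+ e - qF%:R ^+ #|S|) * pivot_sum w' (b |: S) G
  end.

(** Every row outside S is a combination of pivot rows, with coefficients in c,
and only of pivots that it is allowed to use according to ho. *)
Definition echelon K (ho : rel 'I_K) (S : {set 'I_K}) (c : 'M[F]_K)
    (X : 'M[F]_(K, D)) :=
  [/\ X *m pid_mx e = X, \rank (coord_proj F [in S] *m X) = #|S|,
      X = coord_proj F [in S] *m X + c *m (coord_proj F [in S] *m X)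
    & forall b b', c b b' != 0 -> [/\ b \notin S, b' \in S & ho b b']].

(** The rows of w are free in the row space of [pid_mx e]; the others are given by Y0. *)
Definition rows_in K (w : seq 'I_K) (Y0 : {ffun 'I_K -> 'rV[F]_D}) (b : 'I_K) :
    pred 'rV[F]_D :=
  if b \in w then [pred x | x *m pid_mx e == x] else pred1 (Y0 b).

Definition matrix_of_rows K (Y : {ffun 'I_K -> 'rV[F]_D}) : 'M[F]_(K, D) :=
  \matrix_b Y b.

Definition set_row K (Y : {ffun 'I_K -> 'rV[F]_D}) b x : {ffun 'I_K -> 'rV[F]_D} :=
  [ffun b' => if b' == b then x else Y b'].

Lemma sum_row_space (m : nat) (X : 'M[F]_(m, D)) (A A' : R) :
  X *m pid_mx e = X ->
  \sum_(x : 'rV[F]_D | x *m pid_mx e == x) (if (x <= X)%MS then A else A') =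
  qF%:R ^+ \rank X * A + (qF%:R ^+ e - qF%:R ^+ \rank X) * A'.
Proof.
move=> XP.
have sub (x : 'rV[F]_D) : (x *m pid_mx e == x) = (x <= (pid_mx e : 'M[F]_D))%MS.
  apply/eqP/idP => [<-|]; first exact: submxMl.
  by case/submxP => r ->; rewrite -mulmxA pid_idem.
have Xsub : (X <= (pid_mx e : 'M[F]_D))%MS by rewrite -XP submxMl.
rewrite (bigID (fun x : 'rV_D => (x <= X)%MS)) /=.
rewrite (eq_big (fun x => x \in rowg X) (fun _ => A)); first last.
- by move=> x /andP[_ ->].
- move=> x; rewrite inE sub; apply: andb_idl => h; exact: submx_trans h Xsub.
rewrite sumr_const card_rowg -/qF -natrX -[A in LHS]mul1r -mulrnAl; congr (_ + _).
rewrite (eq_big (fun x => x \in rowg (pid_mx e : 'M[F]_D) :\: rowg X) (fun _ => A')).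
- rewrite sumr_const cardsD (setIidPr _).
    rewrite !card_rowg rank_pid_mx // mulrnBr.
      by rewrite -!natrX mulrBl !mulr_natl.
    rewrite leq_pexp2l ?finRing_gt1 //; first by apply/card_gt0P; exists 0.
    by rewrite (leq_trans (mxrankS Xsub)) // rank_pid_mx.
  by rewrite rowgS.
- by move=> x; rewrite in_setD !inE sub andbC.
by move=> x /andP[_ /negbTE ->].
Qed.

(** Reading the rows of w from left to right: the order of w makes every row related
by ho to all pivots chosen before it, so that the row may be reduced by them. *)
Lemma echelon_count K (ho : rel 'I_K) (g : 'M[F]_(K, D) -> R) (G : {set 'I_K} -> R) :
  forall (w : seq 'I_K) (S : {set 'I_K}) (c : 'M[F]_K) (Y0 : {ffun 'I_K -> 'rV[F]_D}),
  uniq w -> pairwise (fun b b' => ho b' b) w ->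
  (forall b, b \in w -> [/\ Y0 b = 0, b \notin S, forall b', c b b' = 0
                         & forall b', b' \in S -> ho b b']) ->
  echelon ho S c (matrix_of_rows Y0) ->
  (forall (S' : {set 'I_K}) c' X', {subset S' <= S :|: [set b in w]} ->
     (forall b, b \notin w -> row b X' = Y0 b) ->
     echelon ho S' c' X' -> g X' = G S') ->
  \sum_(Y in family (rows_in w Y0)) g (matrix_of_rows Y) = pivot_sum w S G.
Proof.
elim=> [|b w IH] S c Y0.
  move=> _ _ _ ech gG /=; rewrite (big_pred1 Y0).
    apply: gG ech => //; first by move=> x; rewrite inE => ->.
    by move=> b _; rewrite rowK.
  move=> Y; apply/familyP/eqP => [h|-> b]; last by rewrite /rows_in /= inE.
  by apply/ffunP => b; apply/eqP; have := h b.
move=> /= /andP[bw uw] /andP[hob pw] st ech gG.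
have [Y0b bS cb hbS] := st b (mem_head _ _).
have [XP rX XE cP] := ech.
set X := matrix_of_rows Y0 in ech XP rX XE.
pose Xs := coord_proj F [in S] *m X.
have XsP : Xs *m pid_mx e = Xs by rewrite /Xs -mulmxA XP.
have rowsX x : matrix_of_rows (set_row Y0 b x) = X + delta_mx b 0 *m x.
  apply/row_matrixP => i; rewrite rowK ffunE linearD /= rowK row_mul.
  case: eqP => [->|/eqP ib].
    rewrite Y0b add0r [row b _](_ : _ = 1%:M) ?mul1mx //.
    by apply/matrixP => k l; rewrite !mxE !ord1 !eqxx.
  rewrite [row i _](_ : _ = 0) ?mul0mx ?addr0 //.
  by apply/rowP => k; rewrite !mxE (negbTE ib).
rewrite (partition_big (fun Y : {ffun 'I_K -> 'rV_D} => Y b)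
  (fun x => x *m pid_mx e == x)); last first.
  by move=> Y /familyP /(_ b); rewrite /rows_in mem_head inE.
rewrite -rX -(sum_row_space _ _ XsP); apply: eq_bigr => x xP.
transitivity (\sum_(Y in family (rows_in w (set_row Y0 b x))) g (matrix_of_rows Y)).
  apply: eq_bigl => Y; apply/andP/familyP => [[/familyP h /eqP Yb] b'|h].
    rewrite /rows_in ffunE; have := h b'; rewrite /rows_in inE.
    by case: eqP => [->|_] //=; rewrite (negbTE bw) !inE Yb.
  split; last first.
    by have := h b; rewrite /rows_in (negbTE bw) ffunE eqxx inE.
  apply/familyP => b'; have := h b'; rewrite /rows_in ffunE inE.
  case: eqP => [->|_] //=; rewrite (negbTE bw) !inE => /eqP ->.
  exact: xP.
(* Either x is a combination of the pivot rows, and its coefficients r' are recorded in c,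
   or b becomes a pivot. *)
case: ifPn => [/submxP[r xE]|xn].
  pose r' := r *m coord_proj F [in S].
  have xE' : x = r' *m Xs by rewrite /r' /Xs -mulmxA (mulmxA (coord_proj F _)) coord_proj_idem.
  apply: (IH S (c + delta_mx b 0 *m r')) => //.
  - move=> b' b'w; have b'bw : b' \in b :: w by rewrite inE b'w orbT.
    have [h1 h2 h3 h4] := st b' b'bw.
    have bb : b' != b by apply: contraTneq b'w => ->.
    split=> //; first by rewrite ffunE (negbTE bb).
    move=> b2; rewrite mxE h3 add0r mxE big1 // => k _.
    by rewrite !mxE (negbTE bb) mul0r.
  - rewrite /echelon rowsX mulmxDl XP -mulmxA (eqP xP).
    have -> : coord_proj F [in S] *m (X + delta_mx b 0 *m x) = Xs.
      rewrite mulmxDr mulmxA [X in _ + X *m x](_ : _ = 0) ?mul0mx ?addr0 //.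
      apply/matrixP => i j; rewrite mulmx_coord_projl !mxE.
      by case: eqP => [->|_]; rewrite ?(negbTE bS) ?mul0r ?mulr0.
    split=> //.
      by rewrite mulmxDl addrA -/Xs -XE -mulmxA -xE'.
    have cE b1 b2 : (c + delta_mx b 0 *m r') b1 b2 = c b1 b2 + (b1 == b)%:R * r' 0 b2.
      by rewrite mxE [X in _ + X]mxE big_ord1 [delta_mx _ _ _ _]mxE andbT.
    move=> b1 b2; rewrite cE; case: (b1 =P b) => [->|_].
      rewrite cb add0r mul1r /r' mulmx_coord_projr => h.
      have b2S : b2 \in S by apply: contraNT h => /negbTE /= ->; rewrite mulr0.
      by split=> //; apply: hbS.
    by rewrite mul0r addr0; apply: cP.
  move=> S' c' X' sS' rX' ech'; apply: gG ech' => //.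
    move=> b' /sS'; rewrite !inE => /orP[->//|->]; by rewrite !orbT.
  move=> b'; rewrite inE negb_or => /andP[bb b'w].
  by rewrite rX' // ffunE (negbTE bb).
apply: (IH (b |: S) c) => //.
- move=> b' b'w; have b'bw : b' \in b :: w by rewrite inE b'w orbT.
    have [h1 h2 h3 h4] := st b' b'bw.
  have bb : b' != b by apply: contraTneq b'w => ->.
  split=> //; first by rewrite ffunE (negbTE bb).
    by rewrite !inE negb_or bb.
  by move=> b2; rewrite !inE => /orP[/eqP ->|/h4//]; apply: (allP hob).
- rewrite /echelon rowsX.
  have Xs'E : coord_proj F [in b |: S] *m (X + delta_mx b 0 *m x) = Xs + delta_mx b 0 *m x.
    rewrite mulmxDr; congr (_ + _).
      apply/matrixP => i j; rewrite /Xs !mulmx_coord_projl /= !inE.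
      by case: eqP => [->|_] //=; rewrite (negbTE bS) mxE Y0b mxE !mulr0.
    rewrite mulmxA; congr (_ *m _).
    apply/matrixP => i j; rewrite mulmx_coord_projl /= !inE !mxE.
    by case: eqP => [->|_]; rewrite ?mul1r ?mulr0.
  rewrite Xs'E; split.
  + by rewrite mulmxDl XP -mulmxA (eqP xP).
  + rewrite cardsU1 bS /= -rX -/Xs; apply/eqP; rewrite eqn_leq; apply/andP; split.
      rewrite addnC; apply: leq_trans (mxrank_add _ _) _; rewrite leq_add2l.
      by apply: leq_trans (mxrankM_maxr _ _) _; rewrite rank_leq_row.
    rewrite add1n; apply: rank_ltmx; rewrite /ltmx.
    have sb : coord_proj F [in S] *m (delta_mx b 0 *m x) = 0.
      rewrite mulmxA [X in X *m x](_ : _ = 0) ?mul0mx //.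
      apply/matrixP => i j; rewrite mulmx_coord_projl !mxE.
      by case: eqP => [->|_]; rewrite ?(negbTE bS) ?mul0r ?mulr0.
    apply/andP; split.
      apply/submxP; exists (coord_proj F [in S]).
      by rewrite mulmxDr sb addr0 /Xs mulmxA coord_proj_idem.
    apply: contra xn => h; apply: submx_trans h.
    apply/submxP; exists (delta_mx 0 b).
    rewrite mulmxDr (mulmxA _ (delta_mx b 0)) mul_delta_mx -rowE /Xs row_mul.
    rewrite [row b (coord_proj _ _)](_ : _ = 0) ?mul0mx ?add0r.
      by rewrite -[delta_mx 0 0](_ : 1%:M = _) ?mul1mx //; apply/matrixP => i j; rewrite !mxE !ord1.
    by apply/rowP => j; rewrite !mxE (negbTE bS) mul0rn.
  + rewrite mulmxDr (mulmxA c (delta_mx b 0)) [c *m delta_mx b 0](_ : _ = 0) ?mul0mx ?addr0.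
      by rewrite addrAC -XE.
    apply/matrixP => i j; rewrite !mxE big1 // => k _; rewrite !mxE.
    case: eqP => [->|_]; last by rewrite mulr0.
    have [->|/cP[_]] := eqVneq (c i b) 0; first by rewrite mul0r.
    by rewrite (negbTE bS).
  move=> b1 b2 h; have [h1 h2 h3] := cP _ _ h.
  rewrite !inE h2 orbT negb_or h1 andbT; split=> //.
  by apply: contraNneq h => ->; rewrite cb.
move=> S' c' X' sS' rX' ech'; apply: gG ech' => //.
  move=> b' /sS'; rewrite !inE => /orP[/orP[->|->]|->]; by rewrite ?orbT.
move=> b'; rewrite inE negb_or => /andP[bb b'w].
by rewrite rX' // ffunE (negbTE bb).
Qed.

End PivotCounting.

(** * Pochhammer symbols and the recursion of the pivot sum *)

Section QPochhammer.
Variables (R : fieldType) (u : R).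

Definition qpoch (k : nat) : R := \prod_(1 <= i < k.+1) (1 - u ^+ i).

(** Zero at negative integers, in agreement with [qpoch_inv_step]. *)
Definition qpoch_inv (k : int) : R :=
  match k with Posz n => (qpoch n)^-1 | Negz _ => 0 end.

Hypothesis u_unity : forall k, (0 < k)%N -> 1 - u ^+ k != 0.
Hypothesis u0 : u != 0.

Lemma qpoch0 : qpoch 0 = 1.
Proof. by rewrite /qpoch big_geq. Qed.

Lemma qpochS k : qpoch k.+1 = qpoch k * (1 - u ^+ k.+1).
Proof. by rewrite /qpoch big_nat_recr. Qed.

Lemma qpoch_neq0 k : qpoch k != 0.
Proof.
by elim: k => [|k IH]; rewrite ?qpoch0 ?oner_neq0 // qpochS mulf_neq0 // u_unity.
Qed.

Lemma qpoch_inv_step (k : int) : (1 - u ^ k) * qpoch_inv k = qpoch_inv (k - 1).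
Proof.
case: k => [[|k]|k].
- by rewrite expr0z subrr mul0r sub0r.
- rewrite [Posz k.+1 - 1](_ : _ = Posz k); last by lia.
  by rewrite /= qpochS invfM mulrCA divff ?mulr1 ?u_unity.
by rewrite [qpoch_inv (Negz k)]/= mulr0 [Negz k - 1](_ : _ = Negz k.+1) //; lia.
Qed.

End QPochhammer.

Section PascalIdentity.
Variables (R : fieldType) (q : R) (T : finType) (good : rel T) (e : nat).
Let u := q^-1.
Hypothesis q0 : q != 0.
Hypothesis u_unity : forall k, (0 < k)%N -> 1 - u ^+ k != 0.
Hypothesis good_anti : forall t t', good t t' -> good t' t -> t = t'.

Lemma u_neq0 : u != 0. Proof. by rewrite invr_eq0. Qed.

Definition echelon_expo (a : T -> nat) (r : T -> int) (rho : nat) : int :=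
  \sum_t \sum_t' (good t t')%:R * ((a t)%:Z - r t) * r t'
  + rho%:Z * (\sum_t ((a t)%:Z - r t)) + e%:Z * \sum_t r t.

(** The product of the q-binomial coefficients (a t choose r t), written with
u = 1/q, times a power of q and a Pochhammer symbol: the pivot sum, times the
Pochhammer symbol of e minus the final number of pivots, when a t rows labelled t
remain to be read, r t pivots labelled t remain to be chosen, and rho pivots have been
chosen. *)
Definition echelon_number (a : T -> nat) (r : T -> int) (rho : nat) : R :=
  (\prod_t (qpoch u (a t) * qpoch_inv u (r t) * qpoch_inv u ((a t)%:Z - r t)))
  * q ^ echelon_expo a r rho * qpoch u (e - rho).

Lemma echelon_number_eq0 a r rho t :
  (r t < 0) || ((a t)%:Z < r t) -> echelon_number a r rho = 0.
Proof.
move=> h; rewrite /echelon_number (bigD1 t) //=.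
have -> : qpoch u (a t) * qpoch_inv u (r t) * qpoch_inv u ((a t)%:Z - r t) = 0.
  case/orP: h => h.
    have [k ->] : exists k, r t = Negz k by case: (r t) h => // k _; exists k.
    by rewrite /= mulr0 mul0r.
  have [k ->] : exists k, (a t)%:Z - r t = Negz k.
    have : (a t)%:Z - r t < 0 by lia.
    by case: (_ - _) => // k _; exists k.
  by rewrite /= mulr0.
by rewrite !mul0r.
Qed.

(** The q-Pascal identity for the closed form: the first term is the case where a row
labelled t0 is in the span of the pivots, the second the case where it is a new
pivot.  The hypothesis on good says that t0 comes first among the remaining labels, so that
the exponents change by quantities that do not depend on the other labels. *)
Lemma echelon_number_step (a a' : T -> nat) (r r' : T -> int) (rho : nat) t0 :
  (forall t, a' t = (a t + (t == t0))%N) ->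
  (forall t, r' t = r t - (t == t0)%:R) ->
  (forall t, (0 < a' t)%N -> good t t0) ->
  rho%:Z + \sum_t r t <= e%:Z ->
  q ^+ rho * echelon_number a r rho
    + (q ^+ e - q ^+ rho) * echelon_number a r' rho.+1
  = echelon_number a' r rho.
Proof.
move=> aE rE gd re.
(* Outside of the range of the q-binomial coefficients all the terms vanish. *)
have [/existsP[t ht]|] := boolP [exists t, (r t < 0) || ((a' t)%:Z < r t)].
  rewrite (echelon_number_eq0 _ ht) !(@echelon_number_eq0 _ _ _ t) ?mulr0 ?addr0 //.
    by move: ht; rewrite rE aE; case: (t == t0) => /=; lia.
  by move: ht; rewrite aE; lia.
rewrite negb_exists => /forallP ok.
have r_ge0 t : 0 <= r t by have := ok t; lia.
have d_ge0 t : 0 <= (a' t)%:Z - r t by have := ok t; lia.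
pose A := a' t0.
have A0 : (0 < A)%N by rewrite /A aE eqxx addn1.
have AS : a t0 = A.-1 by rewrite /A aE eqxx addn1.
have uA : 1 - u ^+ A != 0 by apply: u_unity.
have g1 t : 0 < r t -> good t t0 by move=> h; apply: gd; have := d_ge0 t; lia.
have g2 t : 0 < (a' t)%:Z - r t -> good t t0.
  by move=> h; apply: gd; have := r_ge0 t; lia.
have gg : good t0 t0 by exact: gd.
pose P t := qpoch u (a' t) * qpoch_inv u (r t) * qpoch_inv u ((a' t)%:Z - r t).
pose P0 := \prod_(t | t != t0) P t.
have qA : qpoch u A = qpoch u A.-1 * (1 - u ^+ A) by rewrite -{1 3}(prednK A0) qpochS.
have PE : \prod_t (qpoch u (a' t) * qpoch_inv u (r t) * qpoch_inv u ((a' t)%:Z - r t))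
    = P t0 * P0 by rewrite (bigD1 t0).
(* First term: the row read is not a pivot. *)
have E1 : echelon_expo a r rho = echelon_expo a' r rho - r t0 - rho%:Z.
  rewrite /echelon_expo.
  have -> : \sum_t ((a t)%:Z - r t) = \sum_t ((a' t)%:Z - r t) - 1.
    rewrite (bigD1 t0) //= [in RHS](bigD1 t0) //= aE eqxx addn1.
    rewrite (eq_bigr (fun t => (a' t)%:Z - r t)); last first.
      by move=> t /negbTE tt; rewrite aE tt addn0.
    by rewrite /=; lia.
  have -> : \sum_t \sum_t' (good t t')%:R * ((a t)%:Z - r t) * r t'
      = \sum_t \sum_t' (good t t')%:R * ((a' t)%:Z - r t) * r t' - r t0.
    rewrite (bigD1 t0) //= [in RHS](bigD1 t0) //=.
    rewrite [X in _ + X = _](eq_bigr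
      (fun t => \sum_t' (good t t')%:R * ((a' t)%:Z - r t) * r t')); last first.
      by move=> t /negbTE tt; apply: eq_bigr => t' _; rewrite aE tt addn0.
    rewrite [RHS]addrAC; congr (_ + _).
    transitivity (\sum_t' ((good t0 t')%:R * ((a' t0)%:Z - r t0) * r t'
       - (if t' == t0 then r t0 else 0))).
      apply: eq_bigr => t' _; rewrite aE eqxx PoszD.
      have [->|tt] := eqVneq t' t0.
        by rewrite gg !mul1r [Posz true](_ : _ = 1) //; ring.
      case gt: (good t0 t'); last by rewrite !mul0r subr0.
      have : r t' = 0.
        apply/eqP; rewrite eq_le r_ge0 andbT leNgt; apply: contra tt => h.
        by apply/eqP/good_anti => //; apply: g1.
      by move=> ->; rewrite !mulr0 subr0.
    by rewrite sumrB -big_mkcond big_pred1_eq.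
  by ring.
have P1 : \prod_t (qpoch u (a t) * qpoch_inv u (r t) * qpoch_inv u ((a t)%:Z - r t))
    * (1 - u ^+ A) = (1 - u ^ ((a' t0)%:Z - r t0)) * (P t0 * P0).
  rewrite (bigD1 t0) //= (eq_bigr P); last first.
    by move=> t /negbTE tt; rewrite /P aE tt addn0.
  rewrite -/P0 mulrAC mulrA; congr (_ * _).
  rewrite /P AS -/A qA.
  have -> : Posz A.-1 - r t0 = (Posz A - r t0) - 1 by lia.
  rewrite -qpoch_inv_step ?u_neq0 //; move: (u ^ _) => z.
  by ring.
have I1 : q ^+ rho * echelon_number a r rho * (1 - u ^+ A)
    = echelon_number a' r rho * (u ^ r t0 * (1 - u ^ ((a' t0)%:Z - r t0))).
  rewrite /echelon_number E1 PE; set Z := echelon_expo a' r rho.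
  rewrite [q ^ (_ - _ - _)](_ : _ = q ^ Z * q ^ (- r t0) * q ^ (- rho%:Z)); last first.
    by rewrite !expfzDr.
  have -> : u ^ r t0 = q ^ (- r t0) by rewrite /u exprz_inv.
  set X := \prod_t _ in P1 *.
  transitivity (X * (1 - u ^+ A)
    * (q ^ Z * q ^ (- r t0) * (q ^+ rho * q ^ (- rho%:Z)) * qpoch u (e - rho))).
    by ring.
  have -> : q ^+ rho * q ^ (- rho%:Z) = 1 by rewrite -exprnN divff ?expf_neq0.
  by rewrite P1; ring.
(* Second term: the row read is a pivot. *)
have P2 : \prod_t (qpoch u (a t) * qpoch_inv u (r' t) * qpoch_inv u ((a t)%:Z - r' t))
    * (1 - u ^+ A) = (1 - u ^ r t0) * (P t0 * P0).
  rewrite (bigD1 t0) //= (eq_bigr P); last first.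
    by move=> t /negbTE tt; rewrite /P aE rE tt addn0 subr0.
  rewrite -/P0 mulrAC mulrA; congr (_ * _).
  rewrite /P AS -/A qA rE eqxx.
  have -> : Posz A.-1 - (r t0 - 1) = Posz A - r t0 by lia.
  rewrite -qpoch_inv_step ?u_neq0 //; move: (u ^ r t0) => z.
  by ring.
have E2 : echelon_expo a r' rho.+1 = echelon_expo a' r rho - e%:Z.
  rewrite /echelon_expo.
  have dE t : (a t)%:Z - r' t = (a' t)%:Z - r t.
    by rewrite aE rE; case: (t == t0) => /=; lia.
  under eq_bigr => t _ do under eq_bigr => t' _ do rewrite dE.
  under [X in _ * X]eq_bigr => t _ do rewrite dE.
  have -> : \sum_t r' t = \sum_t r t - 1.
    rewrite (eq_bigr _ (fun t _ => rE t)) sumrB; congr (_ - _).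
    by rewrite (bigD1 t0) //= eqxx big1 ?addr0 // => t /negbTE ->.
  have -> : \sum_t \sum_t' (good t t')%:R * ((a' t)%:Z - r t) * r' t'
      = \sum_t \sum_t' (good t t')%:R * ((a' t)%:Z - r t) * r t'
        - \sum_t ((a' t)%:Z - r t).
    rewrite -sumrB; apply: eq_bigr => t _.
    transitivity (\sum_t' ((good t t')%:R * ((a' t)%:Z - r t) * r t'
       - (if t' == t0 then (a' t)%:Z - r t else 0))).
      apply: eq_bigr => t' _; rewrite rE.
      have [->|tt] := eqVneq t' t0; last by rewrite subr0 !subr0.
      have [h|h] := boolP (good t t0); first by rewrite !mul1r mulrBr mulr1.
      have -> : (a' t)%:Z - r t = 0; last by rewrite !mulr0 !mul0r.
      by apply/eqP; rewrite eq_le d_ge0 andbT leNgt; apply: contra h; apply: g2.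
    by rewrite sumrB -big_mkcond big_pred1_eq.
  by rewrite [Posz rho.+1](_ : _ = rho%:Z + 1); [ring|lia].
have I2 : (q ^+ e - q ^+ rho) * echelon_number a r' rho.+1 * (1 - u ^+ A)
    = echelon_number a' r rho * (1 - u ^ r t0).
  (* If rho = e no further pivot fits and the factor q ^ e - q ^ rho kills the term. *)
  have [rho_e|e_rho] := ltnP rho e.
    rewrite /echelon_number E2 PE; set Z := echelon_expo a' r rho.
    rewrite [q ^ (_ - _)](_ : _ = q ^ Z * q ^ (- e%:Z)); last by rewrite expfzDr.
    set X := \prod_t _ in P2 *.
    have qe : qpoch u (e - rho) = qpoch u (e - rho.+1) * (1 - u ^+ (e - rho)).
      by rewrite -(subnSK rho_e) qpochS.
    rewrite qe.
    have -> : q ^ (- e%:Z) = q ^- e by rewrite exprnN.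
    have -> : u ^+ (e - rho) = q ^+ rho * q ^- e.
      by rewrite /u exprVn -{2}(subnK (ltnW rho_e)) exprD invfM mulrCA divff ?mulr1 // expf_neq0.
    transitivity (X * (1 - u ^+ A)
       * (q ^ Z * qpoch u (e - rho.+1) * (q ^+ e * q ^- e - q ^+ rho * q ^- e))); first by ring.
    by rewrite P2 divff ?expf_neq0 //; ring.
  have r0 : r t0 = 0.
    have : \sum_t r t <= 0 by lia.
    rewrite (bigD1 t0) //=; set s1 := \sum_(t | _) _ => h.
    have h1 : 0 <= s1 by apply: sumr_ge0.
    by have h2 := r_ge0 t0; lia.
  rewrite r0 expr0z subrr mulr0.
  have [->|->] : rho = e \/ echelon_number a r' rho.+1 = 0.
  - left; have : 0 <= \sum_t r t by apply: sumr_ge0.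
    by lia.
  - by rewrite subrr !mul0r.
  by rewrite mulr0 mul0r.
apply: (mulIf uA); rewrite mulrDl I1 I2.
have -> : u ^+ A = u ^ r t0 * u ^ ((a' t0)%:Z - r t0).
  by rewrite -expfzDr ?u_neq0 // exprnP; congr (_ ^ _); rewrite /A; lia.
by move: (u ^ r t0) (u ^ (Posz (a' t0) - r t0)) => x y; ring.
Qed.

End PascalIdentity.

(** * Closed form of the pivot sum *)

Section PivotSumClosedForm.
Variables (F : finFieldType) (R : fieldType) (T : finType) (good : rel T) (e : nat).
Let q : R := #|F|%:R.
Let u := q^-1.
Hypothesis q0 : q != 0.
Hypothesis u_unity : forall k, (0 < k)%N -> 1 - u ^+ k != 0.
Hypothesis good_refl : reflexive good.
Hypothesis good_anti : forall t t', good t t' -> good t' t -> t = t'.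
Variables (K : nat) (lab : 'I_K -> T).

Definition label_count (S : {set 'I_K}) t : nat := #|[set b in S | lab b == t]|.

Lemma sum_label_count S : (\sum_t label_count S t = #|S|)%N.
Proof.
rewrite -sum1_card (partition_big lab predT) //=; apply: eq_bigr => t _.
by rewrite sum1_card; apply: eq_card => b; rewrite !inE.
Qed.

Lemma label_countU1 b (S : {set 'I_K}) t : b \notin S ->
  label_count (b |: S) t = (label_count S t + (t == lab b))%N.
Proof.
move=> bS; rewrite /label_count eq_sym; case: eqP => [bt|/eqP bt].
  have -> : [set b' in b |: S | lab b' == t] = b |: [set b' in S | lab b' == t].
    apply/setP => b'; rewrite !inE; case: eqP => [->|] //=.
    by rewrite bt eqxx.
  by rewrite cardsU1 !inE (negbTE bS) /= add1n addn1.
rewrite addn0; apply: eq_card => b'; rewrite !inE; case: eqP => [->|] //=.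
by rewrite (negbTE bt) (negbTE bS).
Qed.

(** Both sides obey the same recursion in w, by [echelon_number_step]. *)
Lemma pivot_sum_count (tgt : T -> nat) (w : seq 'I_K) (S : {set 'I_K}) :
  (\sum_t tgt t <= e)%N -> uniq w -> (forall b, b \in w -> b \notin S) ->
  pairwise (fun b b' => good (lab b') (lab b)) w ->
  pivot_sum F e w S (fun S' => ([forall t, label_count S' t == tgt t])%:R)
    * qpoch u (e - \sum_t tgt t)
  = echelon_number q good e (fun t => count (fun b => lab b == t) w)
      (fun t => (tgt t)%:Z - (label_count S t)%:Z) #|S|.
Proof.
move=> tgt_e; elim: w S => [|b w IH] S /=.
  move=> _ _ _; have [/forallP tS|] := boolP [forall t, label_count S t == tgt t].
    have tE t : tgt t = label_count S t by rewrite (eqP (tS t)).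
    have r0 t : (tgt t)%:Z - (label_count S t)%:Z = 0 by rewrite tE subrr.
    have -> : (\sum_t tgt t = #|S|)%N.
      by rewrite -sum_label_count; apply: eq_bigr => t _; rewrite tE.
    rewrite /echelon_number /echelon_expo big1; last first.
      by move=> t _; rewrite r0 subrr /= qpoch0 invr1 !mulr1.
    rewrite big1; last first.
      by move=> t _; rewrite big1 // => t' _; rewrite (r0 t') mulr0.
    rewrite big1; last by move=> t _; rewrite r0 subrr.
    rewrite big1; last by move=> t _; rewrite r0.
    by rewrite !mulr0 !addr0 expr0z !mul1r.
  rewrite negb_forall => /existsP[t tn]; rewrite mul0r.
  by rewrite (@echelon_number_eq0 R q T good e q0 _ _ #|S| t) //=; lia.
move=> /andP[bw uw] wS /andP[gb pw].
have bS : b \notin S by apply: wS; rewrite mem_head.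
rewrite mulrDl -!mulrA IH //; last first.
  by move=> b' b'w; apply: wS; rewrite inE b'w orbT.
rewrite IH //; last first.
  move=> b' b'w; rewrite !inE negb_or wS ?inE ?b'w ?orbT // andbT.
  by apply: contraTneq b'w => ->.
rewrite cardsU1 bS add1n.
apply: (echelon_number_step q0 u_unity good_anti (t0 := lab b)) => //.
- by move=> t; rewrite addnC eq_sym.
- by move=> t; rewrite label_countU1 // PoszD opprD addrA natz.
- move=> t; rewrite addn_gt0 lt0b -has_count => /orP[/eqP ->//|/hasP[b' b'w /eqP <-]].
  exact: (allP gb).
rewrite sumrB -!(big_morph Posz PoszD (erefl _)) sum_label_count.
by rewrite addrC subrK lez_nat.
Qed.

End PivotSumClosedForm.

(** * The antisymmetric form of a line *)

Section RowForm.
Variable p : nat.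
Local Notation itv := (itv p).
Implicit Types (I J : itv) (o : nat -> bool) (t u : 'I_p.+1).

(** The antisymmetrized Euler form of the line, evaluated on two intervals. *)
Definition row_form o I J : int :=
  \sum_(j < p) (if o j then 1 else -1) *
    ((in_itv j I && in_itv j.+1 J)%:Z - (in_itv j J && in_itv j.+1 I)%:Z).

Definition row_weight o I J : int := (I == J)%:Z *+ 2 + `|row_form o I J|.

Definition row_energy o (m : itv -> nat) : int :=
  \sum_I \sum_J row_weight o I J * ((m I)%:Z * (m J)%:Z).

Lemma row_formC o I J : row_form o I J = - row_form o J I.
Proof. by rewrite -sumrN; apply: eq_bigr => j _; rewrite -mulrN opprB. Qed.

Lemma row_form_opp o o' I J : (forall j, o' j = ~~ o j) ->
  row_form o' I J = - row_form o I J.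
Proof.
move=> oo; rewrite -sumrN; apply: eq_bigr => j _; rewrite oo -mulNr.
by case: (o j); rewrite ?opprK.
Qed.

Lemma row_formxx o I : row_form o I I = 0.
Proof. by rewrite /row_form big1 // => j _; rewrite subrr mulr0. Qed.

Lemma row_weightC o I J : row_weight o I J = row_weight o J I.
Proof. by rewrite /row_weight eq_sym row_formC normrN. Qed.

Lemma row_energy_opp o o' m : (forall j, o' j = ~~ o j) ->
  row_energy o' m = row_energy o m.
Proof.
move=> oo; apply: eq_bigr => I _; apply: eq_bigr => J _.
by rewrite /row_weight (row_form_opp _ _ oo) normrN.
Qed.

Lemma row_form_eq o I J I' J' :
  (forall j, (j < p)%N ->
     (in_itv j I && in_itv j.+1 J)%:Z - (in_itv j J && in_itv j.+1 I)%:Z =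
     (in_itv j I' && in_itv j.+1 J')%:Z - (in_itv j J' && in_itv j.+1 I')%:Z) ->
  row_form o I J = row_form o I' J'.
Proof. by move=> h; apply: eq_bigr => j _; rewrite h. Qed.

Lemma row_form_single o I J k (x : int) : (k < p)%N ->
  (forall j, (j < p)%N ->
     (in_itv j I && in_itv j.+1 J)%:Z - (in_itv j J && in_itv j.+1 I)%:Z =
     if j == k then x else 0) ->
  row_form o I J = (if o k then 1 else -1) * x.
Proof.
move=> kp h; rewrite /row_form (bigD1 (Ordinal kp)) //= h // eqxx big1 ?addr0 //.
by move=> j jk; rewrite h // (negbTE (_ : nat_of_ord j != k)) ?mulr0.
Qed.

(** The interval from t to n maps to the interval from u to n, for any n: see
[maps_to_overlap].  This is a total order on the starting points. *)
Definition maps_to o t u : bool :=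
  [|| t == u, (t < u)%N && ~~ o u.-1 | (u < t)%N && o t.-1].

Lemma maps_to_refl o : reflexive (maps_to o).
Proof. by move=> t; rewrite /maps_to eqxx. Qed.

Lemma maps_to_anti o t u : maps_to o t u -> maps_to o u t -> t = u.
Proof.
rewrite /maps_to eq_sym; case: eqP => [->//|_] /=.
by case: ltngtP => //= _; case: (o _).
Qed.

Lemma maps_to_total o : total (maps_to o).
Proof.
move=> t u; rewrite /maps_to eq_sym; case: eqP => //= /eqP tu.
by case: ltngtP tu => //= [_|_|/val_inj ->]; rewrite ?eqxx //; case: (o _).
Qed.

Lemma maps_to_trans o : transitive (maps_to o).
Proof.
move=> u t v; rewrite /maps_to.
have [->//|tu] := eqVneq t u; have [<-|uv] := eqVneq u v.
  by move=> /= ->; rewrite orbT.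
have [<-//|tv] := eqVneq t v.
rewrite /= => h1 h2; move: tu uv tv; rewrite -!(inj_eq val_inj) /=.
move: h1 h2.
case: (ltngtP t u) => //= h1; case: (ltngtP u v) => //= h2;
  case: (ltngtP t v) => //= h3; try lia; by case: (o _); case: (o _).
Qed.

Lemma maps_to_overlap o t u (n : 'I_p.+1) : (t <= n)%N -> (u <= n)%N ->
  maps_to o t u -> overlap_hom o (t, n) (u, n).
Proof.
move=> tn un tu j; rewrite /in_itv /arrow_tail /arrow_head /=.
move: tu; rewrite /maps_to -(inj_eq val_inj) /= => tu.
case oj: (o j) => h1 h2.
  have [ut|] := ltnP u t.
    by lia.
  rewrite leq_eqVlt => /orP[/eqP tu'|tu']; first lia.
  have [ju|ju] := eqVneq j u.-1; last by lia.
  by exfalso; rewrite -ju oj in tu; lia.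
have [ut|] := ltnP u t; last by lia.
have [jt|jt] := eqVneq j t.-1; last by lia.
by exfalso; rewrite -jt oj in tu; lia.
Qed.

End RowForm.

(** * Energy of a line extended by one vertex *)

Lemma big_itv (R : Type) (idx : R) (op : Monoid.com_law idx) p (f : itv p -> R) :
  \big[op/idx]_I f I = \big[op/idx]_l \big[op/idx]_k f (k, l).
Proof. by rewrite exchange_big pair_bigA; apply: eq_bigr => -[]. Qed.

Section EnergyStep.
Variables (p N : nat) (o : nat -> bool).
Hypotheses (Np : (N < p)%N) (oN : o N).
Local Notation itv := (itv p).
Implicit Types (I J : itv) (t u : 'I_p.+1).
Let v0 : 'I_p.+1 := inord N.
Let v1 : 'I_p.+1 := inord N.+1.

Lemma v0E : v0 = N :> nat. Proof. by rewrite inordK // ltnS ltnW. Qed.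
Lemma v1E : v1 = N.+1 :> nat. Proof. by rewrite inordK // ltnS. Qed.

Definition maps_sign t u : int := if maps_to o t u then -1 else 1.

Lemma row_form_common t u : (t < u)%N -> (u <= N)%N ->
  row_form o (t, v0) (u, v0) = if o u.-1 then 1 else -1.
Proof.
move=> tu uN; rewrite (@row_form_single _ o _ _ u.-1 1) ?mulr1 //; first by lia.
by move=> j jp; rewrite /in_itv /= v0E; case: eqP; lia.
Qed.

Lemma row_form_ext t u : (t <= N)%N -> (u <= N)%N ->
  row_form o (t, v0) (u, v1) = row_form o (t, v0) (u, v0) + 1.
Proof.
move=> tN uN; rewrite /row_form.
have one : 1 = \sum_(j < p) (if o j then 1 else -1) * (j == N :> nat)%:Z.
  rewrite (bigD1 (Ordinal Np)) //= oN eqxx big1 ?addr0 ?mulr1 // => j jN.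
  by rewrite (negbTE (_ : nat_of_ord j != N)) ?mulr0.
rewrite [X in _ + X]one -big_split; apply: eq_bigr => j _ /=.
rewrite -mulrDr; congr (_ * _).
by rewrite /in_itv /= v0E v1E; case: (j =P N :> nat); lia.
Qed.

Lemma row_form_ext2 t u : (t <= N)%N -> (u <= N)%N ->
  row_form o (t, v1) (u, v1) = row_form o (t, v0) (u, v0).
Proof.
move=> tN uN; apply: row_form_eq => j jp.
by rewrite /in_itv /= v0E v1E; lia.
Qed.

Lemma itv_eq t u v v' : ((t, v) == (u, v') :> itv) = (t == u) && (v == v').
Proof. by []. Qed.

Lemma v01 : (v0 == v1) = false.
Proof. by apply/eqP => /(congr1 val) /=; rewrite v0E v1E; lia. Qed.

(** The form is -1 on a pair of intervals with a morphism from the first to the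
second, and 1 otherwise; the other values needed follow by comparing the two
end points N and N.+1. *)
Lemma maps_form t u : (t <= N)%N -> (u <= N)%N -> t != u ->
  row_form o (t, v0) (u, v0) = maps_sign t u.
Proof.
move=> tN uN tu; rewrite /maps_sign /maps_to (negbTE tu) /=.
case: (ltngtP t u) => [h|h|/val_inj e].
- by rewrite row_form_common //= orbF; case: (o _).
- by rewrite row_formC row_form_common //=; case: (o _); rewrite ?opprK.
by rewrite e eqxx in tu.
Qed.

Lemma weight_common t u : (t <= N)%N -> (u <= N)%N ->
  row_weight o (t, v0) (u, v0) = 1 + (t == u)%:Z.
Proof.
move=> tN uN; rewrite /row_weight itv_eq eqxx andbT.
have [->|tu] := eqVneq t u; first by rewrite row_formxx.
by rewrite maps_form // /maps_sign; case: ifP.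
Qed.

Lemma weight_ext2 t u : (t <= N)%N -> (u <= N)%N ->
  row_weight o (t, v1) (u, v1) = 1 + (t == u)%:Z.
Proof.
move=> tN uN; rewrite -weight_common // /row_weight row_form_ext2 //.
by rewrite !itv_eq !eqxx.
Qed.

Lemma weight_ext t u : (t <= N)%N -> (u <= N)%N ->
  row_weight o (t, v0) (u, v1) = row_weight o (t, v0) (u, v0) + maps_sign t u.
Proof.
move=> tN uN; rewrite weight_common // /row_weight itv_eq v01 andbF row_form_ext //.
have [->|tu] := eqVneq t u.
  by rewrite row_formxx /maps_sign maps_to_refl.
by rewrite maps_form // /maps_sign; case: ifP.
Qed.

Lemma weight_new t : (t <= N)%N -> row_weight o (v1, v1) (t, v0) = 1.
Proof.
move=> tN; rewrite /row_weight itv_eq [v1 == v0]eq_sym v01 andbF add0r.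
rewrite (@row_form_single _ o _ _ N (-1)) ?oN // => j jp.
by rewrite /in_itv /= v0E v1E; case: eqP; lia.
Qed.

Lemma weight_new_ext t : (t <= N)%N -> row_weight o (v1, v1) (t, v1) = 1.
Proof.
move=> tN; rewrite /row_weight itv_eq [X in X && _](_ : _ = false).
  rewrite (@row_form_single _ o _ _ N (-1)) ?oN // => j jp.
  by rewrite /in_itv /= v1E; case: eqP; lia.
by apply/negP => /eqP/(congr1 val) /=; rewrite v1E; lia.
Qed.

Lemma weight_new_new : row_weight o (v1, v1) (v1, v1) = 2.
Proof. by rewrite /row_weight eqxx row_formxx. Qed.

Lemma weight_old I t : (I.1 <= I.2)%N -> (I.2 < N)%N -> (t <= N)%N ->
  row_weight o I (t, v1) = row_weight o I (t, v0).
Proof.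
case: I => k l /= kl lN tN; rewrite /row_weight !itv_eq.
have -> : (l == v1) = false by apply/eqP => /(congr1 val) /=; rewrite v1E; lia.
have -> : (l == v0) = false by apply/eqP => /(congr1 val) /=; rewrite v0E; lia.
rewrite !andbF; congr (_ + `| _ |); apply: row_form_eq => j jp.
by rewrite /in_itv /= v0E v1E; lia.
Qed.

Lemma weight_old_new I : (I.1 <= I.2)%N -> (I.2 < N)%N ->
  row_weight o I (v1, v1) = 0.
Proof.
case: I => k l /= kl lN; rewrite /row_weight !itv_eq.
have -> : (l == v1) = false by apply/eqP => /(congr1 val) /=; rewrite v1E; lia.
rewrite andbF (@row_form_single _ o _ _ N 0) ?mulr0 // => j jp.
by rewrite /in_itv /= v1E; case: eqP; lia.
Qed.

Variables m m' : itv -> nat.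
Hypothesis m_supp : forall I, m I != 0%N -> (I.1 <= I.2)%N && (I.2 <= N)%N.
Hypothesis m'_supp : forall I, m' I != 0%N -> (I.1 <= I.2)%N && (I.2 <= N.+1)%N.
Hypothesis m_old : forall I, (I.2 < N)%N -> m' I = m I.
Hypothesis m_split : forall t, (t <= N)%N -> m (t, v0) = (m' (t, v0) + m' (t, v1))%N.

(** The multiplicities m' arise from m by moving r t intervals from (t, N) to
(t, N.+1) and adding s intervals (N.+1, N.+1), so this is the
expansion of a quadratic form at a translated point.  Writing the mixed terms with
m (t, N) - r t = m' (t, N) absorbs the squares of the r t, because [maps_sign] is antisymmetric off the diagonal and -1 on it. *)
Lemma row_energy_step :
  row_energy o m' = row_energy o m
   + 2 * (\sum_(t : 'I_p.+1 | (t <= N)%N) \sum_(u : 'I_p.+1 | (u <= N)%N)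
        maps_sign t u * ((m' (t, v0))%:Z * (m' (u, v1))%:Z))
   + 2 * (m' (v1, v1))%:Z * (\sum_(t : 'I_p.+1 | (t <= N)%N) (m (t, v0))%:Z)
   + 2 * (m' (v1, v1))%:Z * (m' (v1, v1))%:Z.
Proof.
pose r t : int := (m' (t, v1))%:Z; pose s : int := (m' (v1, v1))%:Z.
pose kr I J : int := (I == J)%:Z.
pose Dl I : int := \sum_(t : 'I_p.+1 | (t <= N)%N) r t * (kr I (t, v1) - kr I (t, v0))
  + s * kr I (v1, v1).
pose A I J : int := row_weight o I J.
have pick (f : itv -> int) J : \sum_I f I * kr I J = f J.
  rewrite (bigD1 J) //= /kr eqxx mulr1 big1 ?addr0 // => I /negbTE ->.
  by rewrite mulr0.
have sumD (f : itv -> int) : \sum_I f I * Dl I =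
    \sum_(t : 'I_p.+1 | (t <= N)%N) r t * (f (t, v1) - f (t, v0)) + s * f (v1, v1).
  rewrite /Dl; under eq_bigr do rewrite mulrDr mulr_sumr.
  rewrite big_split exchange_big /=; congr (_ + _).
    apply: eq_bigr => t _; rewrite -!pick -sumrB mulr_sumr.
    by apply: eq_bigr => I _; ring.
  by rewrite -[in RHS]pick mulr_sumr; apply: eq_bigr => I _; ring.
have m'E I : (m' I)%:Z = (m I)%:Z + Dl I.
  case: I => k l; rewrite /Dl /kr.
  have [lN|lN|lN] := ltngtP l N.
  - rewrite m_old // big1 ?add0r; last first.
      move=> t _; rewrite !itv_eq.
      have -> : (l == v1) = false by apply/eqP => /(congr1 val) /=; rewrite v1E; lia.
      have -> : (l == v0) = false by apply/eqP => /(congr1 val) /=; rewrite v0E; lia.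
      by rewrite !andbF mulr0.
    have -> : ((k, l) == (v1, v1)) = false.
      by apply/eqP => -[_ /(congr1 val)] /=; rewrite v1E; lia.
    by rewrite mulr0 addr0.
  - have lv0 : (l == v0) = false by apply/eqP => /(congr1 val) /=; rewrite v0E; lia.
    have m0 : m (k, l) = 0%N by apply/eqP; apply: contraTT isT => /m_supp /=; lia.
    have [/eqP lv1|lv1] := boolP (l == v1); last first.
      have -> : m' (k, l) = 0%N.
        apply/eqP; apply: contraTT isT => /m'_supp /= h.
        by case/eqP: lv1; apply: val_inj; rewrite /= v1E; lia.
      rewrite m0 big1 ?add0r; last first.
        by move=> t _; rewrite !itv_eq lv0 (negbTE lv1) !andbF mulr0.
      by rewrite itv_eq (negbTE lv1) andbF mulr0.
    rewrite m0 add0r lv1; have [kN|kN] := leqP k N.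
      rewrite (bigD1 k) //= big1; last first.
        move=> t /andP[_ tk]; rewrite !itv_eq [k == t]eq_sym (negbTE tk).
        by rewrite mulr0.
      rewrite !itv_eq !eqxx [v1 == v0]eq_sym v01 /=.
      have -> : (k == v1) = false by apply/eqP => /(congr1 val) /=; rewrite v1E; lia.
      by rewrite mulr0 subr0 mulr1 !addr0.
    rewrite big1 ?add0r; last first.
      move=> t tN; rewrite !itv_eq [v1 == v0]eq_sym v01 andbF subr0.
      by rewrite (_ : (k == t) = false) ?mulr0 //; apply/eqP => e; rewrite e in kN; lia.
    rewrite itv_eq eqxx andbT; case: eqP => [->|kv1]; first by rewrite mulr1.
    rewrite mulr0; apply/eqP; rewrite eqz_nat; apply: contraTT isT => /m'_supp /= h.
    by case: kv1; apply: val_inj; rewrite /= v1E; move: h; rewrite v1E; lia.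
  have lv : l = v0 by apply: val_inj; rewrite /= v0E.
  rewrite lv; have -> : ((k, v0) == (v1, v1)) = false by rewrite itv_eq v01 andbF.
  rewrite mulr0 addr0; have [kN|kN] := leqP k N.
    rewrite (bigD1 k) //= big1; last first.
      move=> t /andP[_ tk]; rewrite !itv_eq [k == t]eq_sym (negbTE tk).
      by rewrite mulr0.
    by rewrite !itv_eq !eqxx v01 andbF m_split // /r PoszD; lia.
  have -> : m' (k, v0) = 0%N.
    by apply/eqP; apply: contraTT isT => /m'_supp /=; rewrite v0E; lia.
  have -> : m (k, v0) = 0%N.
    by apply/eqP; apply: contraTT isT => /m_supp /=; rewrite v0E; lia.
  rewrite big1 // => t tN; rewrite !itv_eq.
  by rewrite (_ : (k == t) = false) ?mulr0 //; apply/eqP => e; rewrite e in kN; lia.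
pose phi J : int := \sum_I A I J * (m I)%:Z.
pose psi J : int := \sum_I A I J * Dl I.
have -> : row_energy o m' = row_energy o m + 2 * \sum_J phi J * Dl J + \sum_J psi J * Dl J.
  rewrite /row_energy.
  transitivity (\sum_I \sum_J (A I J * ((m I)%:Z * (m J)%:Z)
     + A J I * (m J)%:Z * Dl I + A I J * (m I)%:Z * Dl J + A I J * Dl I * Dl J)).
    apply: eq_bigr => I _; apply: eq_bigr => J _; rewrite !m'E /A (row_weightC o J I).
    by ring.
  have sum2 : \sum_I \sum_J A J I * (m J)%:Z * Dl I = \sum_J phi J * Dl J.
    by apply: eq_bigr => I _; rewrite mulr_suml.
  have sum3 : \sum_I \sum_J A I J * (m I)%:Z * Dl J = \sum_J phi J * Dl J.
    by rewrite exchange_big; apply: eq_bigr => J _; rewrite mulr_suml.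
  have sum4 : \sum_I \sum_J A I J * Dl I * Dl J = \sum_J psi J * Dl J.
    by rewrite exchange_big; apply: eq_bigr => J _; rewrite mulr_suml.
  under eq_bigr do rewrite !big_split /=.
  by rewrite !big_split /= sum2 sum3 sum4; ring.
rewrite !sumD.
have phiD t : (t <= N)%N -> phi (t, v1) - phi (t, v0) =
    \sum_(k : 'I_p.+1 | (k <= N)%N) (m (k, v0))%:Z * maps_sign k t.
  move=> tN; rewrite /phi -sumrB.
  rewrite big_itv (bigD1 v0) //= [X in _ + X]big1 ?addr0.
    rewrite [RHS]big_mkcond; apply: eq_bigr => k _; case: ifP => kN.
      by rewrite /A weight_ext //; ring.
    have -> : m (k, v0) = 0%N.
      by apply/eqP; apply: contraTT isT => /m_supp /=; rewrite v0E; lia.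
    by rewrite !mulr0.
  move=> l lv; apply: big1 => k _; have [->|/m_supp /= h] := eqVneq (m (k, l)) 0%N.
    by rewrite !mulr0.
  have lN : (l < N)%N.
    by rewrite ltn_neqAle; case/andP: h => _ ->; rewrite andbT -v0E.
  by rewrite /A weight_old //=; [ring|case/andP: h].
have phiS : phi (v1, v1) = \sum_(k : 'I_p.+1 | (k <= N)%N) (m (k, v0))%:Z.
  rewrite /phi big_itv (bigD1 v0) //= [X in _ + X]big1 ?addr0.
    rewrite [RHS]big_mkcond; apply: eq_bigr => k _; case: ifP => kN.
      by rewrite /A row_weightC weight_new // mul1r.
    have -> : m (k, v0) = 0%N.
      by apply/eqP; apply: contraTT isT => /m_supp /=; rewrite v0E; lia.
    by rewrite !mulr0.
  move=> l lv; apply: big1 => k _; have [->|/m_supp /= h] := eqVneq (m (k, l)) 0%N.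
    by rewrite !mulr0.
  have lN : (l < N)%N.
    by rewrite ltn_neqAle; case/andP: h => _ ->; rewrite andbT -v0E.
  by rewrite /A weight_old_new ?mul0r //=; case/andP: h.
have psiE J : psi J = \sum_(t : 'I_p.+1 | (t <= N)%N) r t * (A (t, v1) J - A (t, v0) J)
    + s * A (v1, v1) J.
  by rewrite /psi (sumD (fun I => A I J)).
have psiD u : (u <= N)%N -> psi (u, v1) - psi (u, v0) = 2 * r u.
  move=> uN; rewrite !psiE /A weight_new // weight_new_ext // opprD addrACA subrr addr0.
  rewrite -sumrB (bigD1 u) //= big1 ?addr0.
    rewrite weight_ext2 // weight_common // (row_weightC o (u, v1) (u, v0)) weight_ext //.
    by rewrite weight_common // eqxx /maps_sign maps_to_refl; ring.
  move=> t /andP[tN tu]; rewrite weight_ext2 // weight_common //.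
  rewrite (row_weightC o (t, v1) (u, v0)) !weight_ext // !weight_common //.
  rewrite [u == t]eq_sym (negbTE tu) /maps_sign.
  have := maps_to_total o t u; have := @maps_to_anti _ o t u.
  case: (maps_to o t u); case: (maps_to o u t) => //= h _; try ring.
  by rewrite h ?eqxx in tu.
have psiS : psi (v1, v1) = 2 * s.
  rewrite psiE /A weight_new_new big1 ?add0r; first by ring.
  move=> t tN; rewrite ![row_weight o (t, _) _]row_weightC weight_new //.
  by rewrite weight_new_ext // subrr mulr0.
rewrite phiS psiS.
rewrite (eq_bigr (fun t => r t * \sum_(k : 'I_p.+1 | (k <= N)%N) (m (k, v0))%:Z * maps_sign k t)); last first.
  by move=> t tN; rewrite phiD.
rewrite [\sum_(t < p.+1 | (t <= N)%N) r t * (psi _ - _)](eq_bigr (fun t => 2 * (r t * r t))); last first.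
  by move=> t tN; rewrite psiD //; ring.
have anti : \sum_(t : 'I_p.+1 | (t <= N)%N) \sum_(k : 'I_p.+1 | (k <= N)%N)
    (r k * r t) * maps_sign k t = - \sum_(t : 'I_p.+1 | (t <= N)%N) r t * r t.
  set X := LHS.
  have XX : X + X = - (\sum_(t : 'I_p.+1 | (t <= N)%N) r t * r t) *+ 2.
    rewrite {2}/X exchange_big /X -big_split -sumrN -sumrMnl; apply: eq_bigr => t tN /=.
    rewrite -big_split (bigD1 t) //= big1 ?addr0.
      by rewrite /maps_sign maps_to_refl; ring.
    move=> k /andP[kN kt]; rewrite /maps_sign.
    have := maps_to_total o t k; have := @maps_to_anti _ o t k.
    case: (maps_to o t k); case: (maps_to o k t) => //= h _; try ring.
    by rewrite h ?eqxx in kt.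
  by lia.
have -> : \sum_(t : 'I_p.+1 | (t <= N)%N) r t *
    \sum_(k : 'I_p.+1 | (k <= N)%N) (m (k, v0))%:Z * maps_sign k t
  = \sum_(t : 'I_p.+1 | (t <= N)%N) \sum_(u : 'I_p.+1 | (u <= N)%N)
        maps_sign t u * ((m' (t, v0))%:Z * (m' (u, v1))%:Z)
    - \sum_(t : 'I_p.+1 | (t <= N)%N) r t * r t.
  rewrite -anti exchange_big /= -big_split; apply: eq_bigr => t tN.
  rewrite mulr_sumr -big_split; apply: eq_bigr => k kN /=.
  by rewrite m_split // PoszD /r; ring.
by rewrite -mulr_sumr /s; ring.
Qed.

End EnergyStep.

(** * Multiplicities of intervals *)

Section Types.
Variables (F : fieldType) (D p : nat) (d : nat -> nat).
Hypothesis dD : forall j, (d j <= D)%N.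
Local Notation itv := (itv p).
Implicit Types (o : nat -> bool) (M : nat -> 'M[F]_D).

Definition mults := {ffun itv -> 'I_D.+1}.
Implicit Types m : mults.

Definition mult K (I : 'I_K -> itv) (J : itv) : nat := #|[set b | I b == J]|.

(** The decompositions of d, restricted to the first N vertices, into intervals. *)
Definition valid N m : bool :=
  [forall J, (m J != 0%N :> nat) ==> (J.1 <= J.2 < N)%N]
  && [forall j : 'I_p.+1, (j < N)%N ==> (\sum_(J : itv | in_itv j J) m J == d j)%N].

Definition has_mults o N M m :=
  exists K (I : 'I_K -> itv) B C,
    interval_basis o d N M I B C /\ forall J, m J = mult I J :> nat.

Lemma validP N m : reflect
  ((forall J, m J != 0%N :> nat -> (J.1 <= J.2 < N)%N) /\
   (forall j, (j <= p)%N -> (j < N)%N -> (\sum_(J : itv | in_itv j J) m J = d j)%N))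
  (valid N m).
Proof.
apply: (iffP andP) => [[/forallP h1 /forallP h2]|[h1 h2]]; split.
- by move=> J; apply/implyP.
- move=> j jp jN; have jp' : (j < p.+1)%N by rewrite ltnS.
  by have /implyP/(_ jN)/eqP := h2 (Ordinal jp').
- by apply/forallP => J; apply/implyP/h1.
by apply/forallP => j; apply/implyP => jN; apply/eqP/h2; rewrite // -ltnS.
Qed.

Lemma sum_mult K (I : 'I_K -> itv) (P : pred itv) :
  (\sum_(J | P J) mult I J = #|[pred b | P (I b)]|)%N.
Proof.
rewrite -sum1_card (partition_big I P) //=.
apply: eq_bigr => J PJ; rewrite /mult -sum1_card.
by apply: eq_bigl => b; rewrite !inE; case: eqP => [->|]; rewrite ?PJ ?andbF.
Qed.

Lemma interval_basis_mult o N M K (I : 'I_K -> itv) B C j :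
  (j <= p)%N -> interval_basis o d N M I B C -> (j < N)%N ->
  (\sum_(J | in_itv j J) mult I J = d j)%N.
Proof.
move=> jp [_ db _] jN; rewrite sum_mult.
by rewrite -(dual_bases_rank (db _ jN)) rank_pid_mx.
Qed.

Lemma mult_leq o N M K (I : 'I_K -> itv) B C J :
  interval_basis o d N M I B C -> (mult I J <= D)%N.
Proof.
move=> h; have [b /eqP bJ|no] := pickP (fun b => I b == J); last first.
  by rewrite /mult eq_card0 // => b; rewrite inE no.
have [Iok _ _] := h; have /andP[h1 h2] := Iok b; rewrite bJ in h1 h2.
have jp : (J.1 <= p)%N by rewrite -ltnS.
apply: leq_trans (dD J.1); rewrite -(interval_basis_mult jp h); last first.
  exact: leq_ltn_trans h1 h2.
by rewrite (bigD1 J) ?leq_addr //= /in_itv leqnn.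
Qed.

Definition mults_of K (I : 'I_K -> itv) : mults := [ffun J => inord (mult I J)].

Lemma mults_ofE o N M K (I : 'I_K -> itv) B C J :
  interval_basis o d N M I B C -> mults_of I J = mult I J :> nat.
Proof. by move=> h; rewrite ffunE inordK // ltnS; apply: mult_leq h. Qed.

Lemma mult_neq0 K (I : 'I_K -> itv) J : mult I J != 0%N -> exists b, I b = J.
Proof.
by rewrite -lt0n => /card_gt0P[b]; rewrite inE => /eqP <-; exists b.
Qed.

Lemma has_mults_valid o N M m : (N <= p.+1)%N -> has_mults o N M m -> valid N m.
Proof.
move=> Np [K [I [B [C [h mE]]]]]; apply/validP; split.
  move=> J; rewrite mE => /mult_neq0[b <-]; by case: h.
move=> j jp jN; rewrite -(interval_basis_mult jp h jN).
by apply: eq_bigr => J _.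
Qed.

Lemma valid_last N m : (N <= p)%N -> valid N.+1 m ->
  (\sum_k m (k, inord N) = d N)%N.
Proof.
move=> Np /validP[supp /(_ N Np (ltnSn N)) <-].
rewrite [RHS]big_mkcond /= [RHS]big_itv [RHS](bigD1 (inord N)) //=.
rewrite [X in (_ + X)%N]big1 ?addn0.
  apply: eq_bigr => k _; rewrite /in_itv /= inordK ?ltnS // leqnn andbT.
  case: ifP => // kN; apply/eqP; apply: contraFT kN => /supp /=.
  by rewrite inordK ?ltnS // => /andP[].
move=> l lN; apply: big1 => k _; case: ifP => //; rewrite /in_itv /= => /andP[h1 h2].
apply/eqP; apply: contraTT isT => /supp /= /andP[h3 h4].
by case/eqP: lN; apply: val_inj; rewrite /= inordK ?ltnS //; apply/eqP; rewrite eqn_leq h2 andbT -ltnS.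
Qed.

(** m is what m' becomes on the vertices up to N: intervals ending at N.+1 are cut. *)
Definition restricts N (m m' : mults) : bool :=
  [forall J : itv, (J.2 < N)%N ==> (m' J == m J)]
  && [forall t : 'I_p.+1, (t <= N)%N ==>
        (m (t, inord N) == m' (t, inord N) + m' (t, inord N.+1) :> nat)%N].

Lemma restrictsP N m m' : reflect
  ((forall J : itv, (J.2 < N)%N -> m' J = m J) /\
   (forall t : 'I_p.+1, (t <= N)%N ->
     (m (t, inord N) = m' (t, inord N) + m' (t, inord N.+1) :> nat)%N))
  (restricts N m m').
Proof.
apply: (iffP andP) => [[/forallP h1 /forallP h2]|[h1 h2]]; split.
- by move=> J /(implyP (h1 J))/eqP.
- by move=> t /(implyP (h2 t))/eqP.
- by apply/forallP => J; apply/implyP => /h1 ->.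
by apply/forallP => t; apply/implyP => /h2 ->.
Qed.

Definition restr N (m' : mults) : mults := [ffun J : itv =>
  if (J.2 < N)%N then m' J
  else if (J.2 == inord N) && (J.1 <= N)%N
    then inord (m' (J.1, inord N) + m' (J.1, inord N.+1)) else ord0].

Lemma restr_split_leq N m' (t : 'I_p.+1) : (N < p)%N -> valid N.+2 m' ->
  (t <= N)%N -> (m' (t, inord N) + m' (t, inord N.+1) <= D)%N.
Proof.
move=> Np /validP[supp dims] tN; apply: leq_trans (dD N).
rewrite -(dims N); [|exact: ltnW|exact: leqW].
have vN : nat_of_ord (inord N : 'I_p.+1) = N by rewrite inordK // ltnS ltnW.
have vN1 : nat_of_ord (inord N.+1 : 'I_p.+1) = N.+1 by rewrite inordK // ltnS.
rewrite (bigD1 (t, inord N)) /= ?leq_add2l; last by rewrite /in_itv /= vN tN leqnn.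
rewrite (bigD1 (t, inord N.+1)) /= ?leq_addr // /in_itv /= vN1 tN leqnSn /=.
by apply/eqP => -[/(congr1 val)] /=; rewrite vN vN1; lia.
Qed.

Lemma restrE N m m' : (N < p)%N -> valid N.+1 m -> valid N.+2 m' ->
  (restr N m' == m) = restricts N m m'.
Proof.
move=> Np vm vm'; have vN : nat_of_ord (inord N : 'I_p.+1) = N.
  by rewrite inordK // ltnS ltnW.
apply/eqP/restrictsP => [<-|[h1 h2]].
  split=> [J JN|t tN]; rewrite ffunE /= ?JN // vN ltnn eqxx tN /=.
  by rewrite inordK // ltnS restr_split_leq.
apply/ffunP => J; rewrite ffunE; case: ifP => [/h1//|/negbT JN].
have /validP[supp _] := vm.
case: ifP => [/andP[/eqP Jv J1N]|/negbT h].
  apply: val_inj; rewrite /= inordK ?ltnS ?restr_split_leq // -h2 // -Jv.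
  by case: J {JN Jv J1N}.
apply: val_inj => /=; apply/esym/eqP; apply: contraNT h => /supp /andP[h3 h4].
have e : J.2 = N :> nat by apply/eqP; rewrite eqn_leq -ltnS h4 leqNgt.
by rewrite -(inj_eq val_inj) /= vN e eqxx -e h3.
Qed.

Lemma restr_valid N m' : (N < p)%N -> valid N.+2 m' -> valid N.+1 (restr N m').
Proof.
move=> Np vm'; have vN : nat_of_ord (inord N : 'I_p.+1) = N.
  by rewrite inordK // ltnS ltnW.
have vN1 : nat_of_ord (inord N.+1 : 'I_p.+1) = N.+1 by rewrite inordK // ltnS.
have /validP[supp dims] := vm'.
apply/validP; split.
  move=> J; rewrite ffunE; case: ifP => [JN /supp/andP[-> _]|_].
    exact: leqW.
  case: ifP => // /andP[/eqP -> J1] _; by rewrite vN J1 ltnSn.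
move=> j jp jN; rewrite -(dims j) //; last exact: leqW.
rewrite !(big_mkcond (fun J => in_itv _ J)) !big_itv /=.
rewrite (bigD1 (inord N)) //= [in RHS](bigD1 (inord N)) //=.
rewrite [X in _ = (_ + X)%N](bigD1 (inord N.+1)) /=; last first.
  by apply/eqP => /(congr1 val) /=; rewrite vN vN1; lia.
rewrite addnA; congr addn.
  rewrite -big_split; apply: eq_bigr => k _ /=.
  rewrite ffunE /= vN ltnn eqxx /= /in_itv /= vN vN1.
  have -> : (j <= N)%N by rewrite -ltnS.
  have -> : (j <= N.+1)%N by exact: ltnW.
  rewrite !andbT; case: ifP => // kj.
  have kN : (k <= N)%N by apply: leq_trans kj _; rewrite -ltnS.
  by rewrite kN inordK // ltnS restr_split_leq.
rewrite [X in X = _](bigD1 (inord N.+1)) /=; last first.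
  by apply/eqP => /(congr1 val) /=; rewrite vN vN1; lia.
rewrite big1 ?add0n; last first.
  move=> k _; case: ifP => // _; rewrite ffunE /= vN1 ltnNge leqnSn /=.
  by rewrite -(inj_eq val_inj) /= vN vN1 gtn_eqF.
apply: eq_bigr => l /andP[l1 l2]; apply: eq_bigr => k _; case: ifP => // _.
rewrite ffunE /= (negbTE l1) /=; case: ifP => // lN.
apply/esym/eqP; apply: contraFT lN => /supp /= /andP[_ h].
move: l1 l2; rewrite -!(inj_eq val_inj) /= vN vN1; lia.
Qed.

(** Multiplicities on N.+2 vertices are determined by their restriction and by the
number of intervals of each kind that are extended; the intervals starting at N.+1 fill
up the dimension. *)
Lemma valid_unique N m m1 m2 : (N < p)%N -> valid N.+2 m1 -> valid N.+2 m2 ->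
  restricts N m m1 -> restricts N m m2 ->
  (forall t : 'I_p.+1, (t <= N)%N -> m1 (t, inord N.+1) = m2 (t, inord N.+1) :> nat) ->
  m1 = m2.
Proof.
move=> Np v1 v2 /restrictsP[r11 r12] /restrictsP[r21 r22] e.
have vN : nat_of_ord (inord N : 'I_p.+1) = N by rewrite inordK // ltnS ltnW.
have vN1 : nat_of_ord (inord N.+1 : 'I_p.+1) = N.+1 by rewrite inordK // ltnS.
have /validP[s1 _] := v1; have /validP[s2 _] := v2.
have l1 := valid_last Np v1; have l2 := valid_last Np v2.
apply/ffunP => -[k l]; apply: val_inj => /=.
have zero (f : mults) : (forall J, f J != 0%N :> nat -> (J.1 <= J.2 < N.+2)%N) ->
    ~~ (k <= l < N.+2)%N -> f (k, l) = 0%N :> nat.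
  by move=> sf h; apply/eqP; apply: contraNT h => /sf.
have [/andP[kl lN]|h] := boolP (k <= l < N.+2)%N; last by rewrite (zero _ s1) // (zero _ s2).
have [lN'|lN'|lN'] := ltngtP l N.
- by rewrite r11 // r21.
- have -> : l = inord N.+1 by apply: val_inj; rewrite /= vN1; lia.
  have [kN|kN] := leqP k N; first exact: e.
  have -> : k = inord N.+1 by apply: val_inj; rewrite /= vN1; lia.
  move: l1; rewrite -l2 (bigD1 (inord N.+1)) //= [in RHS](bigD1 (inord N.+1)) //=.
  rewrite [X in (_ + X)%N = _](eq_bigr (fun t => nat_of_ord (m2 (t, inord N.+1)))).
    by move/addIn.
  move=> t tN; have [tN'|tN'] := leqP t N; first exact: e.
  have h (f : mults) : (forall J, f J != 0%N :> nat -> (J.1 <= J.2 < N.+2)%N) ->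
      f (t, inord N.+1) = 0%N :> nat.
    move=> sf; apply/eqP; apply: contraNT tN => /sf /= /andP[].
    by rewrite vN1 -(inj_eq val_inj) /= vN1; lia.
  by rewrite (h m1) // (h m2).
have -> : l = inord N by apply: val_inj; rewrite /= vN.
have kN : (k <= N)%N by rewrite -lN'.
by have := r12 _ kN; rewrite (r22 _ kN) (e _ kN) => /addIn ->.
Qed.

End Types.

(** * Weight of a line extended by one vertex *)

Section Survivors.
Variables (D p : nat) (d : nat -> nat).
Local Notation mults := (mults D p).
Implicit Types m : mults.

(** Basis vectors at N, and survivors at N.+1, are labelled by the starting point t of
their interval: the former are the rows to be read, the latter the pivots. *)
Definition end_count N m (t : 'I_p.+1) : nat :=
  if (t <= N)%N then nat_of_ord (m (t, inord N)) else 0%N.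
Definition survivors N m (t : 'I_p.+1) : nat :=
  if (t <= N)%N then nat_of_ord (m (t, inord N.+1)) else 0%N.

Lemma survivors_sum N m : (N < p)%N -> valid d N.+2 m ->
  (\sum_t survivors N m t + m (inord N.+1, inord N.+1) = d N.+1)%N.
Proof.
move=> Np vm; rewrite -(valid_last Np vm).
have vN1 : nat_of_ord (inord N.+1 : 'I_p.+1) = N.+1 by rewrite inordK // ltnS.
have /validP[supp _] := vm.
rewrite (bigD1 (inord N.+1)) //= [in RHS](bigD1 (inord N.+1)) //=.
rewrite {1}/survivors vN1 ltnn add0n addnC; congr addn.
apply: eq_bigr => t tN; rewrite /survivors; case: leqP => // Nt.
apply/esym/eqP; apply: contraNT tN => /supp /andP[/= h _].
rewrite vN1 in h; apply/eqP/val_inj; rewrite /= vN1; lia.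
Qed.

End Survivors.

Section Weights.
Variables (R : fieldType) (s : R) (D p : nat) (d : nat -> nat).
Let q := s ^+ 4.
Let u := q^-1.
Hypothesis s0 : s != 0.
Hypothesis u_unity : forall k, (0 < k)%N -> 1 - u ^+ k != 0.
Hypothesis dD : forall j, (d j <= D)%N.
Local Notation itv := (itv p).
Local Notation mults := (mults D p).
Implicit Types (o : nat -> bool) (m : mults).

(** The factor that depends on the dimension vector only: with s^4 = q, it is a power
of s times the orders of the groups GL_(d j). *)
Definition row_gauge (N : nat) : R :=
  (\prod_(j < N) (s ^+ (2 * d j * d j) * qpoch u (d j)))
  * s ^+ (2 * \sum_(j < N.-1) d j * d j.+1).

(** Up to a power of s that depends on d only, the inverse of the number of
automorphisms of the direct sum of intervals with multiplicities m. *)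
Definition mults_weight o m : R :=
  s ^ (- row_energy o (fun J => m J)) * \prod_J (qpoch u (m J))^-1.

(** The ratio of the weights of m' and m is the number of choices of the pivots:
the Pochhammer symbols match directly, the exponents by [row_energy_step]. *)
Lemma weight_step o N m m' : (N < p)%N -> o N ->
  valid d N.+1 m -> valid d N.+2 m' -> restricts N m m' ->
  row_gauge N.+1 * mults_weight o m
    * echelon_number q (maps_to o) (d N.+1) (end_count N m)
        (fun t => (survivors N m' t)%:Z) 0
  = row_gauge N.+2 * mults_weight o m' * qpoch u (d N.+1 - \sum_t survivors N m' t).
Proof.
move=> Np oN vm vm' rm.
have vN : nat_of_ord (inord N : 'I_p.+1) = N by rewrite inordK // ltnS ltnW.
have vN1 : nat_of_ord (inord N.+1 : 'I_p.+1) = N.+1 by rewrite inordK // ltnS.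
have [supp dims] := validP _ _ _ vm.
have [supp' dims'] := validP _ _ _ vm'.
have [old split] := restrictsP _ _ _ rm.
have nv01 : (inord N.+1 : 'I_p.+1) != inord N.
  by apply/eqP => /(congr1 val) /=; rewrite vN vN1; lia.
pose v0 : 'I_p.+1 := inord N; pose v1 : 'I_p.+1 := inord N.+1.
have w0 : nat_of_ord v0 = N by exact: vN.
have w1 : nat_of_ord v1 = N.+1 by exact: vN1.
pose e := d N.+1; pose Rr : int := \sum_(t : 'I_p.+1 | (t <= N)%N) (m' (t, v1))%:Z.
pose dN : int := \sum_(t : 'I_p.+1 | (t <= N)%N) (m (t, v0))%:Z.
pose Mm : int := \sum_(t : 'I_p.+1 | (t <= N)%N) \sum_(w : 'I_p.+1 | (w <= N)%N)
  (maps_to o t w)%:Z * ((m' (t, v0))%:Z * (m' (w, v1))%:Z).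
have diffE (t : 'I_p.+1) : (t <= N)%N ->
    (end_count N m t)%:Z - (survivors N m' t)%:Z = (m' (t, v0))%:Z.
  by move=> tN; rewrite /end_count /survivors tN split // PoszD addrK.
have sizeE : (\sum_t survivors N m' t)%N%:Z = Rr.
  rewrite (big_morph Posz PoszD (erefl _)) /Rr [RHS]big_mkcond.
  by apply: eq_bigr => t _; rewrite /survivors; case: ifP.
have dNE : dN = d N.
  rewrite -(valid_last (ltnW Np) vm) (big_morph Posz PoszD (erefl _)) /dN big_mkcond.
  apply: eq_bigr => t _; case: leqP => // Nt; congr Posz.
  apply/esym/eqP; apply: contraLR isT => /supp /= /andP[h _].
  by rewrite vN in h; lia.
have sE : (m' (v1, v1))%:Z = e%:Z - Rr.
  by rewrite -sizeE /e -(survivors_sum Np vm') PoszD addrAC subrr add0r.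
have expoE : echelon_expo (maps_to o) (d N.+1) (end_count N m)
    (fun t => (survivors N m' t)%:Z) 0 = Mm + e%:Z * Rr.
  rewrite /echelon_expo mul0r addr0 -sizeE (big_morph Posz PoszD (erefl _)); congr (_ + _).
  rewrite /Mm [RHS]big_mkcond; apply: eq_bigr => t _; case: leqP => tN; last first.
    by rewrite big1 // => w _; rewrite /end_count /survivors leqNgt tN /= mulr0 mul0r.
  rewrite [RHS]big_mkcond; apply: eq_bigr => w _; rewrite diffE //.
  rewrite /survivors; case: leqP => wN; last by rewrite mulr0.
  by rewrite natz mulrA.
have Rm : \sum_(t : 'I_p.+1 | (t <= N)%N) (m' (t, v0))%:Z = dN - Rr.
  rewrite /dN /Rr -sumrB; apply: eq_bigr => t tN.
  by rewrite split // PoszD addrK.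
have signE : \sum_(t : 'I_p.+1 | (t <= N)%N) \sum_(w : 'I_p.+1 | (w <= N)%N)
    maps_sign o t w * ((m' (t, v0))%:Z * (m' (w, v1))%:Z) = (dN - Rr) * Rr - 2 * Mm.
  rewrite -Rm mulr_suml /Mm mulr_sumr -sumrB; apply: eq_bigr => t tN.
  rewrite /Rr mulr_sumr mulr_sumr -sumrB; apply: eq_bigr => w wN.
  have sgE (b : bool) : (if b then -1 else 1) = 1 - 2 * (nat_of_bool b)%:Z :> int by case: b.
  by rewrite /maps_sign sgE; move: (Posz _) (Posz _) (Posz _) => x1 x2 x3; ring.
have energyE : row_energy o (fun J => m' J) = row_energy o (fun J => m J)
    + 2 * ((dN - Rr) * Rr - 2 * Mm) + 2 * (e%:Z - Rr) * dN
    + 2 * (e%:Z - Rr) * (e%:Z - Rr).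
  rewrite (@row_energy_step p N o Np oN (fun J => m J)) -/v0 -/v1.
  - by rewrite signE sE.
  - by move=> J /supp; rewrite ltnS.
  - by move=> J /supp'; rewrite ltnS.
  - by move=> J JN; rewrite old.
  by move=> t tN; rewrite split.
have prodE : (\prod_J (qpoch u (m J))^-1) * \prod_t (qpoch u (end_count N m t)
      * qpoch_inv u (survivors N m' t)%:Z
      * qpoch_inv u ((end_count N m t)%:Z - (survivors N m' t)%:Z))
    = (\prod_J (qpoch u (m' J))^-1) * qpoch u (m' (v1, v1)).
  rewrite !big_itv (bigD1 v0) //= [in RHS](bigD1 v0) //=.
  rewrite [X in _ * X * _ = _](bigD1 v1) //= [X in _ = _ * X * _](bigD1 v1) //=.
  rewrite [X in _ * (_ * X) * _ = _](eq_bigr (fun l => \prod_k (qpoch u (m' (k, l)))^-1)); last first.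
    move=> l /andP[l0 l1]; apply: eq_bigr => k _; congr (qpoch u _)^-1.
    have [lN|lN] := ltnP l N; first by rewrite old.
    have z (f : mults) : (forall J, f J != 0%N :> nat -> (J.1 <= J.2 < N.+2)%N) ->
        f (k, l) = 0%N :> nat.
      move=> sf; apply/eqP; apply: contraLR isT => /sf /= /andP[_ h].
      by move: l0 l1; rewrite -!(inj_eq val_inj) /= w0 w1; lia.
    rewrite !z // => J /supp /andP[-> h]; exact: leqW.
  set X := \prod_(_ | _) _.
  rewrite [X in _ * (X * _) * _ = _]big1; last first.
    move=> k _; have -> : m (k, v1) = 0%N :> nat; last by rewrite qpoch0 invr1.
    by apply/eqP; apply: contraLR isT => /supp /=; rewrite w1 ltnn andbF.
  rewrite mul1r mulrAC [RHS]mulrAC mulrA; congr (_ * _).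
  rewrite -big_split /=.
  have -> : \prod_k (qpoch u (m' (k, v1)))^-1
    = (\prod_t (qpoch u (survivors N m' t))^-1) * (qpoch u (m' (v1, v1)))^-1.
    rewrite (bigD1 v1) //= [X in _ = X * _](bigD1 v1) //=.
    rewrite [survivors _ _ v1]/survivors w1 ltnn qpoch0 invr1 mul1r.
    rewrite mulrC; congr (_ * _); apply: eq_bigr => t tv; rewrite /survivors.
    case: leqP => // Nt; congr (qpoch u _)^-1.
    apply/eqP; apply: contraNT tv => /supp' /= /andP[h _].
    by rewrite w1 in h; apply/eqP/val_inj; rewrite /= w1; lia.
  rewrite -[RHS]mulrA [X in _ = _ * X]mulrCA mulfV ?qpoch_neq0 // mulr1 -big_split /=.
  apply: eq_bigr => t _; rewrite /=.
  have [tN|Nt] := leqP t N.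
    rewrite diffE // /= [end_count N m t]/end_count tN -/v0.
    by rewrite !mulrA mulVf ?qpoch_neq0 // mul1r mulrC.
  rewrite /end_count /survivors leqNgt Nt /= qpoch0 invr1 !mulr1.
  have -> : m (t, v0) = 0%N :> nat.
    by apply/eqP; apply: contraLR isT => /supp /= /andP[h _]; rewrite w0 in h; lia.
  have -> : m' (t, v0) = 0%N :> nat.
    by apply/eqP; apply: contraLR isT => /supp' /= /andP[h _]; rewrite w0 in h; lia.
  by rewrite qpoch0 invr1.
have sizeN : (d N.+1 - \sum_t survivors N m' t = m' (v1, v1))%N.
  by rewrite -(survivors_sum Np vm') addKn.
rewrite sizeN /mults_weight /echelon_number expoE subn0 energyE.
rewrite /row_gauge [in RHS]big_ord_recr /=.
rewrite [(\sum_(j < N.+1) d j * d j.+1)%N]big_ord_recr /=.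
have qz z : q ^ z = s ^ (4 * z) by rewrite /q exprnP exprz_exp.
rewrite qz -/e.
set E := row_energy _ _; set P := \prod_(_ < _) _; set W := (\sum_(_ < _) _)%N.
have expE : s ^+ (2 * W) * s ^ (- E) * s ^ (4 * (Mm + e%:Z * Rr)) =
  s ^+ (2 * e * e) * s ^+ (2 * (W + d N * e)) *
  s ^ (- (E + 2 * ((dN - Rr) * Rr - 2 * Mm) + 2 * (e%:Z - Rr) * dN
    + 2 * (e%:Z - Rr) * (e%:Z - Rr))).
  rewrite !exprnP -!expfzDr //; congr (_ ^ _).
  by rewrite !(PoszM, PoszD) dNE; ring.
have reg (x1 x2 x3 x4 x5 x6 x7 : R) :
  x1 * x2 * (x3 * x4) * (x5 * x6 * x7) = x1 * x7 * (x2 * x3 * x6) * (x4 * x5) by ring.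
have reg' (x1 x2 x3 x4 x5 x6 x7 : R) :
  x1 * (x2 * x3) * x4 * (x5 * x6) * x7 = x1 * x3 * (x2 * x4 * x5) * (x6 * x7) by ring.
rewrite reg prodE expE.
by rewrite reg'.
Qed.

End Weights.

(** * Adding one arrow to a representation *)

Lemma pivot_sum_linear (F : finFieldType) e (R : comNzRingType) K (w : seq 'I_K) S
    (J : finType) (P : pred J) (f : J -> R) (chi : J -> {set 'I_K} -> R) :
  pivot_sum F e w S (fun S' => \sum_(j | P j) f j * chi j S') =
  \sum_(j | P j) f j * pivot_sum F e w S (chi j).
Proof.
elim: w S => //= b w IH S; rewrite !IH !mulr_sumr -big_split.
by apply: eq_bigr => j _ /=; ring.
Qed.

Definition upd (T : Type) (M : nat -> T) N x := fun j => if j == N then x else M j.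

(** Linear maps from a space of dimension a to one of dimension b, both embedded as the
first coordinates of F^D. *)
Definition hom_space (F : fieldType) D (a b : nat) : pred 'M[F]_D :=
  fun x => pid_mx a *m x *m pid_mx b == x.

Lemma interval_basis_ext (F : fieldType) D p o d N (M M' : nat -> 'M[F]_D) K
    (I : 'I_K -> itv p) B C :
  (forall j, (j.+1 < N)%N -> M j = M' j) ->
  interval_basis o d N M I B C -> interval_basis o d N M' I B C.
Proof. by move=> MM [h1 h2 h3]; split=> // j jN; rewrite -MM // h3. Qed.

Lemma eq_echelon_number (R : fieldType) (q : R) (T : finType) (good : rel T) e
    (a a' : T -> nat) (r r' : T -> int) rho :
  a =1 a' -> r =1 r' ->
  echelon_number q good e a r rho = echelon_number q good e a' r' rho.
Proof.
move=> aa rr; rewrite /echelon_number /echelon_expo; congr (_ * q ^ (_ + _ * _ + _ * _) * _).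
- by apply: eq_bigr => t _; rewrite aa rr.
- by apply: eq_bigr => t _; apply: eq_bigr => t' _; rewrite aa !rr.
- by apply: eq_bigr => t _; rewrite aa rr.
by apply: eq_bigr => t _; rewrite rr.
Qed.

Section ForwardStep.
Variables (F : finFieldType) (R : fieldType) (s : R) (D p : nat) (d : nat -> nat).
Let q := s ^+ 4.
Let u := q^-1.
Hypothesis sF : s ^+ 4 = #|F|%:R.
Hypothesis s0 : s != 0.
Hypothesis u_unity : forall k, (0 < k)%N -> 1 - u ^+ k != 0.
Hypothesis dD : forall j, (d j <= D)%N.
Local Notation itv := (itv p).
Local Notation mults := (mults D p).
Implicit Types (o : nat -> bool) (m : mults) (M : nat -> 'M[F]_D).

(** The arrow x is recorded by the images of the basis vectors at N, which gives a
family of rows indexed by the intervals alive at N.  [echelon_count] and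
[interval_basis_extend] show that g x only depends on the labels of the
pivots, and [pivot_sum_count] and [weight_step] evaluate the sum. *)
Lemma forward_step o N M m (g : 'M[F]_D -> R) (fh : mults -> R) :
  (N < p)%N -> o N -> has_mults d o N.+1 M m ->
  (forall x m', hom_space (d N) (d N.+1) x ->
     has_mults d o N.+2 (upd M N x) m' -> g x = fh m') ->
  row_gauge s d N.+1 * mults_weight s o m * \sum_(x | hom_space (d N) (d N.+1) x) g x
  = row_gauge s d N.+2 *
    \sum_(m' | valid d N.+2 m' && restricts N m m') mults_weight s o m' * fh m'.
Proof.
move=> Np oN [K [I [B [C [IB mE]]]]] gfh.
have hm : has_mults d o N.+1 M m by exists K, I, B, C; split.
have vm := has_mults_valid dD (leqW Np) hm.
have vN : nat_of_ord (inord N : 'I_p.+1) = N by rewrite inordK // ltnS ltnW.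
have vN1 : nat_of_ord (inord N.+1 : 'I_p.+1) = N.+1 by rewrite inordK // ltnS.
have [Iok BC _] := IB.
have dbN := BC N (ltnSn N); have [PC BP CB BCp] := dbN.
pose alive b := in_itv N (I b).
have aliveE b : alive b = ((I b).2 == inord N).
  rewrite -(inj_eq val_inj) /= vN /alive /in_itv; have /andP[h1 h2] := Iok b.
  by apply/andP/eqP => [[_ h]|h]; [lia|split; lia].
have alive1 b : alive b -> ((I b).1 <= N)%N by case/andP.
pose lab b := (I b).1.
pose leT b b' := maps_to o (lab b') (lab b).
pose al := sort leT (enum alive).
have al_mem b : (b \in al) = alive b by rewrite mem_sort mem_enum.
have al_uniq : uniq al by rewrite sort_uniq enum_uniq.
have al_sorted : pairwise leT al.
  rewrite -sorted_pairwise; last by move=> x y z h1 h2; apply: (maps_to_trans h2 h1).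
  by apply: sort_sorted => x y; apply: maps_to_total.
(* The rows are read in the order al, so that a row maps to all the pivots before it. *)
pose ho b b' := [&& alive b, alive b' & maps_to o (lab b) (lab b')].
pose e := d N.+1.
pose tgt (m' : mults) := survivors N m'.
(* The condition on the pivot labels selects a single m'. *)
pose G S := \sum_(m' | valid d N.+2 m' && restricts N m m')
  fh m' * ([forall t, label_count lab S t == tgt m' t])%:R.
have gG : \sum_(x | hom_space (d N) (d N.+1) x) g x = pivot_sum F e al set0 G.
  rewrite -(@echelon_count F D e R (dD _) K ho (fun X => g (C N *m X)) G al set0 0 0) //.
  - rewrite (reindex_onto (fun Y : {ffun 'I_K -> 'rV[F]_D} => C N *m matrix_of_rows Y)
      (fun x => [ffun b => row b (B N *m x)])) /=; last first.
      move=> x /eqP xH; rewrite -[X in _ *m X](_ : B N *m x = _).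
        by rewrite mulmxA CB -xH -!mulmxA (mulmxA (pid_mx (d N))) pid_idem.
      by apply/row_matrixP => b; rewrite rowK ffunE.
    apply: eq_bigl => Y; apply/andP/familyP => [[/eqP xH /eqP YE] b|h].
      rewrite /rows_in al_mem -YE ffunE; case: ifP => ab.
        rewrite inE -xH row_mul -!mulmxA -row_mul pid_idem.
        by rewrite -row_mul.
      rewrite inE [X in _ == X]ffunE mulmxA BCp.
      apply/eqP/rowP => k; rewrite mxE mulmx_coord_projl.
      by rewrite -/(alive b) ab mul0r mxE.
    have YP : matrix_of_rows Y *m pid_mx e = matrix_of_rows Y.
      apply/row_matrixP => b; rewrite row_mul rowK; have := h b; rewrite /rows_in.
      case: ifP => _; first by rewrite inE => /eqP.
      by rewrite inE ffunE => /eqP ->; rewrite mul0mx.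
    have YB : coord_proj F (fun b => in_itv N (I b)) *m matrix_of_rows Y = matrix_of_rows Y.
      apply/matrixP => b k; rewrite mulmx_coord_projl -/(alive b).
      have := h b; rewrite /rows_in al_mem; case: ifP => ab; first by rewrite mul1r.
      by rewrite inE ffunE => /eqP Yb; rewrite mul0r mxE Yb mxE.
    split.
      by rewrite /hom_space mulmxA PC -mulmxA YP.
    apply/eqP/ffunP => b; rewrite ffunE mulmxA BCp YB rowK.
    by [].
  - have al_alive : all alive al by apply/allP => b; rewrite al_mem.
    apply: (sub_in_pairwise _ al_alive al_sorted).
    by move=> b b' ab ab' h; apply/and3P; split; [exact: ab'|exact: ab|exact: h].
  - by move=> b; rewrite al_mem => ab; split=> [||b'|b']; rewrite ?ffunE ?inE ?mxE.
  - have -> : matrix_of_rows 0 = 0 :> 'M[F]_(K, D).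
      by apply/matrixP => b k; rewrite /matrix_of_rows [LHS]mxE ffunE !mxE.
    split; rewrite ?mulmx0 ?mul0mx ?addr0 ?mxrank0 ?cards0 //.
    by move=> b b'; rewrite mxE eqxx.
  move=> S c X subS rX [XP rXs XE cP].
  have Sal b : b \in S -> alive b.
    by move/subS; rewrite !inE /= al_mem.
  set Xs := coord_proj F [in S] *m X in rXs XE.
  have XsP : Xs *m pid_mx (d N.+1) = Xs by rewrite /Xs -mulmxA XP.
  have SXs : coord_proj F [in S] *m Xs = Xs.
    by rewrite /Xs mulmxA coord_proj_idem.
  have IB' : interval_basis o d N.+1 (upd M N (C N *m X)) I B C.
    by apply: interval_basis_ext IB => j jN; rewrite /upd ltn_eqF.
  have MN : upd M N (C N *m X) N = C N *m (Xs + c *m Xs) by rewrite /upd eqxx -XE.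
  have cP' b b' : c b b' != 0 -> [/\ b \notin S, b' \in S, in_itv N (I b),
      in_itv N (I b') & overlap_hom o (I b) (I b')].
    move=> cbb; have [h1 h2 /and3P[h3 h4 h5]] := cP _ _ cbb; split=> //.
    have := @maps_to_overlap _ o (lab b) (lab b') (inord N).
    rewrite vN => /(_ (alive1 _ h3) (alive1 _ h4) h5).
    move: h3 h4; rewrite !aliveE /lab => /eqP <- /eqP e'.
    by rewrite -{2}e'; case: (I b); case: (I b').
  have [k [B' [C' [kS IBx]]]] :=
    interval_basis_extend IB' Np oN (dD _) MN XsP SXs rXs Sal cP'.
  pose m' := mults_of D (extend_itvs (k := k) I S N).
  have m'E J : m' J = mult (extend_itvs (k := k) I S N) J :> nat.
    exact: (mults_ofE dD _ IBx).
  have hm' : has_mults d o N.+2 (upd M N (C N *m X)) m' by do 4!eexists; split; [exact: IBx|].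
  have Np' : (N.+2 <= p.+1)%N by [].
  have vm' := has_mults_valid dD Np' hm'.
  have multE J : mult (extend_itvs (k := k) I S N) J =
     (#|[set b in ~: S | I b == J]| + #|[set b in S | ((I b).1, inord N.+1) == J]|
       + k * (J == (inord N.+1, inord N.+1)))%N.
    rewrite /mult -!sum1_card big_mkcond big_split_ord /=; congr addn.
      rewrite [in RHS]big_mkcond [X in _ = (_ + X)%N]big_mkcond -big_split.
      apply: eq_bigr => b _; rewrite !inE /= /extend_itvs (unsplitK (inl b)).
      by case: (b \in S) => /=; rewrite ?addn0.
    under eq_bigr do rewrite inE /extend_itvs (unsplitK (inr _)) eq_sym.
    by case: eqP; rewrite ?muln1 ?muln0 ?sum1_card ?card_ord // big1.
  have rm' : restricts N m m'.
    apply/restrictsP; split=> [J JN|t tN].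
      apply: val_inj => /=; rewrite m'E mE multE.
      rewrite [X in (_ + X + _)%N]eq_card0 ?addn0; last first.
        move=> b; rewrite !inE; apply/negP => /andP[_ /eqP bJ].
        by move: JN; rewrite -bJ /= vN1; lia.
      rewrite (negbTE (_ : J != _)) ?muln0 ?addn0; last first.
        by apply/eqP => JE; move: JN; rewrite JE /= vN1; lia.
      apply: eq_card => b; rewrite !inE; case: eqP => bJ; last by rewrite andbF.
      rewrite andbT; apply/negP => /Sal; rewrite aliveE bJ => /eqP h.
      by rewrite h vN ltnn in JN.
    rewrite !m'E mE !multE.
    rewrite [X in (_ + X + _ + _)%N]eq_card0 ?addn0; last first.
      move=> b; rewrite !inE; apply/negP => /andP[_ /eqP[_ /(congr1 val)]] /=.
      by rewrite vN vN1; lia.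
    rewrite (negbTE (_ : (t, inord N) != _)) ?muln0 ?addn0; last first.
      by apply/eqP => -[_ /(congr1 val)] /=; rewrite vN vN1; lia.
    rewrite [X in (_ + (X + _ + _))%N]eq_card0 ?add0n; last first.
      move=> b; rewrite !inE; apply/negP => /andP[_ /eqP bJ].
      by have /andP[_] := Iok b; rewrite bJ /= vN1 ltnn.
    rewrite (negbTE (_ : (t, inord N.+1) != _)) ?muln0 ?addn0; last first.
      by apply/eqP => -[h]; rewrite h vN1 ltnn in tN.
    rewrite /mult -(cardsID S [set b | I b == (t, inord N)]) addnC; congr addn; apply: eq_card => b; rewrite !inE.
      by rewrite andbC.
    rewrite andbC; case bS: (b \in S) => //=; have := Sal _ bS.
    rewrite aliveE; case: (I b) => x y /= /eqP ->.
    by rewrite !xpair_eqE !eqxx.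
  have cnt t : label_count lab S t = tgt m' t.
    rewrite /tgt /survivors; case: leqP => [tN|Nt].
      rewrite m'E multE [X in (X + _ + _)%N]eq_card0 ?add0n; last first.
        move=> b; rewrite !inE; apply/negP => /andP[_ /eqP bJ].
        by have /andP[_] := Iok b; rewrite bJ /= vN1 ltnn.
      rewrite (negbTE (_ : (t, inord N.+1) != _)) ?muln0 ?addn0; last first.
        by apply/eqP => -[h]; rewrite h vN1 ltnn in tN.
      by apply: eq_card => b; rewrite !inE xpair_eqE eqxx andbT.
    apply: eq_card0 => b; rewrite !inE; apply/negP => /andP[/Sal/alive1 h /eqP bt].
    by move: h; rewrite -/(lab b) bt; lia.
  have xH : hom_space (d N) (d N.+1) (C N *m X).
    by rewrite /hom_space mulmxA PC -mulmxA XP.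
  rewrite (gfh _ _ xH hm') /G (bigD1 m') /=; last by rewrite vm' rm'.
  rewrite big1 ?addr0.
    by rewrite (_ : [forall t, _]) ?mulr1 //; apply/forallP => t; rewrite cnt.
  move=> m2 /andP[/andP[v2 r2] m2m]; case: forallP => [h|]; last by rewrite mulr0.
  case/eqP: m2m; apply: (valid_unique Np v2 vm' r2 rm') => t tN.
  by have := eqP (h t); rewrite cnt /tgt /survivors tN.
rewrite gG pivot_sum_linear mulr_sumr mulr_sumr; apply: eq_bigr => m' /andP[vm' rm'].
have te : (\sum_t tgt m' t <= e)%N by rewrite /e -(survivors_sum Np vm') leq_addr.
have q0 : #|F|%:R != 0 :> R by rewrite -sF expf_neq0.
have uu k : (0 < k)%N -> 1 - (#|F|%:R : R)^-1 ^+ k != 0.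
  by rewrite -sF; apply: u_unity.
have al_al b : b \in al -> b \notin (set0 : {set 'I_K}) by rewrite inE.
have := @pivot_sum_count F R _ (maps_to o) e q0 uu (maps_to_refl o) (@maps_to_anti _ o)
  K lab (tgt m') al set0 te al_uniq al_al al_sorted.
rewrite cards0 (@eq_echelon_number _ _ _ _ _ _ (end_count N m) _
  (fun t => (tgt m' t)%:Z)) -?sF; first last.
- by move=> t; rewrite /label_count eq_card0 ?subr0 // => b; rewrite !inE.
- move=> t; transitivity #|[set b | alive b && (lab b == t)]|.
    rewrite count_sort -sum1_count big_enum_cond -sum1_card.
    by apply: eq_bigl => b; rewrite inE.
  rewrite /end_count; case: leqP => [tN|Nt].
    rewrite mE; apply: eq_card => b; rewrite !inE /lab aliveE.
    by case: (I b) => x y; rewrite /= xpair_eqE andbC.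
  apply: eq_card0 => b; rewrite !inE; apply/negP => /andP[/alive1 h /eqP bt].
  by move: h; rewrite -/(lab b) bt; lia.
have qe0 : qpoch u (e - \sum_t tgt m' t) != 0 by apply: qpoch_neq0.
move=> cnt; apply: (mulIf qe0).
have ws := weight_step s0 u_unity Np oN vm vm' rm'.
have reg1 (x1 x2 x3 x4 x5 : R) : x1 * x2 * (x3 * x4) * x5 = x1 * x2 * (x4 * x5) * x3.
  by ring.
have reg2 (x1 x2 x3 x5 : R) : x1 * (x2 * x3) * x5 = x1 * x2 * x5 * x3 by ring.
rewrite reg1 [RHS]reg2; congr (_ * _); apply: etrans ws; congr (_ * _).
exact: cnt.
Qed.

End ForwardStep.

(** * Summing over the representations of a line *)

Section SumFamily.
Variables (T A : finType) (R : nmodType).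

Definition ffset (h : {ffun T -> A}) t0 x : {ffun T -> A} :=
  [ffun t => if t == t0 then x else h t].

Lemma sum_family_set (S : T -> pred A) t0 a0 (f : {ffun T -> A} -> R) :
  \sum_(h in family S) f h =
  \sum_(h in family (fun t => if t == t0 then (pred1 a0 : pred A) else S t))
     \sum_(x | S t0 x) f (ffset h t0 x).
Proof.
rewrite pair_big_dep /=.
rewrite (reindex_onto (fun u : {ffun T -> A} * A => ffset u.1 t0 u.2)
  (fun h => (ffset h t0 a0, h t0))) /=; last first.
  by move=> h _; apply/ffunP => t; rewrite !ffunE; case: eqP => [->|].
apply: eq_bigl => -[h x] /=; rewrite xpair_eqE ffunE eqxx andbC.
apply/andP/andP => [[/andP[/eqP hE _] /familyP hS]|[/familyP hS xS]].
  split; last by have := hS t0; rewrite ffunE eqxx.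
  apply/familyP => t; have := hS t; rewrite ffunE; case: eqP => // -> _.
  by rewrite -hE ffunE eqxx inE.
split; last first.
  apply/familyP => t; have := hS t; rewrite ffunE.
  by case: eqP => [->|_] //.
rewrite eqxx andbT; apply/eqP/ffunP => t; rewrite !ffunE.
by case: eqP => [->|//]; have := hS t0; rewrite eqxx inE => /eqP.
Qed.

End SumFamily.

Section RowSum.
Variables (F : finFieldType) (R : fieldType) (s : R) (D p : nat) (d : nat -> nat).
Let q := s ^+ 4.
Let u := q^-1.
Hypothesis sF : s ^+ 4 = #|F|%:R.
Hypothesis s0 : s != 0.
Hypothesis u_unity : forall k, (0 < k)%N -> 1 - u ^+ k != 0.
Hypothesis dD : forall j, (d j <= D)%N.
Local Notation itv := (itv p).
Local Notation mults := (mults D p).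
Implicit Types (o : nat -> bool) (m : mults) (M : nat -> 'M[F]_D).

Lemma dual_bases_tr (Q : 'M[F]_D) K (S : pred 'I_K) B C :
  dual_bases Q S B C -> dual_bases Q^T S C^T B^T.
Proof.
move=> [QC BQ CB BC]; split; rewrite -?trmx_mul ?QC ?BQ ?CB ?BC //.
by rewrite /coord_proj tr_diag_mx.
Qed.

Lemma interval_basis_tr o o' N M K (I : 'I_K -> itv) B C :
  (forall j, o' j = ~~ o j) -> interval_basis o d N M I B C ->
  interval_basis o' d N (fun j => (M j)^T) I (fun j => (C j)^T) (fun j => (B j)^T).
Proof.
move=> oo [h1 h2 h3]; split=> // j jN.
  by rewrite -[pid_mx _]trmxK tr_pid_mx; apply: dual_bases_tr; apply: h2.
by rewrite h3 // trmx_mul /arrow_tail /arrow_head oo; case: (o j).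
Qed.

Lemma has_mults_tr o o' N M m : (forall j, o' j = ~~ o j) ->
  has_mults d o N M m -> has_mults d o' N (fun j => (M j)^T) m.
Proof.
move=> oo [K [I [B [C [h mE]]]]]; do 4!eexists; split; last exact: mE.
exact: interval_basis_tr oo h.
Qed.

Lemma has_mults_ext o N M M' m : (forall j, (j.+1 < N)%N -> M j = M' j) ->
  has_mults d o N M m -> has_mults d o N M' m.
Proof.
move=> MM [K [I [B [C [h mE]]]]]; exists K, I, B, C; split=> //.
exact: interval_basis_ext MM h.
Qed.

Lemma mults_weight_opp o o' m : (forall j, o' j = ~~ o j) ->
  mults_weight s o' m = mults_weight s o m.
Proof. by move=> oo; rewrite /mults_weight (row_energy_opp _ oo). Qed.

Definition arrow_space o j : pred 'M[F]_D :=
  hom_space (d (arrow_tail o j)) (d (arrow_head o j)).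

(** Transposing all matrices reverses the arrows and exchanges B and C, which reduces
an arrow into N to [forward_step]. *)
Lemma arrow_step o N M m (g : 'M[F]_D -> R) (fh : mults -> R) :
  (N < p)%N -> has_mults d o N.+1 M m ->
  (forall x m', arrow_space o N x ->
     has_mults d o N.+2 (upd M N x) m' -> g x = fh m') ->
  row_gauge s d N.+1 * mults_weight s o m * \sum_(x | arrow_space o N x) g x
  = row_gauge s d N.+2 *
    \sum_(m' | valid d N.+2 m' && restricts N m m') mults_weight s o m' * fh m'.
Proof.
move=> Np hm gfh; case oN: (o N).
  have e : arrow_space o N = hom_space (d N) (d N.+1).
    by rewrite /arrow_space /arrow_tail /arrow_head oN.
  by rewrite e in gfh *; apply: forward_step hm gfh.
pose o' j := ~~ o j.
have oo j : o' j = ~~ o j by [].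
have oo' j : o j = ~~ o' j by rewrite /o' negbK.
have trH x : arrow_space o N x^T = hom_space (d N) (d N.+1) x.
  rewrite /arrow_space /arrow_tail /arrow_head oN /hom_space.
  by rewrite -(inj_eq (@trmx_inj _ _ _)) !trmx_mul !tr_pid_mx trmxK mulmxA.
have -> : \sum_(x | arrow_space o N x) g x
    = \sum_(x | hom_space (d N) (d N.+1) x) g x^T.
  rewrite (reindex_onto trmx trmx) => [|x _]; last exact: trmxK.
  by apply: eq_bigl => x; rewrite trmxK eqxx andbT trH.
rewrite -(mults_weight_opp m oo).
rewrite (forward_step sF s0 u_unity dD (g := fun x => g x^T) (fh := fh) Np _
  (has_mults_tr oo hm)); first last.
- move=> x m' xH hm'; apply: gfh; first by rewrite trH.
  apply: has_mults_ext (has_mults_tr oo' hm') => j _ /=.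
  by rewrite /upd; case: eqP => // _; rewrite trmxK.
- by rewrite oo oN.
congr (_ * _); apply: eq_bigr => m' _.
by rewrite (mults_weight_opp m' oo).
Qed.

(** Only the arrows between the first N vertices are free. *)
Definition row_dom o N (j : 'I_p.+1) : pred 'M[F]_D :=
  if (j.+1 < N)%N then arrow_space o j else pred1 0.

Definition row_arrows (h : {ffun 'I_p.+1 -> 'M[F]_D}) (j : nat) := h (inord j).

Lemma row_gauge_neq0 N : row_gauge s d N != 0.
Proof.
rewrite /row_gauge mulf_neq0 ?expf_neq0 //.
by apply/prodf_neq0 => j _; rewrite mulf_neq0 ?expf_neq0 ?qpoch_neq0.
Qed.

Lemma mults_weight_neq0 o m : mults_weight s o m != 0.
Proof.
rewrite /mults_weight mulf_neq0 ?expfz_neq0 //.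
by apply/prodf_neq0 => J _; rewrite invr_eq0 qpoch_neq0.
Qed.

Lemma valid1 m : valid d 1 m = (m == [ffun J => if J == (ord0, ord0) then inord (d 0%N) else ord0]).
Proof.
apply/validP/eqP => [[supp dims]|->].
  apply/ffunP => -[k l]; rewrite ffunE; apply: val_inj; case: eqP => [[-> ->]|kl] /=.
    rewrite inordK ?ltnS // -(dims 0%N) // (bigD1 (ord0, ord0)) //= big1 ?addn0 //.
    move=> [k' l'] /= /andP[_ kl']; apply/eqP; apply: contraNT kl' => /supp /= /andP[h1 h2].
    by rewrite xpair_eqE -!(inj_eq val_inj) /=; lia.
  apply/eqP; apply: contra_notT kl => /supp /= /andP[h1 h2].
  by congr pair; apply: val_inj => /=; lia.
split=> [J|j _ j1].
  by rewrite ffunE; case: (J =P (ord0, ord0)) => [->|].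
have -> : j = 0%N by lia.
rewrite (bigD1 (ord0, ord0)) //= ffunE eqxx inordK ?ltnS // big1 ?addn0 //.
by move=> J /andP[_ /negbTE JJ]; rewrite ffunE JJ.
Qed.

(** A function of the representation that depends only on the multiplicities of its
intervals is summed over multiplicities with weights: the weight of m, times
the gauge, counts the representations isomorphic to the direct sum.  By induction on the number of
vertices; the partial sum over the last arrow is again a function of the
multiplicities on the remaining vertices, by [arrow_step]. *)
Theorem row_sum o N (f : {ffun 'I_p.+1 -> 'M[F]_D} -> R) (fh : mults -> R) :
  (N <= p)%N ->
  (forall h m, h \in family (row_dom o N.+1) ->
     has_mults d o N.+1 (row_arrows h) m -> f h = fh m) ->
  \sum_(h in family (row_dom o N.+1)) f h =
  row_gauge s d N.+1 * \sum_(m | valid d N.+1 m) mults_weight s o m * fh m.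
Proof.
elim: N f fh => [|N IH] f fh Np ffh.
  pose m0 : mults := [ffun J => if J == (ord0, ord0) then inord (d 0%N) else ord0].
  rewrite (big_pred1 m0); last by move=> m; rewrite valid1.
  pose h0 : {ffun 'I_p.+1 -> 'M[F]_D} := [ffun=> 0].
  rewrite (big_pred1 h0); last first.
    move=> h; apply/familyP/eqP => [hh|-> j]; last by rewrite /row_dom /= inE ffunE.
    by apply/ffunP => j; have := hh j; rewrite /row_dom /= inE ffunE => /eqP.
  rewrite (ffh _ m0); first last.
  - exists (d 0%N), (fun=> (ord0, ord0)), (fun=> pid_mx (d 0%N)), (fun=> pid_mx (d 0%N)).
    split=> [|J]; last first.
      rewrite ffunE /mult [J == _]eq_sym; case: (_ =P J) => [e|ne].
        rewrite inordK ?ltnS // (@eq_card _ _ predT) ?card_ord // => b.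
        by rewrite !inE.
      by rewrite eq_card0 // => b; rewrite !inE.
    split=> // j; rewrite ltnS leqn0 => /eqP ->; split.
    + by rewrite mul_pid_mx; congr pid_mx; rewrite minnn (minn_idPr _).
    + by rewrite mul_pid_mx minnn (minn_idPr _).
    + by rewrite mul_pid_mx !minnn.
    rewrite mul_pid_mx minnn (minn_idPr _) // pid_mx_1.
    by apply/matrixP => i k; rewrite [RHS]coord_projE andbT mxE.
  - by apply/familyP => j; rewrite /row_dom /= inE ffunE.
  rewrite /row_gauge /mults_weight big_ord1 big_ord0 muln0 expr0 mulr1.
  have -> : row_energy o (fun J => m0 J) = 2 * (d 0%N)%:Z * (d 0%N)%:Z.
    have mz J : J != (ord0, ord0) -> (m0 J)%:Z = 0.
      by move=> /negbTE JJ; rewrite ffunE JJ.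
    rewrite /row_energy (bigD1 (ord0, ord0)) //= [X in _ + X]big1 ?addr0; last first.
      by move=> J JJ; apply: big1 => J' _; rewrite mz // mul0r mulr0.
    rewrite (bigD1 (ord0, ord0)) //= big1 ?addr0; last first.
      by move=> J JJ; rewrite (mz J JJ) !mulr0.
    rewrite /row_weight eqxx row_formxx normr0 addr0 ffunE eqxx inordK ?ltnS //.
    by rewrite -mulrA.
  have -> : \prod_J (qpoch (s ^+ 4)^-1 (m0 J))^-1 = (qpoch (s ^+ 4)^-1 (d 0%N))^-1.
    rewrite (bigD1 (ord0, ord0)) //= ffunE eqxx inordK ?ltnS // big1 ?mulr1 // => J /negbTE JJ.
    by rewrite ffunE JJ qpoch0 invr1.
  rewrite -[s ^ (- _)]/(s ^ (- (2 * d 0%N * d 0%N)%N%:Z)) -exprnN.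
  rewrite mulrA mulrACA divff ?expf_neq0 // mul1r divff ?qpoch_neq0 // mul1r.
  by [].
pose jN : 'I_p.+1 := inord N.
have vj : nat_of_ord jN = N by rewrite inordK // ltnS ltnW.
rewrite (sum_family_set _ jN 0).
pose fh' m := (row_gauge s d N.+1 * mults_weight s o m)^-1 * (row_gauge s d N.+2 *
    \sum_(m' | valid d N.+2 m' && restricts N m m') mults_weight s o m' * fh m').
pose f' h := \sum_(x | arrow_space o N x) f (ffset h jN x).
have domE j : (if j == jN then (pred1 0 : pred 'M[F]_D) else row_dom o N.+2 j) =i row_dom o N.+1 j.
  move=> x; rewrite /row_dom; case: eqP => [->|/eqP jj]; first by rewrite vj ltnn.
  have -> : (j.+1 < N.+2)%N = (j.+1 < N.+1)%N; last by [].
  by move: jj; rewrite -(inj_eq val_inj) /= vj; lia.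
have famE : family (fun j => if j == jN then (pred1 0 : pred 'M[F]_D) else row_dom o N.+2 j)
    =i family (row_dom o N.+1).
  by move=> h; apply/familyP/familyP => hh j; [rewrite -domE|rewrite domE]; apply: hh.
rewrite (eq_bigl _ _ famE).
have -> : \sum_(h in family (row_dom o N.+1)) \sum_(x | row_dom o N.+2 jN x)
    f (ffset h jN x) = \sum_(h in family (row_dom o N.+1)) f' h.
  apply: eq_bigr => h _; apply: eq_bigl => x.
  by rewrite /row_dom vj ltnSn.
rewrite (IH f' fh' (ltnW Np)).
  rewrite [X in _ = _ * X](partition_big (restr N) (valid d N.+1)) /=; last first.
    by move=> m' vm'; apply: restr_valid.
  rewrite !mulr_sumr; apply: eq_bigr => m vm; rewrite [LHS]mulrA mulVKf; last first.
    by rewrite mulf_neq0 ?row_gauge_neq0 ?mults_weight_neq0.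
  congr (_ * _); apply: eq_bigl => m'; case vm': (valid _ _ m') => //=.
  by rewrite (restrE dD Np vm vm').
move=> h m hh hm; rewrite /f' /fh'.
have nz : row_gauge s d N.+1 * mults_weight s o m != 0.
  by rewrite mulf_neq0 ?row_gauge_neq0 ?mults_weight_neq0.
rewrite -(arrow_step Np hm (g := fun x => f (ffset h jN x))) ?mulKf //.
move=> x m' xH hm'; apply: ffh.
  apply/familyP => j; rewrite ffunE; case: eqP => [->|/eqP jj].
    by rewrite /row_dom vj ltnSn.
  have := familyP hh j; rewrite -domE (negbTE jj).
  by [].
apply: has_mults_ext hm' => j jN2; rewrite /upd /row_arrows ffunE /jN.
rewrite -(inj_eq val_inj) /= !inordK ?ltnS //; first exact: ltnW.
by lia.
Qed.

End RowSum.

(** * Summing over all the lines at once *)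

Section FamilyFix.
Variables (T A : finType).

Definition fixed_outside (r : seq T) (dom : T -> pred A) (h0 : {ffun T -> A}) :
    T -> pred A :=
  fun t => if t \in r then dom t else pred1 (h0 t).

Lemma sum_fixed_outside (R : nmodType) t0 r dom h0 (f : {ffun T -> A} -> R) :
  t0 \notin r ->
  \sum_(h in family (fixed_outside (t0 :: r) dom h0)) f h =
  \sum_(x | dom t0 x) \sum_(h in family (fixed_outside r dom (ffset h0 t0 x))) f h.
Proof.
move=> t0r; rewrite (partition_big (fun h : {ffun T -> A} => h t0) (dom t0)) /=; last first.
  by move=> h /familyP/(_ t0); rewrite /fixed_outside mem_head.
apply: eq_bigr => x xd; apply: eq_bigl => h.
apply/andP/familyP => [[/familyP hh /eqP hx] t|hh].
  rewrite /fixed_outside ffunE; have := hh t; rewrite /fixed_outside inE.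
  by case: eqP => [->|_] //=; rewrite (negbTE t0r) inE hx.
split; last first.
  by have := hh t0; rewrite /fixed_outside (negbTE t0r) ffunE eqxx inE.
apply/familyP => t; have := hh t; rewrite /fixed_outside ffunE inE.
by case: eqP => [->|_] //=; rewrite (negbTE t0r) inE => /eqP ->.
Qed.

End FamilyFix.

Section FamilyTransfer.
Variables (R : comNzRingType) (T A B : finType).
Variables (sigma : T -> A -> B -> Prop) (domA : T -> pred A) (domB : T -> pred B).
Variable w : T -> B -> R.

Hypothesis transfer1 : forall t (f : A -> R) (fh : B -> R),
  (forall a b, domA t a -> sigma t a b -> f a = fh b) ->
  \sum_(a | domA t a) f a = \sum_(b | domB t b) w t b * fh b.

Lemma family_transfer_seq (r : seq T) (f : {ffun T -> A} -> R) (fh : {ffun T -> B} -> R)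
    (h0 : {ffun T -> A}) (m0 : {ffun T -> B}) :
  uniq r ->
  (forall (h : {ffun T -> A}) (m : {ffun T -> B}), (forall t, t \in r -> domA t (h t) /\ sigma t (h t) (m t)) ->
    (forall t, t \notin r -> h t = h0 t /\ m t = m0 t) -> f h = fh m) ->
  \sum_(h in family (fixed_outside r domA h0)) f h =
  \sum_(m in family (fixed_outside r domB m0)) (\prod_(t <- r) w t (m t)) * fh m.
Proof.
elim: r h0 m0 => [|t0 r IH] h0 m0 /=.
  move=> _ ffh; rewrite (big_pred1 h0) => [|h]; last first.
    apply/familyP/eqP => [hh|-> t]; last by rewrite /fixed_outside /= inE.
    by apply/ffunP => t; have := hh t; rewrite /fixed_outside /= inE => /eqP.
  rewrite (big_pred1 m0) => [|m]; last first.
    apply/familyP/eqP => [hh|-> t]; last by rewrite /fixed_outside /= inE.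
    by apply/ffunP => t; have := hh t; rewrite /fixed_outside /= inE => /eqP.
  by rewrite big_nil mul1r; apply: ffh.
move=> /andP[t0r ur] ffh; rewrite !sum_fixed_outside //.
rewrite (transfer1 (fh := fun b => \sum_(m in family (fixed_outside r domB (ffset m0 t0 b)))
   (\prod_(t <- r) w t (m t)) * fh m)); last first.
  move=> a b da sab; apply: IH => // h m hr hnr; apply: ffh => t.
    rewrite inE; case: eqP => [->|_] /=; last exact: hr.
    by have [] := hnr _ t0r; rewrite !ffunE eqxx => -> ->.
  rewrite inE negb_or => /andP[/negbTE tt0 tr].
  by have [] := hnr _ tr; rewrite !ffunE tt0.
apply: eq_bigr => b _; rewrite mulr_sumr; apply: eq_bigr => m /familyP/(_ t0).
rewrite /fixed_outside (negbTE t0r) ffunE eqxx inE => /eqP mb.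
by rewrite big_cons mb mulrA.
Qed.

(** If in each line the sum over A can be replaced by a weighted sum over B for the
functions that factor through the relation sigma, then the lines can be treated one
after the other.  Here sigma relates a representation to its multiplicities, and is not
a function. *)
Lemma family_transfer (f : {ffun T -> A} -> R) (fh : {ffun T -> B} -> R) (a0 : A) (b0 : B) :
  (forall (h : {ffun T -> A}) (m : {ffun T -> B}), (forall t, domA t (h t)) -> (forall t, sigma t (h t) (m t)) -> f h = fh m) ->
  \sum_(h in family domA) f h =
  \sum_(m in family domB) (\prod_t w t (m t)) * fh m.
Proof.
move=> ffh.
have := @family_transfer_seq (enum T) f fh [ffun=> a0] [ffun=> b0] (enum_uniq T).
have e (C : finType) (dom : T -> pred C) c :
    family (fixed_outside (enum T) dom c) =i family dom.
  by move=> h; apply/familyP/familyP => hh t; have := hh t; rewrite /fixed_outside mem_enum.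
rewrite (eq_bigl _ _ (e A domA _)) (eq_bigl _ _ (e B domB _)) => ->.
  by apply: eq_bigr => m _; rewrite big_enum.
move=> h m hr _; apply: ffh => t; have [] := hr t; by rewrite ?mem_enum.
Qed.

End FamilyTransfer.

Lemma card_family_prod (T A : finType) (S : T -> pred A) :
  (#|family S| = \prod_t #|S t|)%N.
Proof.
rewrite -sum1_card (eq_bigr (fun h : {ffun T -> A} => \prod_(t : T) 1)%N); last first.
  by move=> h _; rewrite big1.
rewrite -(bigA_distr_big_dep S (fun _ _ => 1%N)).
by apply: eq_bigr => t _; rewrite sum1_card.
Qed.

(** * Coupling between two neighbouring lines *)

(** The pairs of intervals in neighbouring lines that contribute a free scalar to
[coupling_kernel]. *)
Definition linked (o : nat -> bool) p (I J : itv p) : bool :=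
  let lo := maxn I.1 J.1 in let hi := minn I.2 J.2 in
  [&& (lo <= hi)%N, o lo & o hi].

Section AlternatingChain.
Variables (F : fieldType) (o : nat -> bool) (z : nat -> F) (lo hi : nat).
Hypothesis alt : forall j, o j.+1 = ~~ o j.
(* z j.+1 is the value at the vertex j, so that z 0 stands to the left of all. *)
Hypothesis zero : forall j, ~~ ((lo < j) && (j <= hi.+1))%N -> z j = 0.
Hypothesis step : forall j, (lo <= j <= hi)%N -> ~~ o j -> z j.+2 = z j.
Hypothesis lohi : (lo <= hi)%N.

Lemma chain_from_start k : (lo + k <= hi)%N -> o (lo + k) ->
  z (lo + k).+1 = if o lo then z lo.+1 else 0.
Proof.
elim/ltn_ind: k => -[_|[_|k IH]].
- by rewrite addn0 => _ ->.
- rewrite addn1 alt => h no; rewrite (negbTE no) step ?leqnn ?lohi //.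
  by apply: zero; rewrite ltnn.
rewrite !addnS => h; rewrite !alt negbK => ok.
rewrite step ?alt ?ok //; last by lia.
by apply: IH => //; lia.
Qed.

(** The equations at the vertices with ~~ o identify the two neighbouring values, so
the values at all vertices with o agree, and they vanish when the chain leaves
the interval through a vertex with ~~ o, where one neighbour is 0. *)
Lemma chain_constant j : (lo <= j <= hi)%N -> o j ->
  z j.+1 = if o lo && o hi then z lo.+1 else 0.
Proof.
move=> /andP[lj jh] oj; have := @chain_from_start (j - lo); rewrite subnKC // => -> //.
case olo: (o lo) => //=; case ohi: (o hi) => //.
have e : z hi.+2 = z hi by apply: step; rewrite ?ohi // lohi leqnn.
rewrite zero in e; last by rewrite ltnn andbF.
have lthi : (lo < hi)%N.
  by rewrite ltn_neqAle lohi andbT; apply/eqP => h; rewrite h ohi in olo.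
have := @chain_from_start (hi.-1 - lo); rewrite subnKC; last by lia.
rewrite olo prednK; last by lia.
move=> <-; rewrite -?e //; first by lia.
have := alt hi.-1; rewrite prednK ?ohi; last by lia.
by case: (o hi.-1).
Qed.

End AlternatingChain.

Section CouplingKernel.
Variables (F : finFieldType) (D p : nat) (d d' : nat -> nat) (o o' : nat -> bool).
Hypothesis alt : forall j, o j.+1 = ~~ o j.
Hypothesis oo' : forall j, o' j = ~~ o j.
Local Notation row := {ffun 'I_p.+1 -> 'M[F]_D}.
Implicit Types h w : row.

(** The vertical arrows going up, from the line of d' to the line of d, sit at the
vertices with o. *)
Definition up_dom (j : 'I_p.+1) : pred 'M[F]_D :=
  if o j then hom_space (d' j) (d j) else pred1 0.

(** The derivative of the potential with respect to the vertical arrow going down at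
j: the two squares on both sides of this arrow, with opposite signs. *)
Definition gradient h h' w (j : nat) : 'M[F]_D :=
  (if (j < p)%N then row_arrows h' j *m row_arrows w j.+1 *m row_arrows h j else 0)
  - (if (0 < j)%N then row_arrows h' j.-1 *m row_arrows w j.-1 *m row_arrows h j.-1
     else 0).

Definition coupling_kernel h h' : {set row} :=
  [set w in family up_dom | [forall j : 'I_p.+1, ~~ o j ==> (gradient h h' w j == 0)]].

Variables (h h' : row) (K K' : nat) (I : 'I_K -> itv p) (I' : 'I_K' -> itv p).
Variables (B : nat -> 'M[F]_(K, D)) (C : nat -> 'M[F]_(D, K)).
Variables (B' : nat -> 'M[F]_(K', D)) (C' : nat -> 'M[F]_(D, K')).
Hypothesis IB : interval_basis o d p.+1 (row_arrows h) I B C.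
Hypothesis IB' : interval_basis o' d' p.+1 (row_arrows h') I' B' C'.

Let inI j := (fun b => in_itv j (I b)).
Let inI' j := (fun b => in_itv j (I' b)).

Definition coord_entry w (j : nat) b' b : F := (B' j *m row_arrows w j *m C j) b' b.

(** In interval bases the equation splits into one scalar equation for each pair of
basis vectors living at j. *)
Lemma coord_gradient w (j : nat) : (j <= p)%N -> ~~ o j ->
  (gradient h h' w j == 0) =
  [forall b', forall b, inI j b && inI' j b' ==>
     ((if (j < p)%N then coord_entry w j.+1 b' b else 0) ==
      (if (0 < j)%N then coord_entry w j.-1 b' b else 0))].
Proof.
move=> jp oj; have [_ db arr] := IB; have [_ db' arr'] := IB'.
have dbj := db j jp; have dbj' := db' j jp.
pose Z := (if (j < p)%N then B' j.+1 *m row_arrows w j.+1 *m C j.+1 else 0)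
  - (if (0 < j)%N then B' j.-1 *m row_arrows w j.-1 *m C j.-1 else 0).
have gE : gradient h h' w j = C' j *m Z *m B j.
  rewrite /Z mulmxBr mulmxBl /gradient; congr (_ - _).
    case: ifP => jp'; last by rewrite mulmx0 mul0mx.
    rewrite arr // arr' // /arrow_tail /arrow_head oo' (negbTE oj) /=.
    by rewrite !mulmxA.
  case: ifP => j0; last by rewrite mulmx0 mul0mx.
  have oj1 : o j.-1 by have := alt j.-1; rewrite prednK // (negbTE oj); case: (o _).
  rewrite arr ?arr' ?prednK // /arrow_tail /arrow_head oo' oj1 /= prednK //.
  by rewrite !mulmxA.
have ZE b' b : Z b' b = (if (j < p)%N then coord_entry w j.+1 b' b else 0)
    - (if (0 < j)%N then coord_entry w j.-1 b' b else 0).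
  by rewrite /Z /coord_entry mxE [in X in _ + X]mxE; congr (_ - _);
    case: ifP => // _; rewrite mxE.
have mask b' b : (B' j *m (C' j *m Z *m B j) *m C j) b' b =
    (inI' j b')%:R * Z b' b * (inI j b)%:R.
  case: dbj => _ _ _ BC; case: dbj' => _ _ _ BC'.
  rewrite !mulmxA BC' -!mulmxA BC !mulmxA mulmx_coord_projr.
  by rewrite mulmx_coord_projl.
apply/eqP/forallP => [g0 b'|hZ].
  apply/forallP => b; apply/implyP => /andP[jb jb']; rewrite -subr_eq0 -ZE.
  have := mask b' b; rewrite -gE g0 mulmx0 mul0mx mxE jb jb' mul1r mulr1.
  by move=> <-.
rewrite gE; have -> : C' j *m Z *m B j = C' j *m (B' j *m (C' j *m Z *m B j) *m C j) *m B j.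
  case: dbj => _ BP CB _; case: dbj' => PC' _ CB' _.
  by rewrite !mulmxA CB' PC' -!mulmxA CB BP.
rewrite [X in C' j *m X](_ : _ = 0) ?mulmx0 ?mul0mx //.
apply/matrixP => b' b; rewrite mask [RHS]mxE.
have /forallP/(_ b) := hZ b'; case jb: (inI j b); last by rewrite mulr0.
case jb': (inI' j b'); last by rewrite mul0r mul0r.
by rewrite ZE => /eqP ->; rewrite subrr mulr0 mul0r.
Qed.

Definition of_scalars (y : {ffun 'I_K' * 'I_K -> F}) : row :=
  [ffun j : 'I_p.+1 => C' j *m (\matrix_(b', b)
     (if [&& o j, inI j b & inI' j b'] then y (b', b) else 0)) *m B j].

Lemma coord_of_scalars y (j : nat) b' b : (j <= p)%N ->
  coord_entry (of_scalars y) j b' b =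
  if [&& o j, inI j b & inI' j b'] then y (b', b) else 0.
Proof.
move=> jp; have [_ db _] := IB; have [_ db' _] := IB'.
have [_ _ _ BC] := db j jp; have [_ _ _ BC'] := db' j jp.
rewrite /coord_entry /row_arrows ffunE inordK ?ltnS // !mulmxA BC' -!mulmxA BC !mulmxA.
rewrite mulmx_coord_projr mulmx_coord_projl mxE -/(inI j b) -/(inI' j b').
by case: (inI j b); case: (inI' j b'); rewrite /= ?andbF ?mul1r ?mulr1 ?mulr0 ?mul0r.
Qed.

Lemma row_of_coord w (j : 'I_p.+1) : w \in family up_dom ->
  w j = C' j *m (B' j *m row_arrows w j *m C j) *m B j.
Proof.
move=> wd; have [_ db _] := IB; have [_ db' _] := IB'.
have jp : (j <= p)%N by rewrite -ltnS.
have [_ BP CB _] := db j jp; have [PC' _ CB' _] := db' j jp.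
rewrite /row_arrows inord_val !mulmxA CB' -!mulmxA CB !mulmxA.
have := familyP wd j; rewrite /up_dom; case: ifP => _; first by move/eqP=> ->.
by rewrite inE => /eqP ->; rewrite mulmx0 mul0mx.
Qed.

(** By [chain_constant], in coordinates an element of the kernel is one scalar for each
linked pair of intervals, constant along the overlap. *)
Lemma coupling_kernel_image :
  coupling_kernel h h' = of_scalars @: [set y in family
    (fun bb => if linked o (I bb.2) (I' bb.1) then predT else pred1 (0 : F))].
Proof.
have [Iok db _] := IB; have [Iok' db' _] := IB'.
have jp (j : 'I_p.+1) : (j <= p)%N by rewrite -ltnS.
have both j b b' : inI j b && inI' j b' =
    (maxn (I b).1 (I' b').1 <= j <= minn (I b).2 (I' b').2)%N.
  by rewrite /inI /inI' /in_itv geq_max leq_min andbACA.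
apply/setP => w; apply/idP/imsetP => [|[y]].
  rewrite !inE => /andP[wd /forallP wk].
  pose y : {ffun 'I_K' * 'I_K -> F} := [ffun bb =>
    if linked o (I bb.2) (I' bb.1) then
      coord_entry w (maxn (I bb.2).1 (I' bb.1).1) bb.1 bb.2 else 0].
  exists y.
    rewrite inE; apply/familyP => -[b' b] /=; rewrite ffunE /=.
    by case: ifP => // _; rewrite inE.
  apply/ffunP => j; rewrite (row_of_coord _ wd) ffunE; congr (_ *m _ *m _).
  apply/matrixP => b' b; rewrite [RHS]mxE.
  case oj: (o j) => /=; last first.
    have := familyP wd j; rewrite /up_dom oj inE => /eqP w0.
    by rewrite /row_arrows inord_val w0 mulmx0 mul0mx mxE.
  (* Shifted by one so that the missing neighbour of the vertex 0 is also a value 0. *)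
  pose z k := if (0 < k <= p.+1)%N && (inI k.-1 b && inI' k.-1 b')
    then coord_entry w k.-1 b' b else 0.
  have outside k : (k <= p)%N -> inI k b && inI' k b' = false -> coord_entry w k b' b = 0.
    move=> kp nk; rewrite /coord_entry.
    have := dual_bases_projl (db' k kp); have := dual_bases_projr (db k kp).
    move=> <- <-; rewrite -!mulmxA mulmx_coord_projl !mulmxA mulmx_coord_projr.
    rewrite -/(inI k b) -/(inI' k b'); move: nk.
    by case: (inI k b); case: (inI' k b') => //= _; rewrite ?mulr0 ?mul0r.
  case jb: (inI j b && inI' j b'); last by apply: outside.
  have lohi : (maxn (I b).1 (I' b').1 <= minn (I b).2 (I' b').2)%N.
    by move: jb; rewrite both => /andP[]; apply: leq_trans.
  have hip : (minn (I b).2 (I' b').2 <= p)%N by rewrite geq_min -ltnS ltn_ord.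
  have zE k : (k <= p)%N -> z k.+1 = coord_entry w k b' b.
    move=> kp; rewrite /z (_ : (0 < k.+1 <= p.+1)%N) //= .
    by case: ifP => // nk; exact/esym/outside.
  have z_zero k : ~~ ((maxn (I b).1 (I' b').1 < k) && (k <= (minn (I b).2 (I' b').2).+1))%N ->
      z k = 0.
    move=> nk; rewrite /z; case: ifP => // /andP[/andP[k0 kp]].
    rewrite both => /andP[k1 k2]; case/negP: nk; apply/andP; split; lia.
  have z_step k : (maxn (I b).1 (I' b').1 <= k <= minn (I b).2 (I' b').2)%N -> ~~ o k ->
      z k.+2 = z k.
    move=> kk ok; have kp : (k <= p)%N by case/andP: kk => _ h1; apply: leq_trans h1 hip.
    have kp1 : (k < p.+1)%N by [].
    have /implyP := wk (Ordinal kp1); rewrite /= => /(_ ok).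
    rewrite coord_gradient // => /forallP/(_ b')/forallP/(_ b).
    rewrite both kk /= => /eqP; case: ltnP => [kp2|pk].
      rewrite zE // => ->; case: k {kk ok kp1} kp kp2 => [|k] kp kp2 /=.
        by rewrite /z.
      by rewrite zE // ltnW.
    have -> : z k.+2 = 0 by rewrite /z; case: ifP => // /andP[/andP[_]]; lia.
    move=> ->; case: k {kk ok kp1} kp pk => [|k] kp pk /=; first by rewrite /z.
    by rewrite zE // ltnW.
  have := chain_constant alt z_zero z_step lohi (j := j).
  rewrite -both jb => /(_ isT oj); rewrite zE // -/(coord_entry w j b' b) => ->.
  rewrite ffunE /= /linked lohi /=; case: ifP => // _.
  by rewrite zE // (leq_trans lohi).
rewrite inE => /familyP yd ->; rewrite inE; apply/andP; split.
  apply/familyP => j; rewrite /up_dom ffunE.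
  have [_ BP _ _] := db j (jp j); have [PC' _ _ _] := db' j (jp j).
  case: ifP => oj; first by rewrite unfold_in /hom_space !mulmxA PC' -!mulmxA BP.
  rewrite inE; apply/eqP; rewrite [X in C' j *m X](_ : _ = 0) ?mulmx0 ?mul0mx //.
  by apply/matrixP => b' b; rewrite !mxE.
apply/forallP => j; apply/implyP => oj; rewrite coord_gradient //.
apply/forallP => b'; apply/forallP => b; apply/implyP => jb.
have yl : y (b', b) != 0 -> linked o (I b) (I' b').
  by have := yd (b', b); rewrite /=; case: ifP => // _; rewrite inE => /eqP ->; rewrite eqxx.
have [y0|/yl] := eqVneq (y (b', b)) 0.
  have z0 k : (k <= p)%N -> coord_entry (of_scalars y) k b' b = 0.
    by move=> kp; rewrite coord_of_scalars // y0 if_same.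
  by apply/eqP; case: ltnP => [/z0 ->|_]; case: ltnP => [_|//]; rewrite ?z0 // (leq_trans (leq_pred _)).
rewrite /linked => /and3P[lohi olo ohi].
move: jb; rewrite both => /andP[loj jhi].
have loj' : (maxn (I b).1 (I' b').1 < j)%N.
  by rewrite ltn_neqAle loj andbT; apply/eqP => h1; rewrite -h1 olo in oj.
have jhi' : (j < minn (I b).2 (I' b').2)%N.
  by rewrite ltn_neqAle jhi andbT; apply/eqP => h1; rewrite h1 ohi in oj.
have hip : (minn (I b).2 (I' b').2 <= p)%N by rewrite geq_min -ltnS ltn_ord.
have j0 : (0 < j)%N by apply: leq_ltn_trans loj'.
have jlt : (j < p)%N by apply: leq_trans jhi' hip.
have oj1 : o j.-1 by have := alt j.-1; rewrite prednK // (negbTE oj); case: (o _).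
rewrite jlt j0 !coord_of_scalars //; last by rewrite (leq_trans (leq_pred _)) // ltnW.
rewrite alt oj oj1 /= !both.
have -> : (maxn (I b).1 (I' b').1 <= j.+1 <= minn (I b).2 (I' b').2)%N by lia.
by have -> : (maxn (I b).1 (I' b').1 <= j.-1 <= minn (I b).2 (I' b').2)%N by lia.
Qed.

Lemma card_coupling_kernel_basis :
  #|coupling_kernel h h'| =
  (#|F| ^ #|[set bb : 'I_K' * 'I_K | linked o (I bb.2) (I' bb.1)]|)%N.
Proof.
rewrite coupling_kernel_image card_in_imset; last first.
  move=> y1 y2; rewrite !inE => /familyP h1 /familyP h2 e.
  apply/ffunP => -[b' b]; have := h1 (b', b); have := h2 (b', b) => /=.
  case: ifP => [lk _ _|_]; last by rewrite !inE => /eqP -> /eqP ->.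
  have /and3P[lohi olo ohi] := lk.
  have hip : (minn (I b).2 (I' b').2 <= p)%N by rewrite geq_min -ltnS ltn_ord.
  have lop : (maxn (I b).1 (I' b').1 <= p)%N by apply: leq_trans lohi hip.
  have := coord_of_scalars y1 b' b lop; rewrite e coord_of_scalars // olo /=.
  have -> : inI (maxn (I b).1 (I' b').1) b && inI' (maxn (I b).1 (I' b').1) b'.
    rewrite /inI /inI' /in_itv leq_maxl leq_maxr /=.
    by move: lohi; rewrite leq_min => /andP[-> ->].
  by move=> ->.
rewrite cardsE card_family_prod (eq_bigr (fun bb : 'I_K' * 'I_K =>
  if linked o (I bb.2) (I' bb.1) then #|F| else 1%N)); last first.
  by move=> bb _; case: ifP => _; rewrite ?card1.
rewrite -big_mkcond prod_nat_const; congr (_ ^ _)%N.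
by apply: eq_card => bb; rewrite inE.
Qed.

End CouplingKernel.

(** * The potential of a grid *)

Section KernelOfMults.
Variables (F : finFieldType) (D p : nat).

Lemma sum_over_basis K (I : 'I_K -> itv p) (f : itv p -> nat) :
  (\sum_b f (I b) = \sum_J mult I J * f J)%N.
Proof.
rewrite (partition_big I predT) //=; apply: eq_bigr => J _.
rewrite (eq_bigr (fun=> f J)) => [|b /eqP -> //].
by rewrite sum_nat_const; congr muln; apply: eq_card => b; rewrite !inE.
Qed.

Lemma card_coupling_kernel (d d' : nat -> nat) (o o' : nat -> bool)
    (h h' : {ffun 'I_p.+1 -> 'M[F]_D}) (m m' : mults D p) :
  (forall j, o j.+1 = ~~ o j) -> (forall j, o' j = ~~ o j) ->
  has_mults d o p.+1 (row_arrows h) m -> has_mults d' o' p.+1 (row_arrows h') m' ->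
  #|coupling_kernel d d' o h h'| =
  (#|F| ^ (\sum_J \sum_J' linked o J J' * (m J * m' J')))%N.
Proof.
move=> alt oo' [K [I [B [C [IB mE]]]]] [K' [I' [B' [C' [IB' mE']]]]].
rewrite (card_coupling_kernel_basis alt oo' IB IB'); congr (_ ^ _)%N.
transitivity (\sum_b' \sum_b if linked o (I b) (I' b') then 1 else 0)%N.
  rewrite pair_bigA -sum1_card big_mkcond; apply: eq_bigr => -[b' b] _ /=.
  by rewrite inE.
rewrite exchange_big (sum_over_basis I (fun J => \sum_b' if linked o J (I' b') then 1 else 0)%N).
apply: eq_bigr => J _; rewrite mE.
rewrite (sum_over_basis I' (fun J' => if linked o J J' then 1 else 0)%N) big_distrr.
by apply: eq_bigr => J' _ /=; rewrite mE'; case: ifP; lia.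
Qed.

End KernelOfMults.

Section LinearZeros.
Variables (F : finFieldType) (U : finType) (V : {set U}) (L : U -> F).

(** The shifts show that L takes every value equally often. *)
Lemma card_zeros_shift (sh : F -> U -> U) :
  (forall c x, x \in V -> sh c x \in V) ->
  (forall c x, x \in V -> L (sh c x) = L x + c) ->
  (forall c x, sh (- c) (sh c x) = x) ->
  (#|F| * #|[set x in V | L x == 0%R]| = #|V|)%N.
Proof.
move=> shV shL shK; rewrite -[RHS]sum1_card (partition_big L predT) //=.
rewrite (eq_bigr (fun=> #|[set x in V | L x == 0]|)) ?sum_nat_const // => c _.
rewrite sum1_card -[RHS](card_imset _ (can_inj (shK c))).
apply: eq_card => x; rewrite [LHS]unfold_in; apply/andP/imsetP => [[xV /eqP Lx]|[y]].
  exists (sh (- c) x); last by rewrite -{1}[c]opprK shK.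
  by rewrite !inE shV //= shL // Lx subrr.
by rewrite !inE => /andP[yV /eqP Ly] ->; rewrite shV // shL // Ly add0r.
Qed.

End LinearZeros.

Section Grid.
Variables (F : finFieldType) (D : nat).
Local Notation row p := {ffun 'I_p.+1 -> 'M[F]_D}.
Local Notation grid n p := {ffun 'I_n.+1 -> row p}.

(** For delta = false this is the orientation of the quiver: the arrow of row i between
j and j.+1 leaves j if i + j is odd.  Transposing the grid reverses delta, and the
column arrow between i and i.+1 goes down if this value is false. *)
Definition row_orientation (delta : bool) (i j : nat) : bool := odd (i + j) (+) delta.

Definition grid_dom n p delta (g : nat -> nat -> nat) (i : 'I_n.+1) : pred (row p) :=
  family (row_dom (g i) (row_orientation delta i) p.+1).

Definition entry n p (h : grid n p) (i j : nat) : 'M[F]_D := row_arrows (h (inord i)) j.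

(** The sum over the unit squares of the trace of the oriented 4-cycle around the
square, with a sign given by its orientation; h is indexed by rows and v by columns. *)
Definition potential n p delta (h : grid n p) (v : grid p n) : F :=
  \sum_(i < n) \sum_(j < p)
    if row_orientation delta i j then
      - \tr (entry v j i *m entry h i j *m entry v j.+1 i *m entry h i.+1 j)
    else \tr (entry v j i *m entry h i.+1 j *m entry v j.+1 i *m entry h i j).

(** The cycle around a square is the same seen from the rows or from the columns, but
the corner where it is read moves, and the parity changes. *)
Lemma potential_tr n p delta (h : grid n p) (v : grid p n) :
  potential (~~ delta) v h = - potential delta h v.
Proof.
rewrite /potential exchange_big -sumrN; apply: eq_bigr => i _ /=.
rewrite -sumrN; apply: eq_bigr => j _.
rewrite /row_orientation addnC addbN; case: (odd _ (+) _) => /=.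
  by rewrite opprK -!mulmxA [RHS]mxtrace_mulC !mulmxA.
by congr (- _); rewrite -!mulmxA [LHS]mxtrace_mulC !mulmxA.
Qed.

Definition zero_count n p delta g : nat :=
  (\sum_(h in family (@grid_dom n p delta g))
    #|[set v in family (@grid_dom p n (~~ delta) (fun j i => g i j))
        | potential delta h v == 0%R]|)%N.

Lemma zero_count_tr n p delta g :
  zero_count p n (~~ delta) (fun j i => g i j) = zero_count n p delta g.
Proof.
rewrite /zero_count negbK.
rewrite (eq_bigr (fun v => \sum_(h in family (@grid_dom n p delta g))
    (potential delta h v == 0%R))%N); last first.
  move=> v _; rewrite -sum1_card big_mkcond [RHS]big_mkcond; apply: eq_bigr => h _.
  by rewrite inE potential_tr oppr_eq0; case: (h \in _).
rewrite exchange_big; apply: eq_bigr => h _.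
rewrite -sum1_card big_mkcond [RHS]big_mkcond; apply: eq_bigr => v _.
by rewrite inE; case: (v \in _).
Qed.

Section FixedRows.
Variables (n p : nat) (delta : bool) (g : nat -> nat -> nat) (h : grid n p).
Hypothesis hdom : h \in family (@grid_dom n p delta g).
Local Notation e := (row_orientation delta).

(** The column arrows going up or, for up = false, those going down. *)
Definition half_dom (up : bool) (j : 'I_p.+1) : pred (row n) :=
  family (fun i : 'I_n.+1 => if e i j == up
    then row_dom (fun i => g i j) (row_orientation (~~ delta) j) n.+1 i else pred1 (0 : 'M[F]_D)).

Definition half up (v : grid p n) : grid p n :=
  [ffun j : 'I_p.+1 => [ffun i : 'I_n.+1 => if e i j == up then v j i else 0]].

Definition merge (v0 v1 : grid p n) : grid p n :=
  [ffun j : 'I_p.+1 => [ffun i : 'I_n.+1 => if e i j then v1 j i else v0 j i]].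

Lemma sum_halves (f : grid p n -> nat) :
  (\sum_(v in family (@grid_dom p n (~~ delta) (fun j i => g i j))) f v =
   \sum_(v1 in family (half_dom true)) \sum_(v0 in family (half_dom false))
     f (merge v0 v1))%N.
Proof.
rewrite pair_big_dep /= (reindex_onto (fun vv : grid p n * grid p n => merge vv.2 vv.1)
   (fun v => (half true v, half false v))) /=; last first.
  move=> v _; apply/ffunP => j; apply/ffunP => i; rewrite !ffunE.
  by case: (e i j).
apply: eq_bigl => -[v1 v0] /=; apply/andP/andP => [[/familyP vd /eqP[e1 e0]]|[/familyP d1 /familyP d0]].
  split; apply/familyP => j; apply/familyP => i.
    rewrite -e1 !ffunE; have := familyP (vd j) i; rewrite !ffunE.
    by case: ifP => //; rewrite inE.
  rewrite -e0 !ffunE; have := familyP (vd j) i; rewrite !ffunE.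
  by case: (e i j) => //= _; rewrite inE.
split.
  apply/familyP => j; apply/familyP => i; rewrite !ffunE.
  have := familyP (d1 j) i; have := familyP (d0 j) i.
  by case: (e i j).
rewrite xpair_eqE; apply/andP; split; apply/eqP/ffunP => j; apply/ffunP => i; rewrite !ffunE.
  have := familyP (d1 j) i; case: (e i j) => //=.
  by rewrite inE => /eqP.
have := familyP (d0 j) i; case: (e i j) => //=.
by rewrite inE => /eqP.
Qed.

Definition gap (v : grid p n) (i : nat) : row p := [ffun j : 'I_p.+1 => v j (inord i)].

Definition grad (v1 : grid p n) (i j : nat) : 'M[F]_D :=
  gradient (h (inord i)) (h (inord i.+1)) (gap v1 i) j.

Lemma alt_orientation i j : e i j.+1 = ~~ e i j.
Proof. by rewrite /row_orientation addnS /= addNb. Qed.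

(** The potential is linear in the arrows going down, with coefficients the gradients. *)
Lemma potential_merge v0 v1 :
  v0 \in family (half_dom false) -> v1 \in family (half_dom true) ->
  potential delta h (merge v0 v1) =
  \sum_(i < n) \sum_(j < p.+1) if e i j then 0 else \tr (entry v0 j i *m grad v1 i j).
Proof.
move=> d0 d1; apply: eq_bigr => i _.
have i_n : (i < n.+1)%N by apply: leq_trans (ltn_ord i) _.
have mE (j : nat) : (j <= p)%N ->
    entry (merge v0 v1) j i = if e i j then entry v1 j i else entry v0 j i.
  by move=> jp; rewrite /entry /row_arrows !ffunE !inordK // ltnS.
have gE (j : nat) : (j <= p)%N -> row_arrows (gap v1 i) j = entry v1 j i.
  by move=> jp; rewrite /row_arrows /gap ffunE.
pose A (j : nat) := \tr (entry v0 j i *m entry h i.+1 j *m entry v1 j.+1 i *m entry h i j).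
pose A' (j : nat) := \tr (entry v0 j.+1 i *m entry h i.+1 j *m entry v1 j i *m entry h i j).
transitivity (\sum_(j < p) (if e i j then 0 else A j) - \sum_(j < p) (if e i j then A' j else 0)).
  rewrite -sumrB; apply: eq_bigr => j _.
  rewrite !mE ?alt_orientation //; last exact: ltnW.
  case: (e i j) => /=; last by rewrite subr0.
  rewrite sub0r /A'; congr (- _).
  by rewrite -[in LHS]mulmxA [LHS]mxtrace_mulC !mulmxA.
transitivity (\sum_(j < p.+1) (if e i j then 0 else if (j < p)%N then A j else 0)
    - \sum_(j < p.+1) (if e i j then 0 else if (0 < j)%N then A' j.-1 else 0)).
  congr (_ - _).
    rewrite big_ord_recr /= ltnn if_same addr0; apply: eq_bigr => j _.
    by rewrite ltn_ord.
  rewrite big_ord_recl /= if_same add0r; apply: eq_bigr => j _.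
  by rewrite /bump leq0n add1n alt_orientation; case: (e i j).
rewrite -sumrB; apply: eq_bigr => j _.
case eij: (e i j); first by rewrite subrr.
rewrite /grad /gradient mulmxBr linearB /=; congr (_ - _).
  case: ltnP => jp; last by rewrite mulmx0 mxtrace0.
  by rewrite gE // /A !mulmxA.
case: ltnP => j0; last by rewrite mulmx0 mxtrace0.
rewrite gE; last by rewrite -ltnS (leq_ltn_trans (leq_pred _)).
by rewrite /A' prednK // !mulmxA.
Qed.

End FixedRows.
End Grid.

(** * Zeros of the potential above fixed rows *)

Lemma mxtrace_delta (F : fieldType) D (i j : 'I_D) (G : 'M[F]_D) :
  \tr (delta_mx i j *m G) = G j i.
Proof.
rewrite /mxtrace (bigD1 i) //= big1 ?addr0.
  rewrite mxE (bigD1 j) //= big1 ?addr0 ?mxE ?eqxx ?mul1r // => k kj.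
  by rewrite mxE (negbTE kj) andbF mul0r.
move=> k ki; rewrite mxE big1 // => l _.
by rewrite mxE (negbTE ki) mul0r.
Qed.

Section ZeroCount.
Variables (F : finFieldType) (D : nat).
Local Notation row p := {ffun 'I_p.+1 -> 'M[F]_D}.
Local Notation grid n p := {ffun 'I_n.+1 -> row p}.
Variables (n p : nat) (delta : bool) (g : nat -> nat -> nat) (h : grid n p).
Hypothesis hdom : h \in family (@grid_dom F D n p delta g).
Local Notation e := (row_orientation delta).
Local Notation V0 := (family (@half_dom F D n p delta g false)).
Local Notation V1 := (family (@half_dom F D n p delta g true)).
Implicit Types (v : grid p n).

Lemma entry_hom i j : (i <= n)%N -> (j < p)%N ->
  hom_space (g i (arrow_tail (e i) j)) (g i (arrow_head (e i) j)) (entry h i j).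
Proof.
move=> i_n jp; have := familyP (familyP hdom (inord i)) (inord j).
by rewrite /row_dom !inordK ?ltnS ?jp // 1?ltnW.
Qed.

Lemma grad_hom v i j : (i < n)%N -> (j <= p)%N -> ~~ e i j ->
  hom_space (g i.+1 j) (g i j) (grad h v i j).
Proof.
move=> i_n jp eij; rewrite /hom_space /grad /gradient.
have sub x y : hom_space (g i.+1 j) (g i j) x -> hom_space (g i.+1 j) (g i j) y ->
    hom_space (D := D) (F := F) (g i.+1 j) (g i j) (x - y).
  by move=> /eqP xH /eqP yH; rewrite /hom_space mulmxBr mulmxBl xH yH.
have zero : hom_space (D := D) (F := F) (g i.+1 j) (g i j) 0.
  by rewrite /hom_space mulmx0 mul0mx.
have eSi k : e i.+1 k = ~~ e i k by rewrite /row_orientation addSn /= addNb.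
have comp (x y z : 'M[F]_D) a b : hom_space (g i.+1 j) a x -> hom_space b (g i j) z ->
    hom_space (g i.+1 j) (g i j) (x *m y *m z).
  move=> /eqP xH /eqP zH; rewrite /hom_space -xH -zH.
  by rewrite !mulmxA pid_idem -!mulmxA pid_idem.
apply: sub.
  case: ltnP => [jp'|_]; last exact: zero.
  apply: comp; last by have := entry_hom (ltnW i_n) jp'; rewrite /arrow_tail /arrow_head (negbTE eij); exact.
  by have := entry_hom i_n jp'; rewrite /arrow_tail /arrow_head eSi eij; exact.
case: ltnP => [j0|_]; last exact: zero.
have ej1 : e i j.-1.
  by have := alt_orientation delta i j.-1; rewrite prednK // (negbTE eij); case: (e i _).
have jp' : (j.-1 < p)%N by rewrite prednK.
apply: comp; last first.
  by have := entry_hom (ltnW i_n) jp'; rewrite /arrow_tail /arrow_head ej1 prednK //; exact.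
by have := entry_hom i_n jp'; rewrite /arrow_tail /arrow_head eSi ej1 /= prednK //; exact.
Qed.

(** The potential vanishes identically in the arrows going down. *)
Definition flat v : bool :=
  [forall i : 'I_n, forall j : 'I_p.+1, ~~ e i j ==> (grad h v i j == 0)].

(** If some gradient is nonzero, moving the corresponding arrow along a suitable
matrix E changes the potential by any prescribed constant. *)
Lemma zeros_over_half v1 : v1 \in V1 ->
  (#|F| * #|[set v0 in V0 | potential delta h (merge delta v0 v1) == 0%R]| =
   #|V0| * (if flat v1 then #|F| else 1))%N.
Proof.
move=> d1; have [fl|] := boolP (flat v1).
  rewrite mulnC; congr muln; rewrite cardsE; apply: eq_card => v0.
  rewrite unfold_in; apply: andb_idr => d0; rewrite (potential_merge h d0 d1).
  apply/eqP/big1 => i _; apply: big1 => j _; case eij: (e i j) => //.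
  have /forallP/(_ i)/forallP/(_ j)/implyP := fl; rewrite eij => /(_ isT)/eqP ->.
  by rewrite mulmx0 mxtrace0.
rewrite negb_forall => /existsP[i]; rewrite negb_forall => /existsP[j].
rewrite negb_imply => /andP[eij G0].
have jp : (j <= p)%N by rewrite -ltnS.
have i_n := ltn_ord i.
have GH := grad_hom v1 i_n jp eij.
set G := grad h v1 i j in G0 GH *.
have [a [b Gab]] : exists a b, G a b != 0.
  have [/existsP[a /existsP[b ?]]|] := boolP [exists a, exists b, G a b != 0].
    by exists a, b.
  rewrite negb_exists => /forallP G00; case/eqP: G0; apply/matrixP => a b.
  have := G00 a; rewrite negb_exists => /forallP/(_ b); rewrite negbK => /eqP ->.
  by rewrite mxE.
(* Dual to the nonzero entry of G, and cut down to the right dimensions. *)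
pose E := (G a b)^-1 *: (pid_mx (g i j) *m delta_mx b a *m pid_mx (g i.+1 j)) : 'M[F]_D.
have EG : \tr (E *m G) = 1.
  rewrite /E -scalemxAl mxtraceZ -!mulmxA mxtrace_mulC -!mulmxA (mulmxA _ G).
  by rewrite (eqP GH) mxtrace_delta mulVf.
have EH : hom_space (g i j) (g i.+1 j) E.
  by rewrite /hom_space /E -scalemxAr -scalemxAl !mulmxA pid_idem -!mulmxA pid_idem.
pose i0 : 'I_n.+1 := inord i.
have i0E : nat_of_ord i0 = i by rewrite inordK // ltnS ltnW.
pose sh c v : grid p n := [ffun j' : 'I_p.+1 => [ffun i' : 'I_n.+1 =>
  if (j' == j) && (i' == i0) then v j' i' + c *: E else v j' i']].
have shV c v : v \in V0 -> sh c v \in V0.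
  move=> /familyP vd; apply/familyP => j'; apply/familyP => i'.
  have := familyP (vd j') i'; rewrite !ffunE.
  have [/andP[/eqP -> /eqP ->]|//] := boolP ((j' == j) && (i' == i0)).
  rewrite i0E (negbTE eij) /= /row_dom i0E ltnS i_n.
  rewrite !unfold_in /arrow_space /arrow_tail /arrow_head.
  have -> : row_orientation (~~ delta) j i.
    by move: eij; rewrite /row_orientation addnC addbN.
  move=> /eqP vH; rewrite /hom_space mulmxDr mulmxDl vH.
  by rewrite -scalemxAr -scalemxAl (eqP EH).
rewrite muln1; transitivity (#|F| * #|[set v0 in [set v in V0] |
    potential delta h (merge delta v0 v1) == 0%R]|)%N.
  by congr muln; apply: eq_card => v; rewrite !inE.
rewrite (@card_zeros_shift F _ [set v in V0]
  (fun v0 => potential delta h (merge delta v0 v1)) sh).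
- by rewrite cardsE.
- by move=> c v; rewrite !inE; apply: shV.
- move=> c v; rewrite inE => vd; have shd := shV c v vd.
  rewrite (potential_merge h shd d1) (potential_merge h vd d1) (bigD1 i) //= [in RHS](bigD1 i) //= addrAC; congr (_ + _).
    rewrite (bigD1 j) //= [in RHS](bigD1 j) //= (negbTE eij) [RHS]addrAC; congr (_ + _).
      rewrite /entry /row_arrows !ffunE inord_val !eqxx /= mulmxDl mxtraceD.
      by rewrite -scalemxAl mxtraceZ EG mulr1.
    apply: eq_bigr => j' j'j; case: (e i j') => //.
    by rewrite /entry /row_arrows !ffunE inord_val (negbTE j'j).
  apply: eq_bigr => i' i'i; apply: eq_bigr => j' _; case: (e i' j') => //.
  rewrite /entry /row_arrows !ffunE inord_val [X in _ && X](_ : _ = false) ?andbF //.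
  rewrite -(inj_eq val_inj) /= i0E inordK ?ltnS; last by rewrite ltnW.
  by apply/negbTE; apply: contra i'i => /eqP i'i; apply/eqP/val_inj.
move=> c v; apply/ffunP => j'; apply/ffunP => i'; rewrite !ffunE.
by case: (_ && _) => //=; rewrite scaleNr addrK.
Qed.

(** The equations for the arrows going up between different pairs of rows are
independent of each other. *)
Lemma card_flat :
  #|[set v in V1 | flat v]| =
  (\prod_(i < n) #|coupling_kernel (g i) (g i.+1) (e i) (h (inord i)) (h (inord i.+1))|)%N.
Proof.
pose ker (i : 'I_n) := coupling_kernel (g i) (g i.+1) (e i) (h (inord i)) (h (inord i.+1)).
pose T v : {ffun 'I_n -> row p} := [ffun i : 'I_n => gap v i].
rewrite -(card_family_prod (fun i => [in ker i])).
have wi (i : 'I_n) : nat_of_ord (inord i : 'I_n.+1) = i by rewrite inordK // ltnS ltnW.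
have up_E (i : 'I_n) (j : 'I_p.+1) : e i j ->
    row_dom (fun i => g i j) (row_orientation (~~ delta) j) n.+1 (inord i : 'I_n.+1)
    = hom_space (D := D) (F := F) (g i.+1 j) (g i j).
  move=> eij; rewrite /row_dom wi ltnS ltn_ord /arrow_space /arrow_tail /arrow_head.
  by rewrite (_ : row_orientation (~~ delta) j i = false) //; move: eij;
    rewrite /row_orientation addnC addbN => ->.
have Tinj : {in [set v in V1 | flat v] &, injective T}.
  move=> v w; rewrite !inE => /andP[/familyP vd _] /andP[/familyP wd _] vw.
  apply/ffunP => j; apply/ffunP => i; have [i_n|ni] := ltnP i n.
    have := congr1 (fun f : {ffun 'I_n -> row p} => f (Ordinal i_n) j) vw.
    by rewrite !ffunE /= inord_val.
  have z (w' : grid p n) : w' j \in half_dom delta g true j -> w' j i = 0.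
    move=> /familyP/(_ i); rewrite /row_dom ltnS ltnNge ni /=.
    by case: ifP => _; rewrite inE => /eqP.
  by rewrite z ?z.
rewrite -(card_in_imset Tinj); apply: eq_card => w.
apply/imsetP/familyP => [[v + ->] i|wk].
  rewrite inE => /andP[/familyP vd /forallP vf]; rewrite ffunE /ker inE.
  apply/andP; split; last first.
    by apply/forallP => j; have := forallP (vf i) j.
  apply/familyP => j; rewrite /gap ffunE /up_dom.
  have := familyP (vd j) (inord i); rewrite wi.
  case: ifP => [/eqP eij|]; first by rewrite up_E // eij.
  by case: (e i j).
pose v : grid p n := [ffun j : 'I_p.+1 => [ffun i : 'I_n.+1 =>
  oapp (fun i' : 'I_n => w i' j) 0 (insub (nat_of_ord i))]].
have gapv (i : 'I_n) : gap v i = w i.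
  apply/ffunP => j; rewrite !ffunE wi.
  by case: insubP => [i' _ /val_inj ->|] //=; rewrite ltn_ord.
exists v; last by apply/ffunP => i; rewrite ffunE gapv.
rewrite inE; apply/andP; split.
  apply/familyP => j; apply/familyP => i; rewrite !ffunE.
  case: insubP => [i' _ i'i|ni] /=.
    have := wk i'; rewrite inE => /andP[/familyP/(_ j) + _].
    rewrite /up_dom -i'i; case eij: (e i' j) => /=; last by [].
    have <- : inord i' = i :> 'I_n.+1 by apply: val_inj; rewrite /= wi.
    by rewrite up_E.
  rewrite /row_dom ltnS ltnNge leqNgt ni /=.
  by case: ifP => _; rewrite inE.
apply/forallP => i; apply/forallP => j; rewrite /grad gapv.
by have := wk i; rewrite inE => /andP[_ /forallP/(_ j)].
Qed.

Lemma zeros_fixed_rows :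
  (#|F| * #|[set v in family (@grid_dom F D p n (~~ delta) (fun j i => g i j))
             | potential delta h v == 0%R]|
   = #|family (@grid_dom F D p n (~~ delta) (fun j i => g i j))|
     + (#|F| - 1) * #|V0| *
       \prod_(i < n) #|coupling_kernel (g i) (g i.+1) (e i) (h (inord i)) (h (inord i.+1))|)%N.
Proof.
have F1 : (0 < #|F|)%N by apply/card_gt0P; exists 0.
have zE : (#|[set v in family (@grid_dom F D p n (~~ delta) (fun j i => g i j))
      | potential delta h v == 0%R]|
    = \sum_(v1 in V1) #|[set v0 in V0 | potential delta h (merge delta v0 v1) == 0%R]|)%N.
  have cnt (U : finType) (A : {pred U}) (P : pred U) :
      (#|[set x in A | P x]| = \sum_(x in A) (P x : nat))%N.
    rewrite -sum1_card big_mkcond [RHS]big_mkcond; apply: eq_bigr => x _.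
    by rewrite inE; case: (x \in A).
  rewrite cnt (sum_halves delta g (fun v => potential delta h v == 0%R : nat)).
  by apply: eq_bigr => v1 _; rewrite cnt.
rewrite zE big_distrr (eq_bigr _ zeros_over_half) /= -big_distrr /=.
rewrite -[X in (_ = X + _)%N]sum1_card (sum_halves delta g (fun=> 1%N)).
under [X in (_ = X + _)%N]eq_bigr do rewrite sum1_card.
rewrite -card_flat sum_nat_const.
rewrite (bigID flat) /= (eq_bigr (fun=> #|F|)); last by move=> v /andP[_ ->].
rewrite [X in (_ + X)%N](eq_bigr (fun=> 1%N)); last by move=> v /andP[_ /negbTE ->].
rewrite !sum_nat_const muln1.
have c1 : #|[pred v in V1 | flat v]| = #|[set v in V1 | flat v]|.
  by apply: eq_card => v; rewrite !inE.
have c2 : #|V1| = (#|[set v in V1 | flat v]| + #|[pred v in V1 | ~~ flat v]|)%N.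
  rewrite -c1 -!sum1_card (bigID flat) /=; congr addn.
move: c1 c2; set x1 := #|[pred v in V1 | flat v]|; set x2 := #|[pred v in V1 | ~~ flat v]|.
move=> -> ->; rewrite -[#|F|](prednK F1) subSS subn0; ring.
Qed.

End ZeroCount.

(** * The symmetry between rows and columns over a finite field *)

Lemma card_hom_space (F : finFieldType) D a b : (a <= D)%N -> (b <= D)%N ->
  #|(hom_space a b : pred 'M[F]_D)| = (#|F| ^ (a * b))%N.
Proof.
move=> aD bD; rewrite -card_mx.
pose f (y : 'M[F]_(a, b)) : 'M[F]_D := (pid_mx a : 'M_(D, a)) *m y *m (pid_mx b : 'M_(b, D)).
have fK : cancel f (fun x => (pid_mx a : 'M_(a, D)) *m x *m (pid_mx b : 'M_(D, b))).
  move=> y; rewrite /f !mulmxA mul_pid_mx minnn (minn_idPr aD) pid_mx_1 mul1mx -mulmxA.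
  by rewrite mul_pid_mx minnn (minn_idPr bD) pid_mx_1 mulmx1.
rewrite -(card_imset _ (can_inj fK)); apply: eq_card => x; rewrite unfold_in.
apply/eqP/imsetP => [<-|[y _ ->]].
  exists ((pid_mx a : 'M_(a, D)) *m x *m (pid_mx b : 'M_(D, b))) => //.
  rewrite /f !mulmxA mul_pid_mx !minnn -!mulmxA mul_pid_mx !minnn.
  by [].
rewrite /f !mulmxA mul_pid_mx minnn (minn_idPr aD) -!mulmxA mul_pid_mx minnn (minn_idPr bD).
by [].
Qed.

Section Cross.
Variable p : nat.
Implicit Types (I J : itv p) (o : nat -> bool).

(** The form between two neighbouring lines, up to sign. *)
Definition cross o I J : int :=
  \sum_(j < p.+1) (if o j then 1 else -1) * (in_itv j I && in_itv j J)%:Z.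

(** The alternating sum over an overlap is 1, -1 or 0 according to its end points. *)
Lemma linkedE o I J : (forall j, o j.+1 = ~~ o j) ->
  2 * (linked o I J)%:Z = `|cross o I J| + cross o I J.
Proof.
move=> alt.
pose lo := maxn I.1 J.1; pose hi := minn I.2 J.2.
pose sg (b : bool) : int := if b then 1 else -1.
have hip : (hi <= p)%N by rewrite /hi geq_min -ltnS ltn_ord.
have crossE : cross o I J = \sum_(lo <= j < hi.+1) sg (o j).
  rewrite [RHS](big_nat_widen _ _ p.+1) // big_geq_mkord [RHS]big_mkcond /=.
  apply: eq_bigr => j _; rewrite /in_itv.
  have -> : (I.1 <= j <= I.2)%N && (J.1 <= j <= J.2)%N = (lo <= j < hi.+1)%N.
    by rewrite /lo /hi ltnS geq_max leq_min andbACA.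
  rewrite [X in if X then sg _ else _]andbC.
  by case: (lo <= j < hi.+1)%N; rewrite ?mulr1 ?mulr0.
rewrite crossE /linked -/lo -/hi.
have sumE k : \sum_(lo <= j < (lo + k)%N) sg (o j) = if odd k then sg (o lo) else 0.
  elim: k => [|k IH]; first by rewrite addn0 big_geq.
  rewrite addnS big_nat_recr ?leq_addr //= IH.
  have -> : o (lo + k)%N = o lo (+) odd k.
    elim: k {IH} => [|k IH]; first by rewrite addn0 addbF.
    by rewrite addnS alt IH /= addbN.
  by case: (odd k); case: (o lo).
have [lohi|hilo] := leqP lo hi; last by rewrite big_geq.
rewrite -{1 2}(subnKC (leqW lohi)) sumE subSn //=.
have -> : o hi = o lo (+) odd (hi - lo)%N.
  rewrite -{1}(subnKC lohi); elim: (hi - lo)%N => [|k IH]; first by rewrite addn0 addbF.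
  by rewrite addnS alt IH /= addbN.
by case: (odd _); case: (o lo).
Qed.

(** The signed sum sees the dimension vectors only, so that replacing [linked] by
|cross| changes exponents by a quantity that does not depend on the
decomposition. *)
Lemma sum_cross (D : nat) o (d d' : nat -> nat) (m m' : mults D p) :
  valid d p.+1 m -> valid d' p.+1 m' ->
  \sum_I \sum_J cross o I J * ((m I)%:Z * (m' J)%:Z) =
  \sum_(j < p.+1) (if o j then 1 else -1) * ((d j)%:Z * (d' j)%:Z).
Proof.
move=> /validP[_ dm] /validP[_ dm'].
transitivity (\sum_(j < p.+1) (if o j then 1 else -1) *
   ((\sum_(I : itv p | in_itv j I) (m I)%:Z) * (\sum_(J : itv p | in_itv j J) (m' J)%:Z))).
  rewrite /cross; under eq_bigr do under eq_bigr do rewrite mulr_suml.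
  under eq_bigr do rewrite exchange_big /=.
  rewrite exchange_big; apply: eq_bigr => j _ /=.
  rewrite [X in _ = _ * (X * _)]big_mkcond [X in _ = _ * (_ * X)]big_mkcond.
  rewrite mulr_suml mulr_sumr.
  apply: eq_bigr => I _; rewrite mulr_sumr mulr_sumr; apply: eq_bigr => J _.
  by case: (in_itv j I); case: (in_itv j J); rewrite /= ?mulr0 ?mul0r ?mulr1 ?mulr0.
apply: eq_bigr => j _; have jp : (j <= p)%N by rewrite -ltnS.
by rewrite -!(big_morph Posz PoszD (erefl _)) dm // dm'.
Qed.

End Cross.

Section GridIdentity.
Variables (F : finFieldType) (R : fieldType) (s : R) (D : nat).
Let q := s ^+ 4.
Let u := q^-1.
Hypothesis sF : s ^+ 4 = #|F|%:R.
Hypothesis s0 : s != 0.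
Hypothesis u_unity : forall k, (0 < k)%N -> 1 - u ^+ k != 0.
Local Notation row p := {ffun 'I_p.+1 -> 'M[F]_D}.
Local Notation grid n p := {ffun 'I_n.+1 -> row p}.
Local Notation mgrid n p := {ffun 'I_n.+1 -> mults D p}.

(** The part of the number of zeros that depends on the representations; by
[zero_countE] it is determined by the number of zeros. *)
Definition coupled_count n p delta (g : nat -> nat -> nat) : nat :=
  (#|family (@half_dom F D n p delta g false)| *
   \sum_(h in family (@grid_dom F D n p delta g))
     \prod_(i < n) #|coupling_kernel (g i) (g i.+1) (row_orientation delta i)
                      (h (inord i)) (h (inord i.+1))|)%N.

Lemma zero_countE n p delta g :
  (#|F| * zero_count F D n p delta g =
   #|family (@grid_dom F D n p delta g)| *
     #|family (@grid_dom F D p n (~~ delta) (fun j i => g i j))|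
   + (#|F| - 1) * coupled_count n p delta g)%N.
Proof.
rewrite /zero_count big_distrr /= (eq_bigr _ (fun h hd => zeros_fixed_rows hd)).
rewrite big_split sum_nat_const /=; congr addn.
by rewrite /coupled_count mulnA big_distrr.
Qed.

Lemma coupled_count_tr n p delta g :
  coupled_count p n (~~ delta) (fun j i => g i j) = coupled_count n p delta g.
Proof.
have F1 : (1 < #|F|)%N by rewrite (cardD1 0) (cardD1 1) !inE oner_neq0.
have := zero_countE n p delta g; have := zero_countE p n (~~ delta) (fun j i => g i j).
rewrite zero_count_tr negbK => -> /eqP; rewrite [X in (X + _)%N == _]mulnC eqn_add2l.
by rewrite eqn_pmul2l ?subn_gt0 // => /eqP.
Qed.

(** Twice the exponent of X attached to a decomposition: |lambda| enters
with a positive sign inside a row, and with a negative sign for neighbouring rows,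
counted in both orders. *)
Definition grid_energy n p delta (m : mgrid n p) : int :=
  \sum_(i < n.+1) row_energy (row_orientation delta i) (fun J => m i J)
  - 2 * \sum_(i < n) \sum_I \sum_J `|cross (row_orientation delta i) I J|
        * ((m (inord i) I)%:Z * (m (inord i.+1) J)%:Z).

(** At X = s^(-2): the coefficient, up to sign, of the product of dilogarithms over the
rows of a grid of dimension g. *)
Definition grid_sum n p delta (g : nat -> nat -> nat) : R :=
  \sum_(m in family (fun i : 'I_n.+1 => valid (g i) p.+1) : pred (mgrid n p))
    s ^ (- grid_energy delta m) * \prod_i \prod_J (qpoch u (m i J))^-1.

Definition grid_gauge n p (g : nat -> nat -> nat) : R :=
  (\prod_(i < n.+1) \prod_(j < p.+1) (s ^+ (2 * g i j * g i j) * qpoch u (g i j)))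
  * s ^+ (2 * (\sum_(i < n.+1) \sum_(j < p) g i j * g i j.+1)
          + 2 * (\sum_(i < n) \sum_(j < p.+1) g i j * g i.+1 j)).

Lemma grid_gauge_tr n p g : grid_gauge p n (fun j i => g i j) = grid_gauge n p g.
Proof.
rewrite /grid_gauge exchange_big addnC; congr (_ * s ^+ (2 * _ + 2 * _)); exact: exchange_big.
Qed.

Lemma grid_gauge_neq0 n p g : grid_gauge n p g != 0.
Proof.
rewrite /grid_gauge mulf_neq0 ?expf_neq0 //.
apply/prodf_neq0 => i _; apply/prodf_neq0 => j _.
by rewrite mulf_neq0 ?expf_neq0 ?qpoch_neq0.
Qed.

Lemma card_half n p delta g : (forall i j, (g i j <= D)%N) ->
  #|family (@half_dom F D n p delta g false)| =
  (#|F| ^ (\sum_(i < n) \sum_(j < p.+1)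
     if row_orientation delta i j then 0 else g i j * g i.+1 j))%N.
Proof.
move=> gD; rewrite card_family_prod exchange_big /= expn_sum; apply: eq_bigr => j _.
rewrite /half_dom card_family_prod big_ord_recr /= [X in (_ * X)%N](_ : _ = 1)%N; last first.
  by rewrite /row_dom /= ltnn if_same card1.
rewrite muln1 expn_sum; apply: eq_bigr => i _.
case eij: (row_orientation delta i j) => /=; first by rewrite card1 expn0.
rewrite /row_dom /= ltnS ltn_ord /arrow_space /arrow_tail /arrow_head.
rewrite (_ : row_orientation (~~ delta) j i); last first.
  by move: eij; rewrite /row_orientation addnC addbN => ->.
exact: card_hom_space.
Qed.

(** Each row contributes its weights by [row_sum], each pair of neighbouring rows the
size of its coupling kernel, and what depends on g only is collected in
[grid_gauge], which is symmetric in rows and columns. *)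
Lemma coupled_countE n p delta g : (forall i j, (g i j <= D)%N) ->
  (coupled_count n p delta g)%:R = grid_gauge n p g * grid_sum n p delta g.
Proof.
move=> gD; rewrite /coupled_count natrM natr_sum.
pose o (i : 'I_n.+1) := row_orientation delta i.
pose kap (m : mgrid n p) (i : 'I_n) : nat := (\sum_I \sum_J
  linked (row_orientation delta i) I J * (m (inord i) I * m (inord i.+1) J))%N.
have transfer (i : 'I_n.+1) (f : row p -> R) (fh : mults D p -> R) :
    (forall a b, grid_dom delta g i a ->
       has_mults (g i) (o i) p.+1 (row_arrows a) b -> f a = fh b) ->
    \sum_(a | grid_dom delta g i a) f a = \sum_(b | valid (g i) p.+1 b)
      (row_gauge s (g i) p.+1 * mults_weight s (o i) b) * fh b.
  move=> ffh; have := row_sum sF s0 u_unity (gD i) (o := o i) (f := f) (fh := fh) (leqnn p).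
  move=> ->; first by rewrite mulr_sumr; apply: eq_bigr => b _; rewrite mulrA.
  by move=> a b ad; apply: ffh.
rewrite (family_transfer transfer (fh := fun m => \prod_(i < n) (#|F| ^ kap m i)%:R)
  [ffun=> 0] [ffun=> ord0]); last first.
  move=> h m hd hm; rewrite natr_prod; apply: eq_bigr => i _; congr (_%:R).
  have wi : nat_of_ord (inord i : 'I_n.+1) = i by rewrite inordK // ltnS ltnW.
  have wi1 : nat_of_ord (inord i.+1 : 'I_n.+1) = i.+1 by rewrite inordK // ltnS.
  have := hm (inord i); have := hm (inord i.+1); rewrite /o wi wi1 => hm1 hm0.
  rewrite (card_coupling_kernel _ _ hm0 hm1) //.
    by move=> j; apply: alt_orientation.
  by move=> j; rewrite /row_orientation addSn /= addNb.
rewrite card_half // natrX -sF mulr_sumr /grid_sum mulr_sumr; apply: eq_bigr => m /familyP md.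
have vm (i : 'I_n.+1) : valid (g i) p.+1 (m i) by exact: md.
rewrite big_split /= /grid_energy /grid_gauge.
have -> : \prod_(i < n.+1) row_gauge s (g i) p.+1 =
    (\prod_(i < n.+1) \prod_(j < p.+1) (s ^+ (2 * g i j * g i j) * qpoch u (g i j)))
    * s ^+ (2 * (\sum_(i < n.+1) \sum_(j < p) g i j * g i j.+1)).
  by rewrite /row_gauge big_split /= prodrXr -big_distrr.
have -> : \prod_(i < n.+1) mults_weight s (o i) (m i) =
    s ^ (- \sum_(i < n.+1) row_energy (o i) (fun J => m i J))
    * \prod_i \prod_J (qpoch u (m i J))^-1.
  rewrite /mults_weight big_split /=; congr (_ * _).
  rewrite -sumrN; elim/big_ind2: _ => // x1 x2 y1 y2 -> ->.
  by rewrite expfzDr.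
have -> : \prod_(i < n) ((#|F| ^ kap m i)%:R : R) = s ^+ (4 * \sum_(i < n) kap m i).
  rewrite exprM sF -prodrXr; apply: eq_bigr => i _.
  by rewrite natrX.
set P1 := \prod_(i < n.+1) _; set P2 := \prod_i _.
rewrite -exprM.
have reg (x1 x2 x3 x4 x5 x6 : R) : x1 * (x2 * x3 * (x4 * x5) * x6) =
  (x1 * x3 * x4 * x6) * (x2 * x5) by ring.
have reg' (x1 x2 x3 x4 : R) : x1 * x2 * (x3 * x4) = (x2 * x3) * (x1 * x4) by ring.
rewrite reg [RHS]reg'; congr (_ * _).
rewrite !exprnP -!expfzDr //; congr (_ ^ _).
have kapE (i : 'I_n) : 4 * (kap m i)%:Z = 2 * (\sum_I \sum_J
      `|cross (row_orientation delta i) I J| * ((m (inord i) I)%:Z * (m (inord i.+1) J)%:Z))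
    + 2 * \sum_(j < p.+1) (if row_orientation delta i j then 1 else -1)
        * ((g i j)%:Z * (g i.+1 j)%:Z).
  have wi : nat_of_ord (inord i : 'I_n.+1) = i by rewrite inordK // ltnS ltnW.
  have wi1 : nat_of_ord (inord i.+1 : 'I_n.+1) = i.+1 by rewrite inordK // ltnS.
  have v0 := vm (inord i); have v1 := vm (inord i.+1); rewrite wi in v0; rewrite wi1 in v1.
  rewrite -(sum_cross (row_orientation delta i) v0 v1) -mulrDr -big_split /=.
  rewrite /kap (big_morph Posz PoszD (erefl _)) (_ : 4%:R = 2%:R * 2%:R) // -mulrA; congr (_ * _).
  rewrite mulr_sumr; apply: eq_bigr => I _.
  rewrite (big_morph Posz PoszD (erefl _)) mulr_sumr -big_split; apply: eq_bigr => J _ /=.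
  rewrite -mulrDl -linkedE; last by move=> j; apply: alt_orientation.
  by rewrite !PoszM; ring.
have dimE (i : 'I_n) : 4 * (\sum_(j < p.+1) if row_orientation delta i j then 0
       else g i j * g i.+1 j)%N%:Z
    + 2 * \sum_(j < p.+1) (if row_orientation delta i j then 1 else -1)
        * ((g i j)%:Z * (g i.+1 j)%:Z)
    = 2 * (\sum_(j < p.+1) g i j * g i.+1 j)%N%:Z.
  rewrite !(big_morph Posz PoszD (erefl _)) !mulr_sumr -big_split; apply: eq_bigr => j _ /=.
  by case: ifP => _; rewrite PoszM; ring.
rewrite PoszD !PoszM; set Hh := Posz (\sum_(i < n.+1) _)%N; set En := \sum_(i < n.+1) _.
set Cr := \sum_(i < n) \sum_I _.
pose a1 := Posz (\sum_(i < n) \sum_(j < p.+1)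
      if row_orientation delta i j then 0 else g i j * g i.+1 j)%N.
pose a2 := Posz (\sum_(i < n) kap m i)%N.
pose a3 := Posz (\sum_(i < n) \sum_(j < p.+1) g i j * g i.+1 j)%N.
have sumE : 4 * (\sum_(i < n) \sum_(j < p.+1)
      if row_orientation delta i j then 0 else g i j * g i.+1 j)%N%:Z
    + 4 * (\sum_(i < n) kap m i)%N%:Z
    = 2 * (\sum_(i < n) \sum_(j < p.+1) g i j * g i.+1 j)%N%:Z + 2 * Cr.
  rewrite !(big_morph Posz PoszD (erefl _)) !mulr_sumr -!big_split; apply: eq_bigr => i _ /=.
  by rewrite kapE -dimE; ring.
rewrite -/a1 -/a2 -/a3 in sumE *; move: a1 a2 a3 Hh En Cr sumE => *; lia.
Qed.

Theorem grid_sum_tr n p delta g : (forall i j, (g i j <= D)%N) ->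
  grid_sum p n (~~ delta) (fun j i => g i j) = grid_sum n p delta g.
Proof.
move=> gD; apply: (mulfI (grid_gauge_neq0 n p g)).
rewrite -coupled_countE // -grid_gauge_tr -coupled_countE; last by [].
by rewrite coupled_count_tr.
Qed.

End GridIdentity.

(** * Rational functions determined by their values at primes *)

Lemma cross_multiply (F : fieldType) (a b c d : F) :
  b != 0 -> d != 0 -> a / b = c / d -> a * d = c * b.
Proof. by move=> b0 d0 /eqP; rewrite eqr_div // => /eqP. Qed.

Section Evaluation.
Variable x : algC.
Local Notation ev P := (map_poly ratr P).[x].

(** The value at x of a rational function without pole at x.  As a relation, it is
compatible with the operations whichever fractions represent f and g. *)
Definition evaluates (f : Qq) (c : algC) := exists A B : {poly rat},
  [/\ ev B != 0, f = tofrac A / tofrac B & c = ev A / ev B].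

Lemma ev_neq0 (B : {poly rat}) : ev B != 0 -> (tofrac B : Qq) != 0.
Proof. by rewrite tofrac_eq0; apply: contra_neq => ->; rewrite rmorph0 horner0. Qed.

Lemma evaluates_poly (A : {poly rat}) : evaluates (tofrac A) (ev A).
Proof.
exists A, 1; rewrite !rmorph1 hornerC !divr1; split=> //.
exact: oner_neq0.
Qed.

Lemma evaluatesD f g c e : evaluates f c -> evaluates g e -> evaluates (f + g) (c + e).
Proof.
move=> [A [B [B0 -> ->]]] [A' [B' [B0' -> ->]]].
exists (A * B' + A' * B), (B * B'); rewrite !(rmorphD, rmorphM) !hornerE /=.
by split; rewrite ?mulf_neq0 // addf_div ?ev_neq0.
Qed.

Lemma evaluatesM f g c e : evaluates f c -> evaluates g e -> evaluates (f * g) (c * e).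
Proof.
move=> [A [B [B0 -> ->]]] [A' [B' [B0' -> ->]]].
exists (A * A'), (B * B'); split.
- by rewrite rmorphM hornerM mulf_neq0.
- by rewrite mulf_div !tofracM.
- by rewrite !rmorphM !hornerM mulf_div.
Qed.

Lemma evaluatesV f c : c != 0 -> evaluates f c -> evaluates f^-1 c^-1.
Proof.
move=> c0 [A [B [B0 -> ec]]]; exists B, A; rewrite invf_div; split=> //.
  by apply: contra_neq c0 => A0; rewrite ec A0 mul0r.
by rewrite ec invf_div.
Qed.

Lemma evaluates1 : evaluates 1 1.
Proof. by have := evaluates_poly 1; rewrite !rmorph1 hornerC. Qed.

Lemma evaluatesN f c : evaluates f c -> evaluates (- f) (- c).
Proof.
move=> [A [B [B0 -> ->]]]; exists (- A), B.
by rewrite !rmorphN hornerN !mulNr.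
Qed.

Lemma evaluatesX f c n : evaluates f c -> evaluates (f ^+ n) (c ^+ n).
Proof.
move=> fc; elim: n => [|n IH]; first exact: evaluates1.
by rewrite !exprS; apply: evaluatesM.
Qed.

Lemma evaluatesXz f c (z : int) : c != 0 -> evaluates f c -> evaluates (f ^ z) (c ^ z).
Proof.
move=> c0 fc; case: z => n; first exact: evaluatesX.
by rewrite NegzE -!exprnN; apply: evaluatesV; [rewrite expf_neq0|apply: evaluatesX].
Qed.

Lemma evaluates_qhalf : evaluates qhalf x.
Proof. by have := evaluates_poly 'X; rewrite map_polyX hornerX. Qed.

Lemma evaluates_prod (I : Type) (r : seq I) (f : I -> Qq) (c : I -> algC) :
  (forall i, evaluates (f i) (c i)) ->
  evaluates (\prod_(i <- r) f i) (\prod_(i <- r) c i).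
Proof.
move=> h; elim/big_ind2: _ => //; first exact: evaluates1.
by move=> ? ? ? ?; apply: evaluatesM.
Qed.

Lemma evaluates_sum (I : Type) (r : seq I) (P : pred I) (f : I -> Qq) (c : I -> algC) :
  (forall i, P i -> evaluates (f i) (c i)) ->
  evaluates (\sum_(i <- r | P i) f i) (\sum_(i <- r | P i) c i).
Proof.
move=> h; elim/big_ind2: _ => //.
  by have := evaluates_poly 0; rewrite !rmorph0 horner0.
by move=> ? ? ? ?; apply: evaluatesD.
Qed.

End Evaluation.

Lemma many_primes n : exists rs : seq nat, [/\ size rs = n, uniq rs & all prime rs].
Proof.
elim: n => [|n [rs [sz u pr]]]; first by exists [::].
have [p pb pp] := prime_above (\max_(i <- rs) i).
exists (p :: rs); rewrite /= sz pp pr u andbT; split=> //.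
apply/negP => prs; move: pb; rewrite ltnNge.
by rewrite (big_rem p) //= leq_maxl.
Qed.

(** The numerator of f - g has infinitely many roots. *)
Lemma eq_by_evaluation (x : nat -> algC) (f g : Qq) :
  {in prime &, injective x} ->
  (forall p, prime p -> exists c, evaluates (x p) f c /\ evaluates (x p) g c) ->
  f = g.
Proof.
move=> xinj h; apply/eqP; rewrite -subr_eq0; apply/eqP.
have hz p : prime p -> evaluates (x p) (f - g) 0.
  move=> /h[c [fc gc]]; rewrite -(subrr c).
  by apply: evaluatesD => //; apply: evaluatesN.
have [A [B [B0 E _]]] := hz 2%N isT.
have roots p : prime p -> root (map_poly ratr A) (x p).
  move=> pp; have [A' [B' [B0' E' /esym/eqP]]] := hz p pp.
  rewrite mulf_eq0 invr_eq0 (negbTE B0') orbF => /eqP A0'.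
  have eAB : A * B' = A' * B.
    apply/eqP; rewrite -tofrac_eq !rmorphM /=; apply/eqP.
    by apply: cross_multiply (ev_neq0 B0) (ev_neq0 B0') _; rewrite -E.
  have := congr1 (fun P => (map_poly ratr P).[x p]) eAB.
  rewrite /= !rmorphM !hornerM A0' mul0r => /eqP; rewrite mulf_eq0 (negbTE B0') orbF.
  by [].
rewrite E; suff -> : A = 0 by rewrite tofrac0 mul0r.
apply/eqP; apply: contraT => An0.
have An0' : map_poly (ratr : rat -> algC) A != 0 by rewrite map_poly_eq0.
have [rs [sz ur pr]] := many_primes (size A).
have := max_poly_roots An0' (rs := map x rs).
rewrite size_map sz size_map_poly ltnn; apply.
  by apply/allP => _ /mapP[p prs ->]; apply/roots/(allP pr).
rewrite map_inj_in_uniq // => p p' /(allP pr) pp /(allP pr) pp'; exact: xinj.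
Qed.

(** * The symmetry between rows and columns over the rational functions *)

(** The sum [grid_sum] before evaluation.  The exponent of X is half of [grid_energy], and the
function z stands for this half. *)
Definition half_grid_sum D n p (g : nat -> nat -> nat)
    (z : {ffun 'I_n.+1 -> mults D p} -> int) : Qq :=
  \sum_(m in family (fun i : 'I_n.+1 => valid (g i) p.+1))
    qhalf ^ z m * \prod_i \prod_J (qpoch q (m i J))^-1.
Arguments half_grid_sum D n p g z : clear implicits.

Definition root4 (p : nat) : algC := sqrtC (sqrtC p%:R).

Lemma root4X p : root4 p ^+ 4 = p%:R.
Proof. by rewrite (exprM _ 2 2) !sqrtCK. Qed.

Lemma root4_neq0 p : prime p -> root4 p != 0.
Proof. by move=> /prime_gt0 p0; rewrite !sqrtC_eq0 pnatr_eq0 -lt0n. Qed.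

Lemma inv_prime_unity p k : prime p -> (0 < k)%N ->
  1 - ((p%:R : algC)^-1) ^+ k != 0.
Proof.
move=> pp k0; rewrite subr_eq0 exprVn -(inj_eq invr_inj) invrK invr1 -natrX.
by rewrite -[1]/(1%:R) eqr_nat neq_ltn -[X in (X < _)%N](exp1n k) ltn_exp2r // prime_gt1.
Qed.

Lemma evaluates_half_grid_sum D n p delta (g : nat -> nat -> nat) z (s : algC) : s != 0 ->
  (forall k, (0 < k)%N -> 1 - ((s ^+ 4)^-1) ^+ k != 0) ->
  (forall m, m \in family (fun i : 'I_n.+1 => valid (D := D) (p := p) (g i) p.+1) ->
     2 * z m = grid_energy delta m) ->
  evaluates (s ^- 2) (half_grid_sum D n p g z) (grid_sum s D n p delta g).
Proof.
move=> s0 us zE; rewrite /half_grid_sum /grid_sum; apply: evaluates_sum => m mg.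
have q_ev : evaluates (s ^- 2) q (s ^+ 4)^-1.
  have -> : (s ^+ 4)^-1 = (s ^- 2) ^+ 2 by rewrite exprVn -exprM.
  exact/evaluatesX/evaluates_qhalf.
apply: evaluatesM.
  have -> : s ^ (- grid_energy delta m) = (s ^- 2) ^ z m.
    by rewrite -zE // exprnN exprz_exp mulNr.
  by apply: evaluatesXz (evaluates_qhalf _); rewrite invr_eq0 expf_neq0.
apply: evaluates_prod => i; apply: evaluates_prod => J; apply: evaluatesV.
  exact: qpoch_neq0.
apply: evaluates_prod => k; apply: evaluatesD; first exact: evaluates1.
by apply/evaluatesN/evaluatesX.
Qed.

(** Evaluate at X = s^(-2) with s^4 = p and apply [grid_sum_tr] over F_p. *)
Lemma half_grid_sum_tr D n p delta (g : nat -> nat -> nat) z z' :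
  (forall i j, (g i j <= D)%N) ->
  (forall m, m \in family (fun i : 'I_n.+1 => valid (D := D) (p := p) (g i) p.+1) ->
     2 * z m = grid_energy delta m) ->
  (forall m, m \in family (fun j : 'I_p.+1 => valid (D := D) (p := n) (g^~ j) n.+1) ->
     2 * z' m = grid_energy (~~ delta) m) ->
  half_grid_sum D p n (fun j i => g i j) z' = half_grid_sum D n p g z.
Proof.
move=> gD zE zE'.
have x2 r : (root4 r ^- 2) ^+ 2 = (r%:R)^-1 by rewrite exprVn -exprM root4X.
apply: (@eq_by_evaluation (fun r => root4 r ^- 2)) => [r t rp tp e|r rp].
  have := congr1 (fun c => c ^+ 2) e; rewrite /= !x2 => /invr_inj/eqP.
  by rewrite eqr_nat => /eqP.
have us k : (0 < k)%N -> 1 - ((root4 r ^+ 4)^-1) ^+ k != 0.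
  by move=> k0; rewrite root4X inv_prime_unity.
exists (grid_sum (root4 r) D n p delta g); split; last first.
  by apply: evaluates_half_grid_sum => //; apply: root4_neq0.
have sF : root4 r ^+ 4 = #|'F_r|%:R by rewrite card_Fp // root4X.
rewrite -(grid_sum_tr sF (root4_neq0 rp) us n p delta gD).
by apply: evaluates_half_grid_sum => //; apply: root4_neq0.
Qed.

(** * Coefficients of a product of dilogarithms *)

Section ProductCoefficient.
Variables n n' : nat.
Local Notation A := (qalg n n').
Implicit Types f g : A.

(** Equality up to weight W.  It is compatible with products, which makes it possible to
replace each dilogarithm by a polynomial. *)
Definition agree (W : nat) f g := forall d, (weight d <= W)%N -> coef f d = coef g d.

Lemma agreeM W f f' g g' : agree W f f' -> agree W g g' -> agree W (f * g) (f' * g').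
Proof.
move=> ff gg d dW; rewrite /= big_seq [RHS]big_seq; apply: eq_bigr => p.
rewrite mem_splits => /eqP e; have := weightD p.1 p.2; rewrite e => we.
by rewrite ff ?gg //; apply: leq_trans dW; rewrite we ?leq_addr ?leq_addl.
Qed.

Lemma agree_prod W a (f g : 'I_a -> A) :
  (forall r, agree W (f r) (g r)) -> agree W (\prod_r f r) (\prod_r g r).
Proof. by move=> fg; elim/big_ind2: _ => // *; apply: agreeM. Qed.

Lemma agree_dilog W (v : dimv n n') : v != 0 ->
  agree W (dilog (y v)) (\sum_(j < W.+1) dilog_coef j *: (- y v) ^+ j).
Proof.
move=> v0 d dW; rewrite (dilogE _ dW) ?big_ord_recl; last first.
  by rewrite /= eq_sym (negbTE v0).
rewrite /dilog_partial big_add1 big_mkord expr0 /dilog_coef big_geq // divr1 expr0 scale1r.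
by congr coef.
Qed.

Lemma lambda_self (v : dimv n n') : lambda v v = 0.
Proof. exact: subrr. Qed.

Lemma lambdaMnl (v w : dimv n n') k : lambda (v *+ k) w = lambda v w *+ k.
Proof. by elim: k => [|k IH]; rewrite ?mulr0n ?lambda0l // !mulrS lambdaDl IH. Qed.

Lemma lambdaMnr (v w : dimv n n') k : lambda v (w *+ k) = lambda v w *+ k.
Proof. by elim: k => [|k IH]; rewrite ?mulr0n ?lambda0r // !mulrS lambdaDr IH. Qed.

Lemma lambda_suml (I : Type) (r : seq I) (P : pred I) (v : I -> dimv n n') w :
  lambda (\sum_(i <- r | P i) v i) w = \sum_(i <- r | P i) lambda (v i) w.
Proof.
by apply: (big_morph (fun v => lambda v w)) => [? ?|]; rewrite ?lambdaDl ?lambda0l.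
Qed.

(** The elements - y_v multiply like in a quantum torus, without sign. *)
Lemma mul_Ny (v w : dimv n n') :
  (- y v) * (- y w) = qhalf ^ lambda v w *: - y (v + w) :> A.
Proof.
by rewrite mulrNN y_relation scaleNr opprK scalerA -expfzDr ?qhalf_neq0 // subrr expr0z scale1r.
Qed.

Lemma exp_Ny (v : dimv n n') k : (- y v) ^+ k = - y (v *+ k) :> A.
Proof.
elim: k => [|k IH]; first by rewrite expr0 mulr0n y0 opprK.
by rewrite exprS IH mul_Ny lambdaMnr lambda_self mul0rn expr0z scale1r mulrS.
Qed.

(** The power of X that comes from reordering the product of the monomials. *)
Definition order_energy a (v : 'I_a -> dimv n n') (m : 'I_a -> nat) : int :=
  \sum_(s < a) \sum_(r < a | (r < s)%N) ((m r)%:Z * (m s)%:Z) * lambda (v r) (v s).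

Lemma prod_exp_Ny a (v : 'I_a -> dimv n n') (m : 'I_a -> nat) :
  \prod_r (- y (v r)) ^+ m r
  = qhalf ^ order_energy v m *: - y (\sum_r v r *+ m r) :> A.
Proof.
elim: a v m => [|a IH] v m.
  by rewrite /order_energy !big_ord0 expr0z scale1r y0 opprK.
rewrite big_ord_recr IH /= exp_Ny -scalerAl mul_Ny scalerA -expfzDr ?qhalf_neq0 //.
rewrite [in RHS]big_ord_recr; congr (qhalf ^ _ *: _).
rewrite /order_energy big_ord_recr /=; congr (_ + _).
  by apply: eq_bigr => s _; rewrite [RHS]big_mkcond big_ord_recr /= ltnNge ltnW //= addr0 -big_mkcond.
rewrite [RHS]big_mkcond big_ord_recr /= ltnn addr0 lambda_suml; apply: eq_bigr => r _.
by rewrite ltn_ord lambdaMnl lambdaMnr -mulrnA -mulr_natr natrM !natz; ring.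
Qed.

Lemma coef_series_sum (I : Type) (r : seq I) (P : pred I) (f : I -> A) d :
  coef (\sum_(i <- r | P i) f i) d = \sum_(i <- r | P i) coef (f i) d.
Proof. exact: (big_morph (fun f : A => coef f d)). Qed.

Lemma coef_prod_dilog a (v : 'I_a -> dimv n n') W d :
  (forall r, v r != 0) -> (weight d <= W)%N ->
  coef (\prod_r dilog (y (v r))) d =
  - \sum_(m : {ffun 'I_a -> 'I_W.+1} | \sum_r v r *+ m r == d)
      qhalf ^ order_energy v (fun r => m r) * \prod_r dilog_coef (m r).
Proof.
move=> v0 dW; rewrite (agree_prod (fun r => agree_dilog (v0 r)) dW) bigA_distr_bigA coef_series_sum.
rewrite [X in - X]big_mkcond -sumrN; apply: eq_bigr => m _.
rewrite scaler_prod Defs.coefZ prod_exp_Ny Defs.coefZ /= eq_sym.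
by case: ifP => _; rewrite ?oppr0 ?mulr0 // !mulrN mulr1 mulrC.
Qed.

End ProductCoefficient.

(** * The form lambda on positive roots *)

Lemma sum_consecutive p (G : 'I_p.+1 -> 'I_p.+1 -> int) :
  \sum_(j < p.+1) \sum_(j' < p.+1) (if consecutive j j' then G j j' else 0) =
  \sum_(j < p) (G (inord j) (inord j.+1) + G (inord j.+1) (inord j)).
Proof.
pose H (j j' : nat) := if j.+1 == j' then G (inord j) (inord j') + G (inord j') (inord j) else 0.
have -> : \sum_(j < p.+1) \sum_(j' < p.+1) (if consecutive j j' then G j j' else 0)
  = \sum_(j < p.+1) \sum_(j' < p.+1) H j j'.
  transitivity (\sum_(j < p.+1) \sum_(j' < p.+1)
     ((if j.+1 == j' then G j j' else 0) + (if j'.+1 == j then G j j' else 0))).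
    apply: eq_bigr => j _; apply: eq_bigr => j' _; rewrite /consecutive.
    have [e|_] := eqVneq j.+1 j'; have [e'|_] := eqVneq j'.+1 j; rewrite ?addr0 ?add0r //=.
    by exfalso; lia.
  under eq_bigr do rewrite big_split.
  rewrite big_split /= [X in _ + X]exchange_big -big_split /=; apply: eq_bigr => j _.
  rewrite -big_split /=; apply: eq_bigr => j' _; rewrite /H !inord_val.
  by case: eqP => //=; rewrite addr0.
rewrite big_ord_recr /= [X in _ + X]big1 ?addr0; last first.
  by move=> j' _; rewrite /H; case: eqP => // e; have := ltn_ord j'; lia.
apply: eq_bigr => j _; rewrite (bigD1 (inord j.+1)) //= big1 ?addr0.
  by rewrite /H inordK ?eqxx // ltnS.
move=> j' j'n; rewrite /H; case: eqP => // e; case/eqP: j'n.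
by apply: val_inj; rewrite /= inordK ?e // ltnS.
Qed.

Lemma sum_vertex n p (H : vertex n p -> int) :
  \sum_u H u = \sum_i \sum_j H (i, j).
Proof. by rewrite pair_bigA; apply: eq_bigr => -[]. Qed.

(** Each pair of neighbouring vertices carries one arrow, whose direction is given by the
parity. *)
Lemma arrow_sum n p (G : vertex n.+1 p.+1 -> vertex n.+1 p.+1 -> int) :
  \sum_(c in arrows n.+1 p.+1) G c.1 c.2 =
  \sum_(i < n.+1) \sum_(j < p) (let u := (i, inord j) in let w := (i, inord j.+1) in
      if odd (i + j) then G u w else G w u)
  + \sum_(i < n) \sum_(j < p.+1) (let u := (inord i, j) in let w := (inord i.+1, j) in
      if odd (i + j) then G w u else G u w).
Proof.
transitivity (\sum_u \sum_w ((if harrow u w then G u w else 0)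
                            + (if varrow u w then G u w else 0))).
  rewrite big_mkcond pair_bigA; apply: eq_bigr => -[u w] _; rewrite inE /=.
  case h: (harrow u w); case v: (varrow u w); rewrite /= ?addr0 ?add0r //.
  by case/and3P: h => _ _ ou; case/and3P: v => _ _; rewrite ou.
under eq_bigr do rewrite big_split.
rewrite big_split /=; congr (_ + _).
  rewrite sum_vertex.
  apply: eq_bigr => i _.
  transitivity (\sum_(j < p.+1) \sum_(j' < p.+1) if consecutive j j'
      then (if odd (i + j) then G (i, j) (i, j') else 0) else 0).
    apply: eq_bigr => j _.
    rewrite sum_vertex.
    rewrite (bigD1 i) //= [X in _ + X]big1 ?addr0 => [|i' i'i]; last first.
      by rewrite big1 // => j' _; rewrite /harrow /= eq_sym (negbTE i'i).
    by apply: eq_bigr => j' _; rewrite /harrow /= eqxx /=; case: consecutive.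
  rewrite sum_consecutive; apply: eq_bigr => j _ /=.
  have jp := ltn_ord j; rewrite !inordK ?ltnS ?(ltnW jp) // addnS /=.
  by case: odd; rewrite ?addr0 ?add0r.
rewrite exchange_big /=.
rewrite sum_vertex.
rewrite exchange_big [RHS]exchange_big /=; apply: eq_bigr => j _.
transitivity (\sum_(i < n.+1) \sum_(i' < n.+1) if consecutive i i'
    then (if ~~ odd (i + j) then G (i, j) (i', j) else 0) else 0).
  rewrite [RHS]exchange_big; apply: eq_bigr => i' _.
  rewrite sum_vertex.
  apply: eq_bigr => i _.
  rewrite (bigD1 j) //= [X in _ + X]big1 ?addr0 => [|k kj]; last first.
    by rewrite /varrow /= (negbTE kj).
  by rewrite /varrow /= eqxx /=; case: consecutive.
rewrite sum_consecutive; apply: eq_bigr => i _ /=.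
have ip := ltn_ord i; rewrite !inordK ?ltnS ?(ltnW ip) // addSn /=.
by case: odd; rewrite /= ?addr0 ?add0r.
Qed.

(** The diagonal part of chi is symmetric and cancels. *)
Lemma lambda_grid n p (x y : dimv n.+1 p.+1) (e f : nat -> nat -> int) :
  (forall i j, (x (i, j))%:Z = e i j) -> (forall i j, (y (i, j))%:Z = f i j) ->
  lambda x y =
  \sum_(i < n.+1) \sum_(j < p) (if row_orientation false i j then 1 else -1)
      * (e i j * f i j.+1 - f i j * e i j.+1)
  - \sum_(i < n) \sum_(j < p.+1) (if row_orientation false i j then 1 else -1)
      * (e i j * f i.+1 j - f i j * e i.+1 j).
Proof.
move=> xe yf; rewrite /lambda /chi.
have -> (a b c d : int) : a - b - (c - d) = (a - c) + (d - b) by ring.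
rewrite -sumrB big1 => [|v _]; last by rewrite mulrC subrr.
rewrite add0r -sumrB (arrow_sum (fun u w => (x u)%:Z * (y w)%:Z - (y u)%:Z * (x w)%:Z)) /=.
congr (_ + _); rewrite -?sumrN; apply: eq_bigr => i _; rewrite -?sumrN; apply: eq_bigr => j _;
  rewrite !xe !yf !inordK ?ltnS // 1?ltnW // /row_orientation addbF;
  by case: odd; ring.
Qed.

(** The value of |lambda| on the roots I in line a and J in line b: nonzero only in
the same line or in neighbouring lines. *)
Definition line_form delta p a (I : itv p) b (J : itv p) : int :=
  if a == b then `|row_form (row_orientation delta a) I J|
  else if a.+1 == b then `|cross (row_orientation delta a) I J|
  else if b.+1 == a then `|cross (row_orientation delta b) J I| else 0.

Lemma line_formE delta p a (I : itv p) b (J : itv p) :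
  `|(if a == b then row_form (row_orientation delta a) I J else 0)
    - ((if a.+1 == b then cross (row_orientation delta a) I J else 0)
       - (if b.+1 == a then cross (row_orientation delta b) J I else 0))|
  = line_form delta a I b J.
Proof.
rewrite /line_form; case: (eqVneq a b) => [->|_]; first by rewrite gtn_eqF // !subr0.
case: (eqVneq a.+1 b) => [<-|_]; first by rewrite gtn_eqF ?subr0 ?sub0r ?normrN.
by case: eqP; rewrite ?subr0 ?sub0r ?opprK // oppr0 normr0.
Qed.

Section PairOfRoots.
Variables (n p : nat) (a b : nat) (I J : itv p) (delta : bool).
Hypotheses (an : (a <= n)%N) (bn : (b <= n)%N).
Let e i j := ((i == a) && in_itv j I)%:Z.
Let f i j := ((i == b) && in_itv j J)%:Z.
Let sg i j : int := if row_orientation delta i j then 1 else -1.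

Lemma along_sum :
  \sum_(i < n.+1) \sum_(j < p) sg i j * (e i j * f i j.+1 - f i j * e i j.+1)
  = if a == b then row_form (row_orientation delta a) I J else 0.
Proof.
rewrite (bigD1 (Ordinal (an : (a < n.+1)%N))) //= [X in _ + X]big1 ?addr0 => [|i ia].
  rewrite /e /f /=; case: (eqVneq a b) => [_|ab].
    by apply: eq_bigr => j _; rewrite eqxx -!PoszM !mulnb.
  by rewrite big1 // => j _; rewrite /= mulr0 mul0r subrr mulr0.
rewrite big1 // => j _; rewrite /e; have -> : (i == a :> nat) = false.
  by apply: contraNF ia => /eqP ia; apply/eqP/val_inj.
by rewrite /= mulr0 mul0r subrr mulr0.
Qed.

Lemma across_sum :
  \sum_(i < n) \sum_(j < p.+1) sg i j * (e i j * f i.+1 j - f i j * e i.+1 j)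
  = (if a.+1 == b then cross (row_orientation delta a) I J else 0)
    - (if b.+1 == a then cross (row_orientation delta b) J I else 0).
Proof.
have one (c d : nat) (H K : itv p) : (d <= n)%N ->
  \sum_(i < n) \sum_(j < p.+1) sg i j
      * (((i == c :> nat) && in_itv j H)%:Z * ((i.+1 == d) && in_itv j K)%:Z)
  = if c.+1 == d then cross (row_orientation delta c) H K else 0.
  move=> dn; case: eqP => [cd|cd].
    rewrite (bigD1 (Ordinal (leq_trans (eq_leq cd) dn : (c < n)%N))) //= [X in _ + X]big1 ?addr0.
      by apply: eq_bigr => j _; rewrite cd !eqxx /= -!PoszM !mulnb.
    move=> i ic; rewrite big1 // => j _; have -> : (i == c :> nat) = false.
      by apply: contraNF ic => /eqP ic; apply/eqP/val_inj.
    by rewrite /= mul0r mulr0.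
  rewrite big1 // => i _; rewrite big1 // => j _.
  by case: eqP => [->|_]; [case: eqP => // _; rewrite mulr0|rewrite mul0r]; rewrite mulr0.
rewrite -(one a b) // -(one b a) // -sumrB; apply: eq_bigr => i _.
by rewrite -sumrB; apply: eq_bigr => j _; rewrite mulrBr.
Qed.

End PairOfRoots.

Definition seg_itv m p (x : segment m p.+1) : itv p := (val x).2.

Lemma sum_eps_at n n' k (P : pred ('I_n * 'I_n')) (Q : pred 'I_k) (h : 'I_k -> 'I_n * 'I_n') v :
  injective h -> (P v = false -> forall j, h j == v -> Q j = false) ->
  (P v -> exists2 j, h j = v & Q j) ->
  (\sum_(j | Q j) (eps (h j).1 (h j).2 : dimv n n')) v = P v.
Proof.
move=> hinj h0 h1; rewrite sum_ffunE; under eq_bigr do rewrite ffunE -surjective_pairing.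
case: (boolP (P v)) => [/h1[j <- qj]|/negbTE/h0 hv].
  rewrite (bigD1 j) //= eqxx big1 ?addr0 // => j' /andP[_ kj].
  by rewrite (inj_eq hinj) eq_sym (negbTE kj).
rewrite big1 // => j qj; apply/eqP; rewrite eqb0; apply/negP => /eqP e.
by move: qj; rewrite (hv j) // e.
Qed.

Lemma hdimE n p (x : hroot n.+1 p.+1) i j :
  hdim x (i, j) = (i == line x) && in_itv j (seg_itv x).
Proof.
apply: (@sum_eps_at _ _ _ (fun v => (v.1 == line x) && in_itv v.2 (seg_itv x)) _
  (fun k => (line x, k))) => [k k' []//|/= e k|/= /andP[/eqP -> jx]]; last by exists j.
by rewrite xpair_eqE => /andP[/eqP ix /eqP ->]; move: e; rewrite ix eqxx.
Qed.

Lemma vdimE n p (x : vroot n.+1 p.+1) i j :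
  vdim x (i, j) = (j == line x) && in_itv i (seg_itv x).
Proof.
apply: (@sum_eps_at _ _ _ (fun v => (v.2 == line x) && in_itv v.1 (seg_itv x)) _
  (fun k => (k, line x))) => [k k' []//|/= e k|/= /andP[/eqP -> jx]]; last by exists i.
by rewrite xpair_eqE => /andP[/eqP -> /eqP ix]; move: e; rewrite ix eqxx.
Qed.

Lemma hdim_lambda n p (x y : hroot n.+1 p.+1) :
  `|lambda (hdim x) (hdim y)|
  = line_form false (line x) (seg_itv x) (line y) (seg_itv y).
Proof.
have ln (t : hroot n.+1 p.+1) : (line t <= n)%N by rewrite -ltnS ltn_ord.
rewrite (lambda_grid (e := fun i j => ((i == line x) && in_itv j (seg_itv x))%:Z)
                     (f := fun i j => ((i == line y) && in_itv j (seg_itv y))%:Z)).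
- by rewrite along_sum // across_sum // line_formE.
- by move=> i j; rewrite hdimE.
- by move=> i j; rewrite hdimE.
Qed.

Lemma vdim_lambda n p (x y : vroot n.+1 p.+1) :
  `|lambda (vdim x) (vdim y)|
  = line_form true (line x) (seg_itv x) (line y) (seg_itv y).
Proof.
have ln (t : vroot n.+1 p.+1) : (line t <= p)%N by rewrite -ltnS ltn_ord.
rewrite (lambda_grid (e := fun i j => ((j == line x) && in_itv i (seg_itv x))%:Z)
                     (f := fun i j => ((j == line y) && in_itv i (seg_itv y))%:Z)).
- rewrite -line_formE -(along_sum (line y) (seg_itv x) (seg_itv y) true (ln x)).
  rewrite -(across_sum (seg_itv x) (seg_itv y) true (ln x) (ln y)).
  rewrite distrC exchange_big [X in `|_ - X|]exchange_big /=.
  have flip i j : (if row_orientation true i j then 1 else -1 : int)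
      = - (if row_orientation false j i then 1 else -1).
    by rewrite /row_orientation addnC addbF addbT; case: odd; rewrite ?opprK.
  rewrite -normrN opprB addrC.
  by congr `|_ + _|; rewrite -?sumrN; apply: eq_bigr => i _; rewrite -?sumrN;
    apply: eq_bigr => j _; rewrite flip ?mulNr ?opprK.
- by move=> i j; rewrite vdimE.
- by move=> i j; rewrite vdimE.
Qed.

(** * Coefficients of the product along a listing *)

Lemma lambdaC N N' (x y : dimv N N') : lambda x y = - lambda y x.
Proof. by rewrite /lambda -opprB. Qed.

Lemma sum_near_diagonal n (E : 'I_n.+1 -> 'I_n.+1 -> int) :
  (forall i i' : 'I_n.+1, i != i' -> ~~ consecutive i i' -> E i i' = 0) ->
  \sum_i \sum_i' E i i' = \sum_i E i i
    + \sum_(i < n) (E (inord i) (inord i.+1) + E (inord i.+1) (inord i)).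
Proof.
move=> E0; rewrite -sum_consecutive -big_split; apply: eq_bigr => i _ /=.
rewrite [LHS](bigD1 i) //= [X in _ = _ + X](bigD1 i) //=.
have -> : consecutive i i = false by rewrite /consecutive orbb gtn_eqF.
rewrite add0r; congr (_ + _); apply: eq_bigr => i' ii'; case: ifPn => // c.
by rewrite E0 // eq_sym.
Qed.

Lemma sum_pairs a (w : 'I_a -> 'I_a -> int) :
  (forall r s, w r s = w s r) -> (forall r, w r r = 0) ->
  \sum_r \sum_s w r s = 2 * \sum_(s < a) \sum_(r < a | (r < s)%N) w r s.
Proof.
move=> wC w0; pose lo := \sum_(s < a) \sum_(r < a) if (r < s)%N then w r s else 0.
have -> : \sum_(s < a) \sum_(r < a | (r < s)%N) w r s = lo.
  by apply: eq_bigr => s _; rewrite big_mkcond.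
rewrite mulrDl mul1r {1}/lo [X in _ = X + _]exchange_big -big_split; apply: eq_bigr => r _ /=.
rewrite -big_split; apply: eq_bigr => s _ /=.
by case: (ltngtP r s) => [_|_|/val_inj->]; rewrite ?addr0 ?add0r ?w0 // wC.
Qed.

(** Rows and columns are treated together: v is [hdim] or [vdim], and vtx i j is the
vertex number j of the line i. *)
Section Listing.
Variables (N N' n p a : nat) (delta : bool).
Variables (v : segment n.+1 p.+1 -> dimv N N') (vtx : 'I_n.+1 -> 'I_p.+1 -> vertex N N').
Hypothesis vtx_onto : forall w, exists i j, w = vtx i j.
Hypothesis vE : forall x i j,
  v x (vtx i j) = (i == line x) && in_itv j (seg_itv x).
Hypothesis lamE : forall x x', `|lambda (v x) (v x')|
  = line_form delta (line x) (seg_itv x) (line x') (seg_itv x').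
Variable phi : 'I_a -> segment n.+1 p.+1.
Hypothesis phi_bij : bijective phi.
Hypothesis phi_same : forall r s : 'I_a, (r < s)%N ->
  line (phi r) = line (phi s) -> 0 <= lambda (v (phi r)) (v (phi s)).
Hypothesis phi_diff : forall r s : 'I_a, (r < s)%N ->
  line (phi r) <> line (phi s) -> lambda (v (phi r)) (v (phi s)) <= 0.
Local Notation proper J := (J.1 <= J.2)%N.

(** A listing runs through all the proper intervals of all the lines. *)
Lemma big_listing (R : Type) (idx : R) (op : Monoid.com_law idx)
    (F : 'I_n.+1 -> itv p -> R) :
  (forall i (J : itv p), ~~ proper J -> F i J = idx) ->
  \big[op/idx]_r F (line (phi r)) (seg_itv (phi r)) = \big[op/idx]_i \big[op/idx]_J F i J.
Proof.
move=> F0; rewrite pair_bigA /= (bigID (fun u : 'I_n.+1 * itv p => proper u.2)) /=.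
rewrite [X in op _ X]big1 ?Monoid.mulm1 => [|u /F0 //].
rewrite (reindex_omap (val : segment n.+1 p.+1 -> _) insub) => [|u pu]; last by rewrite insubT.
rewrite [RHS](eq_bigl xpredT) => [|x]; last by rewrite valK eqxx (valP x).
by rewrite [RHS](reindex phi) //; apply: onW_bij.
Qed.

(** The sign conditions replace lambda by its absolute value with a sign that is symmetric
in the two roots; the sum over r < s becomes half of the sum over all pairs. *)
Lemma order_energy_abs (m : 'I_a -> nat) :
  2 * order_energy (fun r => v (phi r)) m =
  \sum_r \sum_s (if line (phi r) == line (phi s) then 1 else -1)
     * line_form delta (line (phi r)) (seg_itv (phi r)) (line (phi s)) (seg_itv (phi s))
     * ((m r)%:Z * (m s)%:Z).
Proof.
under [RHS]eq_bigr do under eq_bigr do rewrite -lamE.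
rewrite sum_pairs => [|r s|r]; last by rewrite lambda_self normr0 mulr0 mul0r.
  congr (2 * _); apply: eq_bigr => s _; apply: eq_bigr => r rs; rewrite mulrC; congr (_ * _).
  case: eqP => [e|e]; first by rewrite mul1r ger0_norm ?phi_same.
  by rewrite mulN1r ler0_norm ?phi_diff ?opprK.
by rewrite eq_sym lambdaC normrN [(m r)%:Z * _]mulrC.
Qed.

Lemma listing_energy D (M : {ffun 'I_n.+1 -> mults D p}) g :
  M \in family (fun i : 'I_n.+1 => valid (g i) p.+1) ->
  let m r : nat := M (line (phi r)) (seg_itv (phi r)) in
  2 * (order_energy (fun r => v (phi r)) m + (\sum_r m r ^ 2)%N%:Z)
  = grid_energy delta M.
Proof.
move=> /familyP valM m.
have M0 i (J : itv p) : ~~ proper J -> M i J = 0%N :> nat.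
  have [supp _] := validP _ _ _ (valM i); case: (eqVneq (M i J : nat) 0%N) => // /supp.
  by case/andP => ->.
rewrite mulrDr order_energy_abs.
pose E (i i' : 'I_n.+1) : int := \sum_I \sum_J (if i == i' then 1 else -1) * line_form delta i I i' J
   * ((M i I)%:Z * (M i' J)%:Z).
have -> : \sum_r \sum_s (if line (phi r) == line (phi s) then 1 else -1)
     * line_form delta (line (phi r)) (seg_itv (phi r)) (line (phi s)) (seg_itv (phi s))
     * ((m r)%:Z * (m s)%:Z) = \sum_i \sum_i' E i i'.
  transitivity (\sum_r \sum_i' \sum_J
     (if line (phi r) == i' then 1 else -1)
     * line_form delta (line (phi r)) (seg_itv (phi r)) i' J
     * ((m r)%:Z * (M i' J)%:Z)).
    apply: eq_bigr => r _; rewrite -(big_listing _ (F := fun i' J =>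
       (if line (phi r) == i' then 1 else -1)
     * line_form delta (line (phi r)) (seg_itv (phi r)) i' J
     * ((m r)%:Z * (M i' J)%:Z))) // => i' J /M0 ->; by rewrite !mulr0.
  rewrite (big_listing _ (F := fun i I => \sum_i' \sum_J
     (if i == i' then 1 else -1) * line_form delta i I i' J
     * ((M i I)%:Z * (M i' J)%:Z))).
    by apply: eq_bigr => i _; rewrite exchange_big.
  by move=> i J /M0 ->; rewrite big1 // => i' _; rewrite big1 // => J' _; rewrite mul0r mulr0.
rewrite sum_near_diagonal; last first.
  move=> i i' ii' /norP[/negbTE c1 /negbTE c2]; apply: big1 => I _; apply: big1 => J _.
  rewrite /line_form c1 c2; have -> : (i == i' :> nat) = false by apply: negbTE ii'.
  by rewrite mulr0 mul0r.
rewrite /grid_energy addrAC; congr (_ + _).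
  rewrite (big_morph Posz PoszD (erefl _)).
  rewrite (big_listing _ (F := fun i I => ((M i I) ^ 2)%N%:Z)); last by move=> i J /M0 ->.
  rewrite mulr_sumr -big_split; apply: eq_bigr => i _ /=.
  rewrite mulr_sumr -big_split; apply: eq_bigr => I _ /=.
  rewrite /row_weight; under [RHS]eq_bigr do rewrite mulrDl.
  rewrite big_split /= addrC; congr (_ + _).
    rewrite (bigD1 I) //= eqxx big1 ?addr0 => [|J JI].
      by rewrite -mulnn PoszM mulr2n.
    by rewrite eq_sym (negbTE JI) mul0r.
  by apply: eq_bigr => J _; rewrite /line_form !eqxx mul1r.
rewrite mulr_sumr -sumrN; apply: eq_bigr => i _.
have ip := ltn_ord i; have wi : nat_of_ord (inord i : 'I_n.+1) = i by rewrite inordK // ltnS ltnW.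
have wi1 : nat_of_ord (inord i.+1 : 'I_n.+1) = i.+1 by rewrite inordK // ltnS.
have ne : (inord i == inord i.+1 :> 'I_n.+1) = false.
  by rewrite -val_eqE /= wi wi1 ltn_eqF.
have -> : E (inord i.+1) (inord i) = E (inord i) (inord i.+1).
  rewrite /E exchange_big; apply: eq_bigr => I _; apply: eq_bigr => J _.
  rewrite eq_sym [in X in _ = _ * X]mulrC; congr (_ * _ * _).
  by rewrite /line_form wi wi1 gtn_eqF // gtn_eqF ?leqnSn // eqxx ltn_eqF.
rewrite mulrDl mul1r opprD; congr (_ + _); rewrite -sumrN; apply: eq_bigr => I _;
  rewrite -sumrN; apply: eq_bigr => J _;
  by rewrite ne /line_form wi wi1 ltn_eqF // eqxx !mulNr mul1r.
Qed.

Lemma root_neq0 x : v x != 0.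
Proof.
apply/eqP => /ffunP/(_ (vtx (line x) (seg_itv x).1)); rewrite vE ffunE eqxx.
by rewrite /in_itv leqnn (valP x).
Qed.

Lemma sum_roots_at D (M : {ffun 'I_n.+1 -> mults D p}) i j :
  (forall i (J : itv p), ~~ proper J -> M i J = 0%N :> nat) ->
  (\sum_r v (phi r) *+ M (line (phi r)) (seg_itv (phi r))) (vtx i j)
  = (\sum_(J | in_itv j J) M i J)%N.
Proof.
move=> M0; rewrite sum_ffunE.
transitivity (\sum_r ((i == line (phi r)) && in_itv j (seg_itv (phi r)))
    * M (line (phi r)) (seg_itv (phi r)))%N.
  by apply: eq_bigr => r _; rewrite ffunMnE vE -mulr_natr natn.
rewrite (big_listing _ (F := fun i' J => ((i == i') && in_itv j J) * M i' J)%N); last first.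
  by move=> i' J /M0 ->; rewrite muln0.
rewrite (bigD1 i) //= [X in (_ + X)%N]big1 ?addn0 => [|i' i'i]; last first.
  by rewrite big1 // => J _; rewrite eq_sym (negbTE i'i).
rewrite [RHS]big_mkcond; apply: eq_bigr => J _; rewrite eqxx /=.
by case: in_itv; rewrite ?mul1n ?mul0n.
Qed.

(** A multiplicity function on the listing is the same as a family of valid
multiplicities on the lines. *)
Theorem coef_listing_product W d : (weight d <= W)%N ->
  let g i j := d (vtx (inord i) (inord j)) in
  exists2 z, (forall M, M \in family (fun i : 'I_n.+1 => valid (D := W) (p := p) (g i) p.+1) ->
      2 * z M = grid_energy delta M)
    & coef (\prod_r dilog (y (v (phi r)))) d = - half_grid_sum W n p g z.
Proof.
move=> dW g; have [psi phiK psiK] := phi_bij.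
pose to_list (M : {ffun 'I_n.+1 -> mults W p}) : {ffun 'I_a -> 'I_W.+1} :=
  [ffun r => M (line (phi r)) (seg_itv (phi r))].
pose of_list (m : {ffun 'I_a -> 'I_W.+1}) : {ffun 'I_n.+1 -> mults W p} :=
  [ffun i => [ffun J => if insub (i, J) is Some x then m (psi x) else ord0]].
have of_list0 m i (J : itv p) : ~~ proper J -> of_list m i J = 0%N :> nat.
  by move=> nJ; rewrite !ffunE insubN.
have to_of m : to_list (of_list m) = m.
  apply/ffunP => r; rewrite !ffunE (_ : (line (phi r), seg_itv (phi r)) = val (phi r)).
    by rewrite valK phiK.
  by rewrite [RHS]surjective_pairing.
pose z (M : {ffun 'I_n.+1 -> mults W p}) : int :=
  order_energy (fun r => v (phi r)) (fun r => to_list M r) + (\sum_r to_list M r ^ 2)%N%:Z.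
exists z => [M /listing_energy <-|].
  rewrite /z; congr (2 * (_ + _)); first by
    apply: eq_bigr => s _; apply: eq_bigr => r _; rewrite !ffunE.
  by congr Posz; apply: eq_bigr => r _; rewrite ffunE.
rewrite (coef_prod_dilog (fun r => root_neq0 (phi r)) dW); congr (- _).
rewrite /half_grid_sum [RHS](reindex_onto of_list to_list); last first.
  move=> M /familyP valM; apply/ffunP => i; apply/ffunP => J; rewrite !ffunE.
  case: insubP => [x _ ex|nJ]; first by rewrite ffunE psiK /line /seg_itv ex.
  have [supp _] := validP _ _ _ (valM i).
  apply: val_inj; case: (eqVneq (M i J : nat) 0%N) => [e|/supp]; first by rewrite /= e.
  by case/andP => pJ; rewrite /= pJ in nJ.
apply: eq_big => [m|m _].
  rewrite to_of eqxx andbT.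
  have sumE i j : (\sum_r v (phi r) *+ m r) (vtx i j) = (\sum_(J | in_itv j J) of_list m i J)%N.
    rewrite -(sum_roots_at _ _ (of_list0 m)); congr (fun_of_fin _ _).
    by apply: eq_bigr => r _; rewrite -{1}(to_of m) ffunE.
  apply/eqP/familyP => [e i|val_m].
    apply/validP; split=> [J|j jp _].
      by apply: contraR; rewrite ltn_ord andbT => /(of_list0 m) ->.
    by rewrite -[j](inordK (n' := p)) // -sumE e /g inord_val inordK.
  apply/ffunP => w; have [i [j ->]] := vtx_onto w.
  have [_ sums] := validP _ _ _ (val_m i).
  by rewrite sumE sums ?ltn_ord //; [rewrite /g !inord_val|rewrite -ltnS].
rewrite /z to_of expfzDr ?qhalf_neq0 // -mulrA; congr (_ * _).
rewrite -(big_listing _ (F := fun i J => (qpoch q (of_list m i J))^-1)); last first.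
  by move=> i J /of_list0 ->; rewrite qpoch0 invr1.
rewrite -exprnP -prodrXr -big_split; apply: eq_bigr => r _ /=.
have -> : of_list m (line (phi r)) (seg_itv (phi r)) = m r.
  by have /ffunP/(_ r) := to_of m; rewrite ffunE.
by [].
Qed.

End Listing.

(** * Horizontal and vertical listings *)

Theorem theorem6p1 (n n' : nat) (hn : (1 <= n)%N) (hn' : (1 <= n')%N)
  (phi : 'I_((n * n' * n'.+1) %/ 2) -> hroot n n')
  (phi_listing : bijective phi)
  (phi_same : forall r s : 'I_((n * n' * n'.+1) %/ 2), (r < s)%N ->
     line (phi r) = line (phi s) -> 0 <= lambda (hdim (phi r)) (hdim (phi s)))
  (phi_diff : forall r s : 'I_((n * n' * n'.+1) %/ 2), (r < s)%N ->
     line (phi r) <> line (phi s) -> lambda (hdim (phi r)) (hdim (phi s)) <= 0)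
  (psi : 'I_((n' * n * n.+1) %/ 2) -> vroot n n')
  (psi_listing : bijective psi)
  (psi_same : forall r s : 'I_((n' * n * n.+1) %/ 2), (r < s)%N ->
     line (psi r) = line (psi s) -> 0 <= lambda (vdim (psi r)) (vdim (psi s)))
  (psi_diff : forall r s : 'I_((n' * n * n.+1) %/ 2), (r < s)%N ->
     line (psi r) <> line (psi s) -> lambda (vdim (psi r)) (vdim (psi s)) <= 0) :
  \prod_(r < (n * n' * n'.+1) %/ 2) dilog (y (hdim (phi r))) =
  \prod_(r < (n' * n * n.+1) %/ 2) dilog (y (vdim (psi r))).
Proof.
move: phi phi_listing phi_same phi_diff psi psi_listing psi_same psi_diff.
case: n hn => // m _; case: n' hn' => // p _.
move=> phi phi_listing phi_same phi_diff psi psi_listing psi_same psi_diff.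
apply: qalgP => d.
have rows_onto (w : vertex m.+1 p.+1) : exists i j, w = (i, j) by case: w => i j; exists i, j.
have cols_onto (w : vertex m.+1 p.+1) : exists i j, w = (j, i) by case: w => i j; exists j, i.
have [z zE ->] := coef_listing_product rows_onto (@hdimE m p) (@hdim_lambda m p)
  phi_listing phi_same phi_diff (leqnn (weight d)).
have [z' zE' ->] := coef_listing_product cols_onto (fun x j i => vdimE x i j) (@vdim_lambda m p)
  psi_listing psi_same psi_diff (leqnn (weight d)).
congr (- _); apply/esym/(half_grid_sum_tr (delta := false)) => // i j.
exact: leq_weight.
Qed.
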